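(* Consider the closed-loop system described in the context, and let $r_e\in\mathbb{R}$, $d_e\in L^2(0,L)$. Assume that $r(t)\to r_e$, $d(t)\to d_e$ and $\dot d(t)\to0$ (the last two in $L^2(0,L)$) as $t\to+\infty$. Then $y_x(t,0)\to r_e$ as $t\to+\infty$, with exponential vanishing of the contribution of the initial conditions; that is, for all $t\geq0$, $$\vert y_x(t,0)-r_e\vert\leq Ce^{-\kappa t}\left(\vert\Delta u_D(0)\vert+\vert\Delta\zeta(0)\vert+\Vert\Delta w(0)\Vert_{H_0^1(0,L)}+\Vert\mathcal{A}\Delta w(0)\Vert_{L^2(0,L)}\right)+\rho(t),$$ where $C,\kappa>0$ are constants that do not depend on the initial conditions $(y_0,z_0)$ nor on $r,d$, and $\rho(t)\to0$ as $t\to+\infty$ with $\rho$ not depending on the initial conditions $(y_0,z_0)$.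
   Context: Notation. $\mathbb{R}_+=[0,+\infty)$, $\mathbb{N}=\{0,1,2,\dots\}$. Fix $L>0$, $D>0$ and a real-valued $c\in L^\infty(0,L)$. $\langle f,g\rangle=\int_0^L f(x)g(x)\,dx$ on $L^2(0,L)$; $\Vert f\Vert_{H_0^1(0,L)}=\Vert f'\Vert_{L^2(0,L)}$; $\dot d$ is the time derivative of $d$. Spectral data. $\mathcal{A}f=f''+cf$ on $D(\mathcal{A})=H^2(0,L)\cap H_0^1(0,L)$, a self-adjoint operator with compact resolvent in $L^2(0,L)$. $(e_j)_{j\geq1}$ is a Hilbert basis of $L^2(0,L)$ of real eigenfunctions, $\mathcal{A}e_j=\lambda_je_j$, with $\lambda_1>\lambda_2>\cdots\to-\infty$. $n\in\mathbb{N}$ is the integer with $\lambda_j\geq0$ for $1\leq j\leq n$ and $\lambda_j\leq\lambda_{n+1}<0$ for $j\geq n+1$ ($n=0$ allowed). Put $a(x)=\frac{x}{L}c(x)$, $b(x)=-\frac{x}{L}$, $a_j=\langle a,e_j\rangle$, $b_j=\langle b,e_j\rangle$, $\alpha=\frac1L-\sum_{j\geq n+1}\frac{e_j'(0)}{\lambda_j}a_j$, $\beta=-\sum_{j\geq n+1}\frac{e_j'(0)}{\lambda_j}b_j$. Matrices. $A_1\in\mathbb{R}^{(n+1)\times(n+1)}$ has zero first row, first column $(0,a_1,\dots,a_n)^\top$, and lower-right $n\times n$ block $\mathrm{diag}(\lambda_1,\dots,\lambda_n)$; $B_1=(1,b_1,\dots,b_n)^\top$; $L_1=(\alpha,e_1'(0),\dots,e_n'(0))$;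 $A=\begin{pmatrix}A_1&0\\L_1&0\end{pmatrix}\in\mathbb{R}^{(n+2)\times(n+2)}$, $B=\begin{pmatrix}B_1\\\beta\end{pmatrix}\in\mathbb{R}^{n+2}$. A gain $K\in\mathbb{R}^{1\times(n+2)}$ is fixed such that $A_K=A+e^{-DA}BK$ is Hurwitz. Closed-loop system. Data: $r:\mathbb{R}_+\to\mathbb{R}$ continuous, $d:\mathbb{R}_+\to L^2(0,L)$ continuously differentiable, $y_0\in H^2(0,L)\cap H_0^1(0,L)$, $z_0\in\mathbb{R}$. The system is $y_t=y_{xx}+c(x)y+d(t,x)$, $\dot z(t)=y_x(t,0)-r(t)$, $y(t,0)=0$, $y(t,L)=u_D(t):=u(t-D)$, $y(0,\cdot)=y_0$, $z(0)=z_0$, where $u(t)=0$ for $t<0$ and $u(t)=\int_0^tv(\tau)\,d\tau$ for $t\geq0$. Write $v_D(t)=v(t-D)$, $w(t,x)=y(t,x)-\frac{x}{L}u_D(t)$, $w_j(t)=\langle w(t,\cdot),e_j\rangle$, $\zeta(t)=z(t)-\sum_{j\geq n+1}\frac{e_j'(0)}{\lambda_j}w_j(t)$, $X=(u_D,w_1,\dots,w_n,\zeta)^\top\in\mathbb{R}^{n+2}$. The control is $v(t)=0$ for $t<0$ and $v(t)=KZ(t)$ for $t\geq0$, with $Z(t)=X(t)+\int_{t-D}^te^{A(t-D-\tau)}Bv(\tau)\,d\tau$. Thus $w_t=\mathcal{A}w+a\,u_D+b\,v_D+d$ with $w(t,\cdot)\in D(\mathcal{A})$, $w(0)=y_0$,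 and $\dot z(t)=w_x(t,0)+\frac1Lu_D(t)-r(t)$. Equilibrium and deviations. For $r_e\in\mathbb{R}$, $d_e\in L^2(0,L)$, let $d_{e,j}=\langle d_e,e_j\rangle$, $\Gamma_e=\big(0,d_{e,1},\dots,d_{e,n},-r_e-\sum_{j\geq n+1}\frac{e_j'(0)}{\lambda_j}d_{e,j}\big)^\top$, $Z_e=X_e=-A_K^{-1}\Gamma_e=:(u_e,w_{1,e},\dots,w_{n,e},\zeta_e)^\top$, $w_{j,e}=-\frac{a_j}{\lambda_j}u_e-\frac{d_{e,j}}{\lambda_j}$ for $j\geq n+1$, $w_e=\sum_{j\geq1}w_{j,e}e_j\in D(\mathcal{A})$. Deviations: $\Delta u_D=u_D-u_e$, $\Delta\zeta=\zeta-\zeta_e$, $\Delta w=w-w_e$. *)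

(* Defs.v *)
From HB Require Import structures.
From mathcomp Require Import all_boot all_order all_algebra.
From mathcomp Require Import all_classical all_reals all_analysis.
From mathcomp Require Import complex.

Set Implicit Arguments.
Unset Strict Implicit.
Unset Printing Implicit Defensive.

Import Order.TTheory GRing.Theory Num.Theory.
Import numFieldNormedType.Exports.

Local Open Scope classical_set_scope.
Local Open Scope ring_scope.

(* An element of L^p(0,L) is represented by a function R -> R, of which only
   the restriction to ]0, L[ matters. *)
Definition in_Lp (R : realType) (L : R) (p : \bar R) (f : R -> R) : Prop :=
  f \_ `]0, L[ \in Lfun (@lebesgue_measure R) p.

Definition in_L2 (R : realType) (L : R) (f : R -> R) : Prop := in_Lp L 2%:E f.

Definition L2norm (R : realType) (L : R) (f : R -> R) : R :=
  fine 'N[@lebesgue_measure R]_2%:E[EFin \o f \_ `]0, L[].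

Definition L2inner (R : realType) (L : R) (f g : R -> R) : R :=
  (\int[@lebesgue_measure R]_(x in `]0, L[) (f x * g x))%R.

(* f is the continuous representative on [0, L] of an element of H^1(0,L),
   i.e. an absolutely continuous function, and g is its derivative in L^2. *)
Definition is_H1 (R : realType) (L : R) (f g : R -> R) : Prop :=
  in_L2 L g /\
  forall x, 0 <= x <= L ->
    f x = f 0 + (\int[@lebesgue_measure R]_(s in `]0, x[) g s)%R.

(* f is in H^2(0,L), f1 the continuous representative of f' (so that f1 0 is the
   boundary value f'(0)), f2 a representative of f''. *)
Definition is_H2 (R : realType) (L : R) (f f1 f2 : R -> R) : Prop :=
  is_H1 L f f1 /\ is_H1 L f1 f2.

(* f in H^2(0,L) /\ H^1_0(0,L), the domain of the operator A. *)
Definition is_domA (R : realType) (L : R) (f f1 f2 : R -> R) : Prop :=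
  [/\ is_H2 L f f1 f2, f 0 = 0 & f L = 0].

(* A f = f'' + c f, where f2 stands for f''. *)
Definition opA (R : realType) (c f f2 : R -> R) : R -> R :=
  fun x => f2 x + c x * f x.

Definition L2cvg (R : realType) (L : R) (T : Type) (F : set_system T)
    (f : T -> R -> R) (g : R -> R) : Prop :=
  L2norm L (fun x => f s x - g x) @[s --> F] --> 0.

(* The limits are taken within [0, +oo[, hence one-sided at t = 0. *)
Definition L2continuous_at (R : realType) (L : R) (f : R -> R -> R) (t : R) :
    Prop :=
  L2cvg L (within [set s | 0 <= s] (nbhs t)) f (f t).

Definition L2derivative_at (R : realType) (L : R) (f : R -> R -> R) (t : R)
    (g : R -> R) : Prop :=
  L2cvg L (within [set s | 0 <= s] t^')
    (fun s x => (s - t)^-1 * (f s x - f t x)) g.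

Definition L2C1 (R : realType) (L : R) (f f' : R -> R -> R) : Prop :=
  forall t, 0 <= t ->
    [/\ in_L2 L (f t), in_L2 L (f' t), L2derivative_at L f t (f' t)
      & L2continuous_at L f' t].

Definition expm (R : realType) (n : nat) (M : 'M[R]_n) : 'M[R]_n :=
  \matrix_(i, j)
    limn (fun N => (\sum_(k < N) (k`!%:R)^-1 *: (M ^+ k : 'M[R]_n)) i j).

Definition Hurwitz (R : realType) (n : nat) (M : 'M[R]_n) : Prop :=
  forall z : R[i], eigenvalue (map_mx (real_complex R) M) z -> complex.Re z < 0.

(* L, D, c and the eigenelements of A f = f'' + c f; peig1 and peig2 are the
   first and second derivatives of the eigenfunctions.  Eigenpairs are numbered
   from 0: (plam j, peig j) is the pair (lambda_(j+1), e_(j+1)).  Thus the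
   nonnegative eigenvalues are those with j < pn, and sums over indices
   >= n + 1 become sums over j >= pn. *)
Record plant (R : realType) := Plant {
  pL : R;
  pD : R;
  pc : R -> R;
  plam : nat -> R;
  peig : nat -> R -> R;
  peig1 : nat -> R -> R;
  peig2 : nat -> R -> R;
  pn : nat }.

Definition Hilbert_basis (R : realType) (L : R) (e : nat -> R -> R) : Prop :=
  [/\ forall j, in_L2 L (e j),
      forall i j, L2inner L (e i) (e j) = (i == j)%:R
    & forall f, in_L2 L f -> forall eps, 0 < eps ->
        exists (N : nat) (q : nat -> R),
          L2norm L (fun x => f x - \sum_(j < N) q j * e j x) < eps].

Definition plant_ok (R : realType) (P : plant R) : Prop :=
  [/\ 0 < pL P, 0 < pD P & in_Lp (pL P) +oo%E (pc P)] /\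
  [/\ Hilbert_basis (pL P) (peig P),
      forall j, is_domA (pL P) (peig P j) (peig1 P j) (peig2 P j)
    & forall j, {ae @lebesgue_measure R, forall x, 0 < x < pL P ->
        opA (pc P) (peig P j) (peig2 P j) x = plam P j * peig P j x}] /\
  [/\ forall i j, (i < j)%N -> plam P j < plam P i,
      plam P j @[j --> \oo] --> -oo,
      forall j, (j < pn P)%N -> 0 <= plam P j
    & forall j, (pn P <= j)%N -> plam P j <= plam P (pn P) < 0].

Definition coeff (R : realType) (P : plant R) (f : R -> R) (j : nat) : R :=
  L2inner (pL P) f (peig P j).

Definition acoef (R : realType) (P : plant R) (j : nat) : R :=
  coeff P (fun x => x / pL P * pc P x) j.

Definition bcoef (R : realType) (P : plant R) (j : nat) : R :=
  coeff P (fun x => - (x / pL P)) j.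

(* sum_(j >= n+1) e_j'(0) / lambda_j * q_j *)
Definition tail_sum (R : realType) (P : plant R) (q : nat -> R) : R :=
  limn (fun N => \sum_(pn P <= j < N) peig1 P j 0 / plam P j * q j).

Definition alpha (R : realType) (P : plant R) : R :=
  (pL P)^-1 - tail_sum P (acoef P).

Definition beta_ (R : realType) (P : plant R) : R := - tail_sum P (bcoef P).

Definition matA1 (R : realType) (P : plant R) : 'M[R]_(1 + pn P) :=
  block_mx 0                                (0 : 'M[R]_(1, pn P))
           (\col_(j < pn P) acoef P j) (diag_mx (\row_(j < pn P) plam P j)).

Definition matB1 (R : realType) (P : plant R) : 'cV[R]_(1 + pn P) :=
  col_mx 1%:M (\col_(j < pn P) bcoef P j).

Definition matL1 (R : realType) (P : plant R) : 'rV[R]_(1 + pn P) :=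
  row_mx (alpha P)%:M (\row_(j < pn P) peig1 P j 0).

Definition matA (R : realType) (P : plant R) : 'M[R]_(1 + pn P + 1) :=
  block_mx (matA1 P) 0
           (matL1 P) 0.

Definition matB (R : realType) (P : plant R) : 'cV[R]_(1 + pn P + 1) :=
  col_mx (matB1 P) (beta_ P)%:M.

Definition matAK (R : realType) (P : plant R) (K : 'rV[R]_(1 + pn P + 1)) :
    'M[R]_(1 + pn P + 1) :=
  matA P + expm (- pD P *: matA P) *m matB P *m K.

(* y, y_x, y_xx (as functions of time, then space), z and v. *)
Record traj (R : realType) := Traj {
  ty : R -> R -> R;
  tyx : R -> R -> R;
  tyxx : R -> R -> R;
  tz : R -> R;
  tv : R -> R }.

Definition uinput (R : realType) (T : traj R) (t : R) : R :=
  if t < 0 then 0 else (\int[@lebesgue_measure R]_(s in `[0, t]) tv T s)%R.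

Definition uD (R : realType) (P : plant R) (T : traj R) (t : R) : R :=
  uinput T (t - pD P).

Definition w (R : realType) (P : plant R) (T : traj R) (t x : R) : R :=
  ty T t x - x / pL P * uD P T t.

Definition wx (R : realType) (P : plant R) (T : traj R) (t x : R) : R :=
  tyx T t x - (pL P)^-1 * uD P T t.

Definition wxx (R : realType) (T : traj R) (t x : R) : R := tyxx T t x.

Definition zeta (R : realType) (P : plant R) (T : traj R) (t : R) : R :=
  tz T t - tail_sum P (coeff P (w P T t)).

(* Stacks (u, (w_1, ..., w_n), s) into a vector of R^(n+2). *)
Definition stack (R : realType) (n : nat) (u : R) (q : nat -> R) (s : R) :
    'cV[R]_(1 + n + 1) :=
  col_mx (col_mx u%:M (\col_(j < n) q j)) s%:M.

Definition Xstate (R : realType) (P : plant R) (T : traj R) (t : R) :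
    'cV[R]_(1 + pn P + 1) :=
  stack (pn P) (uD P T t) (coeff P (w P T t)) (zeta P T t).

Definition Zstate (R : realType) (P : plant R) (T : traj R) (t : R) :
    'cV[R]_(1 + pn P + 1) :=
  Xstate P T t +
  \col_i (\int[@lebesgue_measure R]_(s in `[(t - pD P), t])
    ((expm ((t - pD P - s) *: matA P) *m matB P) i 0 * tv T s))%R.

(* The control v jumps at time 0 (from 0 to K Z(0)), hence v_D jumps at time
   D, where y_t has only one-sided limits: the evolution equation is required
   to hold in L^2(0,L) at every t > 0 other than D, and y is continuous in
   L^2(0,L) on the whole of [0, +oo[. *)
Definition closed_loop (R : realType) (P : plant R)
    (K : 'rV[R]_(1 + pn P + 1)) (r : R -> R) (d : R -> R -> R)
    (y0 : R -> R) (z0 : R) (T : traj R) : Prop :=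
  [/\ forall t, 0 < t ->
        (@lebesgue_measure R).-integrable `[0, t] (EFin \o tv T),
      forall t, t < 0 -> tv T t = 0
    & forall t, 0 <= t -> tv T t = (K *m Zstate P T t) 0 0] /\
  [/\ forall t, 0 <= t -> is_H2 (pL P) (ty T t) (tyx T t) (tyxx T t),
      forall t, 0 <= t -> ty T t 0 = 0 /\ ty T t (pL P) = uD P T t,
      forall t, 0 <= t -> L2continuous_at (pL P) (ty T) t,
      forall t, 0 < t -> t != pD P ->
        L2derivative_at (pL P) (ty T) t
          (fun x => tyxx T t x + pc P x * ty T t x + d t x)
    & forall x, 0 <= x <= pL P -> ty T 0 x = y0 x] /\
  [/\ {within `[0, +oo[, continuous (tz T)},
      forall t : R, 0 < t -> is_derive t 1 (tz T) (tyx T t 0 - r t)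
    & tz T 0 = z0].

Definition Gamma_e (R : realType) (P : plant R) (re : R) (de : R -> R) :
    'cV[R]_(1 + pn P + 1) :=
  stack (pn P) 0 (coeff P de) (- re - tail_sum P (coeff P de)).

Definition X_e (R : realType) (P : plant R) (K : 'rV[R]_(1 + pn P + 1))
    (re : R) (de : R -> R) : 'cV[R]_(1 + pn P + 1) :=
  - (invmx (matAK K) *m Gamma_e P re de).

Definition u_e (R : realType) (P : plant R) (K : 'rV[R]_(1 + pn P + 1))
    (re : R) (de : R -> R) : R :=
  usubmx (usubmx (X_e K re de)) 0 0.

Definition zeta_e (R : realType) (P : plant R) (K : 'rV[R]_(1 + pn P + 1))
    (re : R) (de : R -> R) : R :=
  dsubmx (X_e K re de) 0 0.

Definition wcoef_e (R : realType) (P : plant R) (K : 'rV[R]_(1 + pn P + 1))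
    (re : R) (de : R -> R) (j : nat) : R :=
  if insub j is Some i then dsubmx (usubmx (X_e K re de)) i 0
  else - (acoef P j / plam P j) * u_e K re de - coeff P de j / plam P j.

(* we = sum_j w_(j,e) e_j in L^2(0,L), as an element of the domain of A with
   derivatives we1, we2. *)
Definition is_w_e (R : realType) (P : plant R) (K : 'rV[R]_(1 + pn P + 1))
    (re : R) (de : R -> R) (we we1 we2 : R -> R) : Prop :=
  is_domA (pL P) we we1 we2 /\
  L2cvg (pL P) \oo
    (fun N x => \sum_(j < N) wcoef_e K re de j * peig P j x) we.

(* |Delta u_D(0)| + |Delta zeta(0)| + ||Delta w(0)||_(H^1_0)
   + ||A Delta w(0)||_(L^2) *)
Definition initial_deviation (R : realType) (P : plant R)
    (K : 'rV[R]_(1 + pn P + 1)) (re : R) (de we we1 we2 : R -> R)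
    (T : traj R) : R :=
  `|uD P T 0 - u_e K re de| + `|zeta P T 0 - zeta_e K re de|
  + L2norm (pL P) (fun x => wx P T 0 x - we1 x)
  + L2norm (pL P) (opA (pc P) (fun x => w P T 0 x - we x)
                              (fun x => wxx T 0 x - we2 x)).

(* Main.v *)
Require Import Defs.
From HB Require Import structures.
From mathcomp Require Import all_boot all_order all_algebra.
From mathcomp Require Import all_classical all_reals all_analysis.
From mathcomp Require Import complex.
From mathcomp Require Import measurable_realfun ess_sup_inf ring lra.

Set Implicit Arguments.
Unset Strict Implicit.
Unset Printing Implicit Defensive.

Import Order.TTheory GRing.Theory Num.Theory.
Import numFieldNormedType.Exports.

Local Open Scope classical_set_scope.
Local Open Scope ring_scope.

(** The slope at the left end deviates from its target by
[[
  y_x(t,0) - r_e = Du(t) / L + sum_(j < n) e_j'(0) Dw_j(t)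
                   + sum_(j >= n) (e_j'(0) / lambda_j) <A Dw(t), e_j>
]]
    where Du and Dw are the deviations of u_D and w (modes are numbered from 0
    and n is [pn P]).  This is [slope_deviation], a consequence of the modal
    expansion [left_slope_modal] of f'(0) for f in the domain of A.  The weights
    e_j'(0) / lambda_j are square summable, because f'(0) is obtained by pairing
    f and A f with fixed functions of L2; hence the tail is bounded by the L2
    norm of the high modes of A Dw ([tail_sum_bound]), and it is enough to make
    Du, finitely many Dw_j, and this norm decay.

    The first two are coordinates of the state X of the finite-dimensional
    model.  The predictor state Z satisfies the delay-free equation
    Z' = A_K Z + Gamma ([Zstate_is_derive]), whose equilibrium X_e is such that
    K X_e = 0, so the Hurwitz matrix A_K makes Z - X_e decay ([Hurwitz_decay]),
    then the control v = K (Z - X_e), then the predictor integral over a window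
    of length D, and finally X - X_e.

    The high modes of A Dw are out of reach of the variation of constants
    formula for Dw_j, which would only bound Dw in L2.  They are recovered from
    the time derivative of the modes: m_j = lambda_j w_j + a_j u_D + d_j satisfies
[[
  m_j' = lambda_j (m_j + b_j v_D) + a_j v_D + d_j',
]]
    and after time D, when v_D has become differentiable, m_j + b_j v_D obeys a
    similar equation without the unbounded factor in front of v_D.  All the source
    coefficients are square summable, so the energy of any finite set of high modes
    obeys a Gronwall inequality that does not depend on the number of modes
    ([decays_rate]).  Up to decaying terms lambda_j Dw_j is m_j, which is the bound
    wanted ([decays_Adw]).

    Every estimate has the form [decays]: a squared quantity is at most
    C J^2 exp (- k t) + rho t, where J is the initial deviation, C only depends on
    the plant and the gain, and rho on r and d as well.  The functions rho are kept
    nonincreasing with limit 0 ([vanishing]), a class that is stable under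
    everything that the proof does to them, Gronwall's inequality included
    ([decay_step]).  A square root gives the theorem. *)

(** * Continuity on a subset of the line *)

Section within_continuity.
Context {R : realType}.
Variable A : set R.
Implicit Types f g : R -> R.

Lemma within_continuousDr f g : {within A, continuous f} ->
  {within A, continuous g} -> {within A, continuous (fun x => f x + g x)}.
Proof. exact: within_continuousD. Qed.

Lemma within_continuousBr f g : {within A, continuous f} ->
  {within A, continuous g} -> {within A, continuous (fun x => f x - g x)}.
Proof. exact: within_continuousB. Qed.

Lemma within_continuousM f g : {within A, continuous f} ->
  {within A, continuous g} -> {within A, continuous (fun x => f x * g x)}.
Proof.
move=> /subspace_continuousP cf /subspace_continuousP cg.
by apply/subspace_continuousP => x Ax; apply: cvgM; [exact: cf|exact: cg].
Qed.

Lemma within_continuous_cst a : {within A, continuous (fun=> a : R)}.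
Proof. by apply/subspace_continuousP => x Ax; exact: cvg_cst. Qed.

Lemma within_continuousZ a f : {within A, continuous f} ->
  {within A, continuous (fun x => a * f x)}.
Proof. by move=> cf; apply: within_continuousM => //; exact: within_continuous_cst. Qed.

Lemma within_continuous_sum (I : Type) (r : seq I) (P : pred I) (f : I -> R -> R) :
  (forall i, P i -> {within A, continuous (f i)}) ->
  {within A, continuous (fun x => \sum_(i <- r | P i) f i x)}.
Proof.
move=> cf; elim: r => [|i r ih].
  by under eq_fun do rewrite big_nil; exact: within_continuous_cst.
under eq_fun do rewrite big_cons.
case: (boolP (P i)) => // Pi; by apply: within_continuousDr => //; exact: cf.
Qed.

Lemma continuous_within f : continuous f -> {within A, continuous f}.
Proof. by move=> cf; exact: continuous_subspaceT. Qed.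

End within_continuity.

(** * The space L2(0, L) *)

(** Both Cauchy-Schwarz inequalities below, for integrals and for finite sums, come
    down to this. *)
Lemma discriminant_le (R : realFieldType) (a b c : R) : 0 <= a -> 0 <= b ->
  (forall s t, 0 <= s ^+ 2 * a + 2 * s * t * c + t ^+ 2 * b) -> c ^+ 2 <= a * b.
Proof.
move=> a0 b0 q; have [b00|bN0] := eqVneq b 0.
  have [->|cN0] := eqVneq c 0; first by rewrite expr0n/= mulr_ge0.
  have := q 1 (- (a + 1) / c); rewrite b00 mulr0 addr0.
  have -> : 1 ^+ 2 * a + 2 * 1 * (- (a + 1) / c) * c = - a - 2 by field.
  by move=> ?; exfalso; lra.
have := q b (- c).
have -> : b ^+ 2 * a + 2 * b * - c * c + (- c) ^+ 2 * b = b * (a * b - c ^+ 2).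
  by ring.
by rewrite pmulr_rge0 ?subr_ge0// lt_neqAle eq_sym bN0.
Qed.

Section L2_space.
Context {R : realType}.
Variable L : R.
Let mu : {measure set (measurableTypeR R) -> \bar R} := @lebesgue_measure R.
Let D : set (measurableTypeR R) := `]0, L[%classic.
Implicit Types f g h : R -> R.

Let mD : measurable D.
Proof. exact: measurable_itv. Qed.

Let muD : (mu D < +oo)%E.
Proof.
rewrite [mu D]lebesgue_measure_itv/=.
by case: ifPn => _; rewrite ?ltry// -EFinD ltry.
Qed.

Lemma in_L2_measurable f : in_L2 L f -> measurable_fun D f.
Proof.
rewrite /in_L2 /in_Lp inE => /andP[]; rewrite inE/= => mf _.
exact/(measurable_restrictT _ mD).
Qed.

Lemma in_L2_mul_integrable f g : in_L2 L f -> in_L2 L g ->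
  mu.-integrable D (EFin \o (fun x => f x * g x)).
Proof.
move=> f2 g2.
have /Lfun1_integrable h := Lfun2_mul_Lfun1 f2 g2.
apply/(integrable_mkcond _ mD); rewrite restrict_EFin.
apply: eq_integrable h => // x _ /=.
by rewrite !patchE; case: ifP => //; rewrite mulr0.
Qed.

Lemma in_L2_integrable_sqr f : in_L2 L f ->
  mu.-integrable D (EFin \o (fun x => f x ^+ 2)).
Proof.
move=> f2; have := in_L2_mul_integrable f2 f2.
by apply: eq_integrable => // x _; rewrite /= expr2.
Qed.

Lemma in_L2_intro f : measurable_fun D f ->
  mu.-integrable D (EFin \o (fun x => f x ^+ 2)) -> in_L2 L f.
Proof.
move=> mf /integrableP[_ fi].
rewrite /in_L2 /in_Lp inE; apply/andP; split; rewrite inE/=.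
  exact/(measurable_restrictT _ mD).
rewrite /finite_norm unlock; apply: poweR_lty.
apply: le_lt_trans fi; rewrite [leRHS]integral_mkcond.
apply: ge0_le_integral => //=.
- apply/measurable_EFinP.
  apply/(@measurableT_comp _ _ _ _ _ _ (fun x : R => x `^ 2)%R) => //.
  exact/measurableT_comp/(measurable_restrictT _ mD).
- apply/(measurable_restrictT _ mD); apply: measurableT_comp => //.
  apply: measurableT_comp => //; exact: measurable_funX.
- move=> x _; rewrite !patchE; case: ifP => _ /=.
    by rewrite normrX powR_mulrn.
  by rewrite normr0 powR0.
Qed.

Lemma in_L2_bounded (M : R) f : measurable_fun D f -> (forall x, D x -> `|f x| <= M) ->
  in_L2 L f.
Proof.
move=> mf fM; apply: in_L2_intro => //.
apply: measurable_bounded_integrable => //; first exact: measurable_funX.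
exists (M ^+ 2); split; first by rewrite num_real.
move=> y My x Dx /=; rewrite normrX (le_trans _ (ltW My))//.
by rewrite lerXn2r ?nnegrE ?(le_trans _ (fM _ Dx)) ?fM.
Qed.

Lemma in_L2_cst a : in_L2 L (fun=> a).
Proof. exact: (@in_L2_bounded `|a|). Qed.

Lemma in_L2D f g : in_L2 L f -> in_L2 L g -> in_L2 L (f + g).
Proof.
move=> f2 g2; rewrite /in_L2 /in_Lp.
rewrite (_ : _ \_ _ = f \_ D + g \_ D); last first.
  by apply/funext => x; rewrite /GRing.add /= !patchE;
  case: ifP => //; rewrite /= addr0.
have := @Lfun_addr_closed _ _ R mu 2%:E.
move=> /(_ _)[|_]; first by rewrite lee_fin ler1n.
exact.
Qed.

Lemma in_L2Z a f : in_L2 L f -> in_L2 L (a *: f).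
Proof.
move=> f2; rewrite /in_L2 /in_Lp.
rewrite (_ : _ \_ _ = a \o* (f \_ D)); last first.
  apply/funext => x; rewrite /= !patchE; case: ifP => //; last by rewrite mul0r.
  by move=> _; rewrite mulrC.
by apply: Lfun_scale => //; rewrite ler1n.
Qed.

Lemma in_L2N f : in_L2 L f -> in_L2 L (- f).
Proof. by rewrite -scaleN1r; exact: in_L2Z. Qed.

Lemma in_L2B f g : in_L2 L f -> in_L2 L g -> in_L2 L (f - g).
Proof. by move=> f2 g2; apply: in_L2D => //; exact: in_L2N. Qed.

Lemma in_L2_sum (N : nat) (q : nat -> R) (e : nat -> R -> R) :
  (forall j, in_L2 L (e j)) -> in_L2 L (fun x => \sum_(j < N) q j * e j x).
Proof.
move=> e2; elim: N => [|N ih].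
  by under eq_fun do rewrite big_ord0; exact: in_L2_cst.
under eq_fun do rewrite big_ord_recr/=.
exact: (in_L2D ih (in_L2Z _ (e2 N))).
Qed.

Lemma in_L2M_Loo c f : in_Lp L +oo%E c -> in_L2 L f ->
  in_L2 L (fun x => c x * f x).
Proof.
rewrite {1}/in_Lp inE => /andP[]; rewrite inE/= => mc; rewrite inE/= => + f2.
rewrite /finite_norm unlock ifT; last first.
  apply: (@lt_le_trans _ _ (mu `[0, 1]%classic)).
    by rewrite [mu _]lebesgue_measure_itv/= lte_fin ltr01 oppr0 adde0 lte_fin.
  by apply: le_measure; rewrite ?inE.
move=> /(@ess_supr_bounded _ _ _ _ (fun x => `|(c \_ D) x|)) [M cM].
have mcD : measurable_fun D c by exact/(measurable_restrictT _ mD).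
have mf := in_L2_measurable f2.
apply: in_L2_intro; first exact: measurable_funM.
apply/integrableP; split.
  by apply: measurableT_comp => //; apply: measurable_funX; exact: measurable_funM.
have /integrableP[_ h] : mu.-integrable D (EFin \o (fun x => M ^+ 2 * f x ^+ 2)).
  have -> : (EFin \o (fun x => M ^+ 2 * f x ^+ 2)) =
    (fun x => (M ^+ 2)%:E * (EFin \o (fun x => f x ^+ 2)%R) x)%E by [].
  by apply: integrableZl => //; exact: in_L2_integrable_sqr.
apply: le_lt_trans h; apply: ae_ge0_le_integral => //.
- apply: measurableT_comp => //; apply: measurableT_comp => //.
  by apply: measurable_funX; exact: measurable_funM.
- apply: measurableT_comp => //; apply: measurableT_comp => //.
  by apply: measurable_funM => //; apply: measurable_funX.
apply: filterS cM => x /= + Dx; rewrite patchE ifT ?inE// => cM.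
rewrite lee_fin exprMn !normrM; apply: ler_wpM2r => //.
by apply: ler_pM => //; rewrite (le_trans cM)// ler_norm.
Qed.

Lemma in_L2_integrable f : in_L2 L f -> mu.-integrable D (EFin \o f).
Proof.
move=> f2; have := in_L2_mul_integrable f2 (in_L2_cst 1).
by apply: eq_integrable => // x _ /=; rewrite mulr1.
Qed.

(** * Inner product *)

Lemma L2innerC f g : L2inner L f g = L2inner L g f.
Proof. by apply: eq_Rintegral => x _; rewrite mulrC. Qed.

Lemma L2innerDl f g h : in_L2 L f -> in_L2 L g -> in_L2 L h ->
  L2inner L (f + g) h = L2inner L f h + L2inner L g h.
Proof.
move=> f2 g2 h2; rewrite -RintegralD//; try exact: in_L2_mul_integrable.
by apply: eq_Rintegral => x _; rewrite -mulrDl.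
Qed.

Lemma L2innerZl a f g : in_L2 L f -> in_L2 L g ->
  L2inner L (a *: f) g = a * L2inner L f g.
Proof.
move=> f2 g2; rewrite -RintegralZl//; try exact: in_L2_mul_integrable.
by apply: eq_Rintegral => x _; rewrite /= -mulrA.
Qed.

Lemma L2innerDr f g h : in_L2 L f -> in_L2 L g -> in_L2 L h ->
  L2inner L h (f + g) = L2inner L h f + L2inner L h g.
Proof. by move=> *; rewrite !(L2innerC h) L2innerDl. Qed.

Lemma L2innerZr a f g : in_L2 L f -> in_L2 L g ->
  L2inner L g (a *: f) = a * L2inner L g f.
Proof. by move=> *; rewrite !(L2innerC g) L2innerZl. Qed.

Lemma L2innerBl f g h : in_L2 L f -> in_L2 L g -> in_L2 L h ->
  L2inner L (f - g) h = L2inner L f h - L2inner L g h.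
Proof.
by move=> f2 g2 h2; rewrite -scaleN1r L2innerDl//; [rewrite L2innerZl// mulN1r|exact: in_L2Z].
Qed.

Lemma L2inner_suml (N : nat) (q : nat -> R) (e : nat -> R -> R) g :
  (forall j, in_L2 L (e j)) -> in_L2 L g ->
  L2inner L (fun x => \sum_(j < N) q j * e j x) g =
  \sum_(j < N) q j * L2inner L (e j) g.
Proof.
move=> e2 g2; elim: N => [|N ih].
  rewrite big_ord0 /L2inner; under eq_Rintegral do rewrite big_ord0 mul0r.
  by rewrite Rintegral_cst// mul0r.
rewrite big_ord_recr/= -ih -L2innerZl// -L2innerDl//.
- by congr L2inner; apply/funext => x; rewrite big_ord_recr.
- exact: in_L2_sum.
- exact: in_L2Z.
Qed.

Lemma L2inner_ae_eq f g h : in_L2 L f -> in_L2 L g -> in_L2 L h ->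
  {ae @lebesgue_measure R, forall x, 0 < x < L -> f x = g x} -> L2inner L f h = L2inner L g h.
Proof.
move=> f2 g2 h2 fg; congr fine; apply: ae_eq_integral => //.
- by have /integrableP[] := in_L2_mul_integrable f2 h2.
- by have /integrableP[] := in_L2_mul_integrable g2 h2.
move: fg; apply: filterS; first exact: (ae_filter_ringOfSetsType mu).
by move=> x /= fg; rewrite in_itv/= => /fg ->.
Qed.

Lemma L2inner_ge0 f : 0 <= L2inner L f f.
Proof. by apply: Rintegral_ge0 => x _; rewrite -expr2 sqr_ge0. Qed.

Lemma L2norm_ge0 f : 0 <= L2norm L f.
Proof. by apply: fine_ge0; exact: Lnorm_ge0. Qed.

Lemma L2norm_sqr f : in_L2 L f -> L2norm L f ^+ 2 = L2inner L f f.
Proof.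
move=> f2.
have h := @powR_Lnorm _ _ R mu (EFin \o f \_ D) 2 (_ : 2 != 0).
have Nfin : ('N[mu]_2%:E[EFin \o f \_ D])%E \is a fin_num.
  rewrite ge0_fin_numE ?Lnorm_ge0//.
  by move: f2; rewrite /in_L2 /in_Lp inE => /andP[_]; rewrite inE.
rewrite /L2norm -powR_mulrn ?fine_ge0 ?Lnorm_ge0//.
have : ((fine ('N[mu]_2%:E[EFin \o f \_ D])%E) `^ 2)%:E =
    (\int[mu]_x (`|(f \_ D) x| `^ 2)%:E)%E.
  by rewrite -h// -{2}(fineK Nfin) poweR_EFin.
move=> /(congr1 fine)/= ->.
rewrite /L2inner [RHS]Rintegral_mkcond; congr fine; apply: eq_integral => x _.
rewrite !patchE; case: ifP => _; rewrite ?normr0 ?powR0//.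
by rewrite powR_mulrn// real_normK ?num_real// expr2.
Qed.

Lemma Cauchy_Schwarz f g : in_L2 L f -> in_L2 L g ->
  `|L2inner L f g| <= L2norm L f * L2norm L g.
Proof.
move=> f2 g2.
suff h : L2inner L f g ^+ 2 <= L2inner L f f * L2inner L g g.
  rewrite -(@ler_pXn2r _ 2)// ?nnegrE ?mulr_ge0 ?L2norm_ge0//.
  by rewrite real_normK ?num_real// exprMn !L2norm_sqr.
have q a b : 0 <= a ^+ 2 * L2inner L f f + 2 * a * b * L2inner L f g
                  + b ^+ 2 * L2inner L g g.
  have := L2inner_ge0 (a *: f + b *: g).
  rewrite L2innerDl ?L2innerDr ?L2innerZl ?L2innerZr ?(L2innerC g f);
    do ?[exact: in_L2Z|exact: in_L2D|by []].
  - by congr (_ <= _); ring.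
  - by apply: in_L2D; exact: in_L2Z.
by apply: discriminant_le q; exact: L2inner_ge0.
Qed.

Lemma L2normZ a f : in_L2 L f -> L2norm L (a *: f) = `|a| * L2norm L f.
Proof.
move=> f2; apply/eqP; rewrite -(@eqrXn2 _ 2)// ?mulr_ge0 ?L2norm_ge0//.
rewrite exprMn real_normK ?num_real// !L2norm_sqr//; last exact: in_L2Z.
by rewrite L2innerZl// ?L2innerZr//; [rewrite mulrA expr2|exact: in_L2Z].
Qed.

Lemma L2normN f : in_L2 L f -> L2norm L (- f) = L2norm L f.
Proof. by move=> f2; rewrite -scaleN1r L2normZ// normrN1 mul1r. Qed.

Lemma L2normD f g : in_L2 L f -> in_L2 L g ->
  L2norm L (f + g) <= L2norm L f + L2norm L g.
Proof.
move=> f2 g2; rewrite -(@ler_pXn2r _ 2)// ?nnegrE ?addr_ge0 ?L2norm_ge0//.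
rewrite sqrrD !L2norm_sqr//; last exact: in_L2D.
rewrite L2innerDl ?L2innerDr//; last exact: in_L2D.
have := Cauchy_Schwarz f2 g2; have := ler_norm (L2inner L f g).
by rewrite (L2innerC g f) mulr2n; lra.
Qed.

Lemma L2norm_distC f g : in_L2 L f -> in_L2 L g ->
  L2norm L (f - g) = L2norm L (g - f).
Proof. by move=> f2 g2; rewrite -opprB L2normN//; exact: in_L2B. Qed.

End L2_space.

(** * Bounded linear functionals on L2(0, L) *)

Lemma shift_dnbhs (R : realType) (t : R) : shift t h @[h --> 0^'] --> t^'.
Proof.
move=> A [e /= e0 eA]; exists e => //= h /= he h0; apply: eA => /=.
  by move: he; rewrite sub0r normrN /shift opprD addrCA subrr addr0 normrN.
by rewrite /shift -subr_eq0 addrK.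
Qed.

Lemma is_derive_slope (R : realType) (f : R -> R) (t l : R) :
  (s - t)^-1 * (f s - f t) @[s --> t^'] --> l -> is_derive t 1 f l.
Proof.
move=> fl.
have h' : h^-1 *: ((f \o shift t) (h *: 1) - f t) @[h --> 0^'] --> l.
  rewrite (_ : (fun h : R => _) =
      (fun s => (s - t)^-1 * (f s - f t)) \o shift t); last first.
    by apply/funext => k /=; rewrite addrK -[k *: 1]/(k * 1) mulr1.
  by apply: cvg_comp fl; exact: shift_dnbhs.
apply: DeriveDef; last by apply: cvg_lim => //.
by apply/cvg_ex; exists l.
Qed.

Section functionals.
Context {R : realType}.
Variable L : R.
Implicit Types (f g h : R -> R) (phi : (R -> R) -> R).

(** Coefficients and tail sums are of this kind, so that limits, continuity and
    derivatives in L2 are transferred to all of them by the same lemmas. *)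
Definition bounded_functional phi :=
  (forall a f g, in_L2 L f -> in_L2 L g -> phi (a *: f + g) = a * phi f + phi g)
  /\ exists2 C, 0 <= C & forall f, in_L2 L f -> `|phi f| <= C * L2norm L f.

Section linearity.
Variable phi : (R -> R) -> R.
Hypothesis phi_bl : bounded_functional phi.

Lemma functionalZ a f : in_L2 L f -> phi (a *: f) = a * phi f.
Proof.
move=> f2; have phi0 : phi 0 = 0.
  have := phi_bl.1 1 0 0 (in_L2_cst L 0) (in_L2_cst L 0).
  by rewrite scaler0 addr0 mul1r => /esym/eqP; rewrite -subr_eq0 addrK => /eqP.
by rewrite -[a *: f]addr0 phi_bl.1 ?phi0 ?addr0//; exact: in_L2_cst.
Qed.

Lemma functionalD f g : in_L2 L f -> in_L2 L g -> phi (f + g) = phi f + phi g.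
Proof. by move=> f2 g2; rewrite -[X in phi (X + _)]scale1r phi_bl.1// mul1r. Qed.

Lemma functionalB f g : in_L2 L f -> in_L2 L g -> phi (f - g) = phi f - phi g.
Proof.
move=> f2 g2; rewrite functionalD//; last exact: in_L2N.
by rewrite -scaleN1r functionalZ// mulN1r.
Qed.

Lemma functional_cvg {T : Type} {F : set_system T} {FF : Filter F}
    (f : T -> R -> R) g :
  (\forall s \near F, in_L2 L (f s)) -> in_L2 L g -> L2cvg L F f g ->
  phi (f s) @[s --> F] --> phi g.
Proof.
move=> f2 g2 fg; case: phi_bl => _ [C C0 phiC].
apply/cvgrPdist_lt => /= e e0.
have C1 : 0 < C + 1 by apply: ltr_wpDl.
have /cvgrPdist_lt/(_ (e / (C + 1))) := fg.
rewrite divr_gt0// => /(_ isT) fge.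
near=> s; rewrite distrC -functionalB//; last by near: s.
apply: (le_lt_trans (phiC _ _)); first by apply: in_L2B => //; near: s.
apply: (@le_lt_trans _ _ ((C + 1) * L2norm L (fun x => f s x - g x))).
  by rewrite ler_wpM2r ?L2norm_ge0// lerDl.
rewrite mulrC -ltr_pdivlMr//.
have := near fge s; rewrite sub0r normrN => /(_ _).
by rewrite ger0_norm ?L2norm_ge0//; apply.
Unshelve. all: by end_near. Qed.

Lemma functional_is_derive (f : R -> R -> R) g t :
  0 < t -> (forall s, 0 <= s -> in_L2 L (f s)) -> in_L2 L g ->
  L2derivative_at L f t g -> is_derive t 1 (fun s => phi (f s)) (phi g).
Proof.
move=> t0 f2 g2 fg.
have near_ge0 : \forall s \near t^', 0 <= s.
  by apply: nbhs_dnbhs; exact: lt_le_nbhsr.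
have E : within [set s | 0 <= s] t^' = t^'.
  apply/seteqP; split => A /= hA; last exact: filterS hA.
  by move: near_ge0; apply: filter_app; exact: hA.
have : phi ((s - t)^-1 *: (f s - f t)) @[s --> t^'] --> phi g.
  apply: functional_cvg => //.
    by near=> s; apply: in_L2Z; apply: in_L2B; apply: f2; [near: s|exact: ltW].
  by move: fg; rewrite /L2derivative_at E.
move=> h; apply: is_derive_slope.
apply: cvg_trans h; apply: near_eq_cvg; near=> s.
rewrite functionalZ ?functionalB//; try exact: f2 (ltW t0).
- by apply: f2; near: s.
- by apply: in_L2B; apply: f2; [near: s|exact: ltW].
Unshelve. all: by end_near. Qed.
End linearity.
End functionals.

Section functional_examples.
Context {R : realType}.
Variable L : R.

Lemma bounded_functional_L2inner (g : R -> R) : in_L2 L g ->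
  bounded_functional L (fun f => L2inner L f g).
Proof.
move=> g2; split=> [a f h f2 h2|].
  by rewrite L2innerDl ?L2innerZl//; exact: in_L2Z.
exists (L2norm L g); first exact: L2norm_ge0.
by move=> f f2; rewrite mulrC Cauchy_Schwarz.
Qed.

End functional_examples.

Lemma L2norm_continuous (R : realType) (L : R) (f : R -> R -> R) (g : R -> R) :
  (forall t, 0 <= t -> in_L2 L (f t)) -> in_L2 L g ->
  (forall t, 0 <= t -> L2continuous_at L f t) ->
  {within `[0, +oo[, continuous (fun t => L2norm L (f t - g))}.
Proof.
move=> f2 g2 fc; apply/subspace_continuousP => t; rewrite /= in_itv/= andbT => t0.
have E : `[0, +oo[%classic = [set s : R | 0 <= s].
  by apply/seteqP; split => s /=; rewrite in_itv/= andbT.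
rewrite E; apply/cvgrPdist_lt => /= e e0.
have /cvgrPdist_lt/(_ e e0) := fc t t0.
apply: filter_app; near=> s; rewrite sub0r normrN ger0_norm ?L2norm_ge0//.
have s0 : 0 <= s by near: s; exact: withinT.
have fs := f2 _ s0; have ft := f2 _ t0.
have := L2normD (in_L2B fs ft) (in_L2B ft g2).
have := L2normD (in_L2B ft fs) (in_L2B fs g2).
rewrite (L2norm_distC ft fs) !addrA !subrK => h1 h2 h3.
have {}h3 : L2norm L (f s - f t) < e by [].
by rewrite /from_subspace ltr_norml; apply/andP; split; lra.
Unshelve. all: by end_near. Qed.

Lemma functional_continuous (R : realType) (L : R) (phi : (R -> R) -> R)
    (f : R -> R -> R) :
  bounded_functional L phi ->
  (forall t, 0 <= t -> in_L2 L (f t)) ->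
  (forall t, 0 <= t -> L2continuous_at L f t) ->
  {within `[0, +oo[, continuous (fun t => phi (f t))}.
Proof.
move=> phibl f2 fc; apply/subspace_continuousP => t; rewrite /= in_itv/= andbT => t0.
have E : `[0, +oo[%classic = [set s : R | 0 <= s].
  by apply/seteqP; split => s /=; rewrite in_itv/= andbT.
rewrite E /from_subspace; apply: (functional_cvg phibl _ (f2 _ t0) (fc _ t0)).
by near=> s; apply: f2; near: s; exact: withinT.
Unshelve. all: by end_near. Qed.

(** * The Sobolev space H1(0, L) *)

Section triangle.
Context {R : realType}.
Let mu : {measure set (measurableTypeR R) -> \bar R} := @lebesgue_measure R.
Variables f g : R -> R.
Hypothesis f1 : mu.-integrable setT (EFin \o f).
Hypothesis g1 : mu.-integrable setT (EFin \o g).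

Let h (z : measurableTypeR R * measurableTypeR R) : \bar R :=
  (f z.1 * (g z.2 * (z.2 < z.1)%R%:R))%R%:E.

Let mf : measurable_fun setT f.
Proof. by apply/measurable_EFinP; exact: measurable_int f1. Qed.

Let mg : measurable_fun setT g.
Proof. by apply/measurable_EFinP; exact: measurable_int g1. Qed.

Let mh : measurable_fun setT h.
Proof.
apply/measurable_EFinP; apply: measurable_funM.
  exact: (measurableT_comp mf measurable_fst).
apply: measurable_funM; first exact: (measurableT_comp mg measurable_snd).
have mb : measurable_fun setT (fun z : measurableTypeR R * measurableTypeR R => z.2 < z.1).
  by apply: measurable_fun_ltr; [exact: measurable_snd|exact: measurable_fst].
rewrite (_ : (fun z => _) = (fun z : measurableTypeR R * measurableTypeR R =>
    if z.2 < z.1 then 1 else 0)); last by apply/funext => z; case: ifP.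
by apply: measurable_fun_ifT => //; exact: measurable_cst.
Qed.

Let normg := \int[mu]_x `|g x|.

Let int_normg : (\int[mu]_x `|(g x)%:E|)%E = normg%:E.
Proof.
have /integrableP[_ gfin] := g1.
by rewrite [RHS]fineK// ge0_fin_numE// integral_ge0.
Qed.

Let h1 : (mu \x mu)%E.-integrable setT h.
Proof.
apply/integrable12ltyP; first exact: mh.
apply: (@le_lt_trans _ _ (\int[mu]_x (`|f x| * normg)%:E)%E).
  apply: ge0_le_integral => //.
  - by move=> x _; apply: integral_ge0.
  - apply: (@measurable_fun_fubini_tonelli_F _ _ _ _ R mu (fun z => `|h z|%E)) => //.
    by apply: measurableT_comp => //; exact: mh.
  - by apply/measurable_EFinP; apply: measurable_funM => //; exact: measurableT_comp.
  move=> x _; rewrite EFinM -int_normg -ge0_integralZl//=; last first.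
    by apply/measurable_EFinP; exact: measurableT_comp.
  apply: ge0_le_integral => //.
  - apply/measurable_EFinP; apply: measurableT_comp => //.
    apply: measurable_funM => //; apply: measurable_funM => //.
    rewrite (_ : (fun z => _) = (fun z : measurableTypeR R =>
      if z < x then 1 else 0)); last by apply/funext => z; case: ifP.
    apply: measurable_fun_ifT => //; exact: measurable_fun_ltr.
  - by apply: measurable_funeM; apply/measurable_EFinP; exact: measurableT_comp.
  move=> y _; rewrite -EFinM lee_fin !normrM; apply: ler_wpM2l => //.
  by rewrite ler_piMr//; case: (y < x); rewrite ?normr1 ?normr0.
have /integrableP[_] : mu.-integrable setT (EFin \o (fun x => `|f x| * normg)).
  have -> : EFin \o (fun x => `|f x| * normg) =
    (fun x => (EFin \o (fun x => `|f x|)%R) x * normg%:E)%E by [].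
  apply: integrableZr => //; exact: integrable_norm.
apply: le_lt_trans; apply: ge0_le_integral => //.
- by move=> x _; rewrite lee_fin mulr_ge0// Rintegral_ge0.
- by apply/measurable_EFinP; apply: measurable_funM => //; exact: measurableT_comp.
- apply: measurableT_comp => //; apply/measurable_EFinP.
  by apply: measurable_funM => //; exact: measurableT_comp.
- by move=> x _; rewrite lee_fin ler_norm.
Qed.

(** With the derivatives of two H1 functions, extended by 0, as [f] and [g], this is
    integration by parts. *)
Lemma Fubini_triangle :
  \int[mu]_x (f x * \int[mu]_(s in `]-oo, x[) g s) =
  \int[mu]_s (g s * \int[mu]_(x in `]s, +oo[) f x).
Proof.
have := @Fubini _ _ _ _ _ mu mu _ h1.
have -> : (fun x => \int[mu]_y h (x, y))%E =
    EFin \o (fun x => f x * \int[mu]_(s in `]-oo, x[) g s).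
  apply/funext => x /=.
  have gx : mu.-integrable `]-oo, x[ (EFin \o g) by apply: integrableS g1.
  rewrite /h /= EFinM /Rintegral fineK; last exact: integrable_fin_num.
  rewrite -integralZl// [RHS]integral_mkcond; apply: eq_integral => y _.
  rewrite patchE mem_setE in_itv/=.
  by case: (y < x); rewrite ?mulr1 ?mulr0// EFinM.
have -> : (fun y => \int[mu]_x h (x, y))%E =
    EFin \o (fun s => g s * \int[mu]_(x in `]s, +oo[) f x).
  apply/funext => s /=.
  have fs : mu.-integrable `]s, +oo[ (EFin \o f) by apply: integrableS f1.
  rewrite /h /= EFinM /Rintegral fineK; last exact: integrable_fin_num.
  rewrite -integralZl// [RHS]integral_mkcond; apply: eq_integral => y _.
  rewrite patchE mem_setE in_itv/= andbT.
  by case: (s < y); rewrite ?mulr1 ?mulr0// mulrC EFinM.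
by move=> /(congr1 fine).
Qed.

End triangle.

Section H1.
Context {R : realType}.
Variable L : R.
Hypothesis L0 : 0 < L.
Let mu : {measure set (measurableTypeR R) -> \bar R} := @lebesgue_measure R.
Let D : set (measurableTypeR R) := `]0, L[%classic.
Implicit Types f g : R -> R.

Let mD : measurable D.
Proof. exact: measurable_itv. Qed.

Let ext_integrable g : in_L2 L g -> mu.-integrable setT (EFin \o (g \_ D)).
Proof.
by move=> /in_L2_integrable/(integrable_mkcond _ mD); rewrite restrict_EFin.
Qed.

(** Extending the derivative by 0 lets a half-line be the domain of integration, the
    form needed for [Fubini_triangle]. *)
Lemma H1_integral_left f g x : is_H1 L f g -> 0 <= x <= L ->
  f x = f 0 + \int[mu]_(s in `]-oo, x[) (g \_ D) s.
Proof.
move=> [g2 fg] xL; rewrite fg//; congr (_ + _).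
rewrite Rintegral_mkcond [RHS]Rintegral_mkcond; apply: eq_Rintegral => s _.
case/andP: xL => x0 xL.
rewrite !patchE !mem_setE !in_itv/=.
by case: (ltP 0 s) => s0; case: (ltP s x) => sx //=; rewrite (lt_le_trans sx).
Qed.

Lemma H1_integral_right f g x : is_H1 L f g -> 0 <= x <= L ->
  f L = f x + \int[mu]_(s in `]x, +oo[) (g \_ D) s.
Proof.
move=> fg xL; have [g2 _] := fg.
rewrite (H1_integral_left fg xL) (H1_integral_left fg (x := L)); last by rewrite (ltW L0) lexx.
rewrite -addrA; congr (_ + _).
have gi := ext_integrable g2.
rewrite [in RHS]Rintegral_itv_bndo_bndc; last exact: integrableS gi.
rewrite -Rintegral_setU//=; first last.
- apply/disj_set2P; rewrite -subset0 => z/=; rewrite !in_itv/= andbT => -[zx xz].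
  by move: (le_lt_trans zx xz); rewrite ltxx.
- by apply: integrableS gi => //; exact: measurableU.
rewrite Rintegral_mkcond [RHS]Rintegral_mkcond; apply: eq_Rintegral => s _.
rewrite !patchE !mem_setE !in_itv/=.
have -> : (s \in (`]-oo, x] `|` `]x, +oo[)) = true :> bool.
  by apply/mem_set => /=; rewrite !in_itv/= andbT; case: (leP s x); [left|right].
by case: (ltP s L) => // sL; rewrite andbF.
Qed.

Lemma H1_continuous f g : is_H1 L f g -> {within `[0, L], continuous f}.
Proof.
move=> fg; have [g2 _] := fg; have gi := ext_integrable g2.
have h : {within `[0, L], continuous
    (fun x => f 0 + parameterized_integral mu 0 x (g \_ D))}.
  apply: within_continuousDr; first exact: within_continuous_cst.
  apply: parameterized_integral_continuous; first exact: ltW.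
  exact: integrableS gi.
apply: subspace_eq_continuous h => x; rewrite inE/= in_itv/= => xL.
rewrite /from_subspace /parameterized_integral (H1_integral_left fg xL); congr (_ + _).
rewrite Rintegral_itv_bndo_bndc; last exact: integrableS gi.
rewrite Rintegral_mkcond [RHS]Rintegral_mkcond; apply: eq_Rintegral => s _.
rewrite !patchE !mem_setE !in_itv/=.
case: (leP s x) => sx; rewrite ?andbF// andbT.
by case: (ltgtP 0 s) => s0 //=; case: ifP.
Qed.

(** Cauchy-Schwarz against the constant function 1. *)
Lemma H1_bound f g x : is_H1 L f g -> f 0 = 0 -> 0 <= x <= L ->
  `|f x| <= L2norm L (fun=> 1) * L2norm L g.
Proof.
move=> fg f0 xL; have [g2 _] := fg.
rewrite (H1_integral_left fg xL) f0 add0r.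
have gi := ext_integrable g2.
apply: le_trans (le_normr_Rintegral _ _) _; [exact: measurable_itv|exact: integrableS gi|].
have ng2 : in_L2 L (fun x => `|g x|).
  apply: in_L2_intro.
    by apply: measurableT_comp => //; exact: in_L2_measurable.
  have := in_L2_integrable_sqr g2; apply: eq_integrable => // y _ /=.
  by rewrite real_normK ?num_real.
have -> : L2norm L g = L2norm L (fun x => `|g x|).
  apply/eqP; rewrite -(@eqrXn2 _ 2) ?L2norm_ge0// !L2norm_sqr//; apply/eqP.
  by apply: eq_Rintegral => y _; rewrite -!expr2 real_normK ?num_real.
apply: le_trans (Cauchy_Schwarz (in_L2_cst L 1) ng2).
apply: le_trans (ler_norm _).
rewrite [leLHS]Rintegral_mkcond [leRHS]Rintegral_mkcond; apply: le_Rintegral => //.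
- have : mu.-integrable `]-oo, x[ (EFin \o (fun t => `|(g \_ D) t|)).
    by apply: integrable_norm => //; exact: integrableS gi.
  by move=> /integrable_mkcond; rewrite restrict_EFin; apply; exact: measurable_itv.
- have := ext_integrable ng2; apply: eq_integrable => // y _.
  by rewrite /= !patchE; case: ifP; rewrite ?mul1r.
move=> y _; rewrite /= !patchE; case: ifP => _.
  by case: ifP => _; rewrite ?normr0 ?mul1r.
by case: ifP => _; [rewrite mul1r; exact: normr_ge0|exact: lexx].
Qed.

Lemma L2norm_bounded (M : R) f : in_L2 L f -> 0 <= M ->
  (forall x, 0 < x < L -> `|f x| <= M) -> L2norm L f <= M * L2norm L (fun=> 1).
Proof.
move=> f2 M0 fM; rewrite -(@ler_pXn2r _ 2) ?nnegrE ?mulr_ge0 ?L2norm_ge0//.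
have M2 := in_L2Z M (in_L2_cst L 1).
rewrite -[M in leRHS]ger0_norm// -L2normZ; last exact: in_L2_cst.
rewrite !L2norm_sqr//; apply: le_Rintegral => //; [exact: in_L2_mul_integrable..|].
move=> x /=; rewrite in_itv/= => /fM; rewrite -!expr2 => h.
by rewrite -[leRHS]/((M * 1) ^+ 2) mulr1 -real_normK ?num_real// lerXn2r ?nnegrE// (le_trans _ h).
Qed.

Lemma continuous_in_L2 f : {within `[0, L], continuous f} -> in_L2 L f.
Proof.
move=> cf.
have [M [_ fM]] := compact_bounded (continuous_compact cf (@segment_compact R 0 L)).
apply: (@in_L2_bounded _ _ (M + 1)).
  apply: subspace_continuous_measurable_fun => //.
  by apply: continuous_subspaceW cf; exact: subset_itv_oo_cc.
move=> x Dx; apply: (fM (M + 1)); first by rewrite ltrDl.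
by exists x => //; exact: subset_itv_oo_cc.
Qed.

Lemma H1_in_L2 f g : is_H1 L f g -> in_L2 L f.
Proof. by move=> /H1_continuous; exact: continuous_in_L2. Qed.

Lemma Poincare f g : is_H1 L f g -> f 0 = 0 ->
  L2norm L f <= L2norm L (fun=> 1) ^+ 2 * L2norm L g.
Proof.
move=> fg f0; rewrite expr2 -mulrA [leRHS]mulrC; apply: L2norm_bounded.
- exact: H1_in_L2 fg.
- by rewrite mulr_ge0 ?L2norm_ge0.
by move=> x /andP[/ltW x0 /ltW xL]; apply: H1_bound => //; rewrite x0.
Qed.

Lemma integration_by_parts_H1 f f1 g g1 : is_H1 L f f1 -> is_H1 L g g1 ->
  L2inner L f1 g + L2inner L f g1 = f L * g L - f 0 * g 0.
Proof.
move=> ff gg; have [f12 _] := ff; have [g12 _] := gg.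
have f2 := H1_in_L2 ff; have g2 := H1_in_L2 gg.
have LL : 0 <= L <= L by rewrite lexx ltW.
have L00 : (0 : R) <= 0 <= L by rewrite lexx ltW.
have := Fubini_triangle (ext_integrable f12) (ext_integrable g12).
have -> : \int[mu]_x ((f1 \_ D) x * \int[mu]_(s in `]-oo, x[) (g1 \_ D) s) =
    L2inner L f1 (g + (fun=> - g 0)).
  rewrite /L2inner [RHS]Rintegral_mkcond; apply: eq_Rintegral => x _.
  rewrite !patchE; case: ifPn => [|_]; last by rewrite mul0r.
  rewrite /D mem_setE in_itv/= => /andP[x0 xL]; congr (_ * _).
  rewrite /GRing.add /= [X in _ = X + _](H1_integral_left gg (x := x)) ?(ltW x0) ?ltW//.
  by rewrite addrAC subrr add0r.
have -> : \int[mu]_s ((g1 \_ D) s * \int[mu]_(x in `]s, +oo[) (f1 \_ D) x) =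
    L2inner L g1 ((fun=> f L) - f).
  rewrite /L2inner [RHS]Rintegral_mkcond; apply: eq_Rintegral => x _.
  rewrite !patchE; case: ifPn => [|_]; last by rewrite mul0r.
  rewrite /D mem_setE in_itv/= => /andP[x0 xL]; congr (_ * _).
  rewrite -[RHS]/(f L - f x) (H1_integral_right ff (x := x)) ?(ltW x0) ?ltW//.
  by rewrite addrAC subrr add0r.
have int1 f0 : in_L2 L f0 -> forall c, L2inner L f0 (fun=> c) =
    c * \int[mu]_(s in D) f0 s.
  move=> f02 c; rewrite -RintegralZl//; last exact: in_L2_integrable.
  by apply: eq_Rintegral => x _; rewrite mulrC.
have fL : f L = f 0 + \int[mu]_(s in D) f1 s by have [_ ->] := ff.
have gL : g L = g 0 + \int[mu]_(s in D) g1 s by have [_ ->] := gg.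
rewrite L2innerDr//; last exact: in_L2_cst.
rewrite L2innerC [RHS]L2innerC L2innerBl//; last exact: in_L2_cst.
rewrite [X in _ = X - _]L2innerC !int1// (L2innerC L g).
set A := \int[mu]_(s in D) f1 s in fL *; set B := \int[mu]_(s in D) g1 s in gL *.
move=> h; have -> : L2inner L f1 g = f L * B - L2inner L f g1 + g 0 * A.
  by rewrite -h mulNr subrK.
by rewrite fL gL; ring.
Qed.

Lemma is_H1D f f1 g g1 : is_H1 L f f1 -> is_H1 L g g1 -> is_H1 L (f + g) (f1 + g1).
Proof.
move=> [f12 ff] [g12 gg]; split; first exact: in_L2D.
move=> x xL; rewrite -[LHS]/(f x + g x) ff// gg// -[(f + g) 0]/(f 0 + g 0).
have sub : (`]0, x[ : set (measurableTypeR R)) `<=` D.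
  by apply: subset_itvl; rewrite bnd_simp; case/andP: xL.
rewrite [X in _ = _ + X](_ : _ = \int[mu]_(s in `]0, x[) (f1 s + g1 s))// RintegralD//.
- by rewrite addrACA.
- by apply: integrableS (in_L2_integrable f12).
- by apply: integrableS (in_L2_integrable g12).
Qed.

Lemma is_H1Z a f f1 : is_H1 L f f1 -> is_H1 L (a *: f) (a *: f1).
Proof.
move=> [f12 ff]; split; first exact: in_L2Z.
move=> x xL; rewrite -[LHS]/(a * f x) ff// -[(a *: f) 0]/(a * f 0) mulrDr.
have sub : (`]0, x[ : set (measurableTypeR R)) `<=` D.
  by apply: subset_itvl; rewrite bnd_simp; case/andP: xL.
rewrite [X in _ = _ + X](_ : _ = \int[mu]_(s in `]0, x[) (a * f1 s))// RintegralZl//.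
by apply: integrableS (in_L2_integrable f12).
Qed.

Lemma is_H1B f f1 g g1 : is_H1 L f f1 -> is_H1 L g g1 -> is_H1 L (f - g) (f1 - g1).
Proof. move=> ff gg; have := is_H1D ff (is_H1Z (-1) gg).
by rewrite !scaleN1r. Qed.

Lemma is_H1_affine p q : is_H1 L (fun x => p + q * x) (fun=> q).
Proof.
split; first exact: in_L2_cst.
move=> x /andP[x0 xL]; rewrite mulr0 addr0 Rintegral_cst//.
transitivity (p + q * fine (mu `]0, x[%classic)) => //.
by rewrite [mu _]lebesgue_measure_itv/= lte_fin; case: ltgtP x0 => //= [|<-]; rewrite ?subr0 ?oppr0 ?addr0.
Qed.

End H1.

(** * Eigenfunction expansions and the slope at the left end *)

Lemma sum_Cauchy_Schwarz (R : realType) (m N : nat) (x y : nat -> R) :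
  (\sum_(m <= j < N) x j * y j) ^+ 2 <=
  (\sum_(m <= j < N) x j ^+ 2) * (\sum_(m <= j < N) y j ^+ 2).
Proof.
apply: discriminant_le => [||s t].
- by apply: sumr_ge0 => j _; exact: sqr_ge0.
- by apply: sumr_ge0 => j _; exact: sqr_ge0.
have : 0 <= \sum_(m <= j < N) (s * x j + t * y j) ^+ 2.
  by apply: sumr_ge0 => j _; exact: sqr_ge0.
rewrite !mulr_sumr -!big_split/=; congr (_ <= _).
by apply: eq_bigr => j _; ring.
Qed.

Section spectral.
Context {R : realType}.
Variable P : plant R.
Hypothesis ok : plant_ok P.
Let mu : {measure set (measurableTypeR R) -> \bar R} := @lebesgue_measure R.
Let L := pL P.
Let c := pc P.
Let e := peig P.
Let e1 := peig1 P.
Let e2 := peig2 P.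
Let lam := plam P.
Let n := pn P.
Implicit Types f g : R -> R.

Lemma plant_L0 : 0 < pL P. Proof. by have [[]] := ok. Qed.
Lemma plant_D0 : 0 < pD P. Proof. by have [[]] := ok. Qed.
Lemma plant_c : in_Lp (pL P) +oo%E (pc P). Proof. by have [[]] := ok. Qed.
Lemma peig_in_L2 j : in_L2 (pL P) (peig P j).
Proof. by have [_ [[[]]]] := ok. Qed.
Lemma peig_domA j : is_domA (pL P) (peig P j) (peig1 P j) (peig2 P j).
Proof. by have [_ [[]]] := ok. Qed.
Lemma peig_orthonormal i j : L2inner (pL P) (peig P i) (peig P j) = (i == j)%:R.
Proof. by have [_ [[[]]]] := ok. Qed.
Lemma plam_neg j : (pn P <= j)%N -> plam P j <= plam P (pn P).
Proof. by have [_ [_ [_ _ _ h]]] := ok => /h/andP[]. Qed.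
Lemma plam_n_lt0 : plam P (pn P) < 0.
Proof. by have [_ [_ [_ _ _ /(_ _ (leqnn _))/andP[]]]] := ok. Qed.

Let L0 := plant_L0.
#[local] Hint Resolve peig_in_L2 : core.

Lemma coeffD f g j : in_L2 L f -> in_L2 L g ->
  coeff P (f + g) j = coeff P f j + coeff P g j.
Proof. by move=> f2 g2; rewrite /coeff L2innerDl. Qed.

Lemma coeffZ a f j : in_L2 L f -> coeff P (a *: f) j = a * coeff P f j.
Proof. by move=> f2; rewrite /coeff L2innerZl. Qed.

Lemma coeffB f g j : in_L2 L f -> in_L2 L g ->
  coeff P (f - g) j = coeff P f j - coeff P g j.
Proof. by move=> f2 g2; rewrite /coeff L2innerBl. Qed.

Lemma bounded_functional_coeff j : bounded_functional L (fun f => coeff P f j).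
Proof. exact: bounded_functional_L2inner. Qed.

Lemma coeff_sum (N : nat) (q : nat -> R) i :
  coeff P (fun x => \sum_(j < N) q j * e j x) i = if (i < N)%N then q i else 0.
Proof.
rewrite /coeff L2inner_suml//.
under eq_bigr do rewrite peig_orthonormal.
case: ifPn => [iN|Ni].
  rewrite (bigD1 (Ordinal iN))//= eqxx mulr1 big1 ?addr0// => j ji.
  rewrite [_ == _](_ : _ = false) ?mulr0//; apply/negbTE.
  by apply: contra ji => /eqP ij; apply/eqP/val_inj.
rewrite big1// => j _; rewrite [_ == _](_ : _ = false) ?mulr0//; apply/negbTE.
by apply: contra Ni => /eqP <-.
Qed.

(** Pythagoras: among the combinations of the first [N] eigenfunctions, the one with
    the coefficients of [f] is the closest to [f]. *)
Lemma L2norm_dist_sum f (N : nat) (q : nat -> R) : in_L2 L f ->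
  L2norm L (fun x => f x - \sum_(j < N) q j * e j x) ^+ 2 =
  L2norm L f ^+ 2 - \sum_(j < N) coeff P f j ^+ 2
  + \sum_(j < N) (q j - coeff P f j) ^+ 2.
Proof.
move=> f2; set s := fun x => \sum_(j < N) q j * e j x.
have s2 : in_L2 L s by exact: in_L2_sum.
have fs2 := in_L2B f2 s2.
rewrite -[X in L2norm L X]/(f - s) !L2norm_sqr//.
have Es g : in_L2 L g -> L2inner L s g = \sum_(j < N) q j * coeff P g j.
  move=> g2; rewrite /s L2inner_suml//; apply: eq_bigr => j _.
  by rewrite L2innerC.
rewrite L2innerBl// ![L2inner L _ (f - s)]L2innerC !L2innerBl//.
rewrite (L2innerC L f s) !Es//.
under [X in _ - (_ - X)]eq_bigr => j _ do rewrite coeff_sum ltn_ord.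
rewrite opprB addrAC -!addrA; congr (_ + _); rewrite -!sumrN -!big_split/=.
by apply: eq_bigr => j _; ring.
Qed.

Lemma Bessel f (N : nat) : in_L2 L f ->
  \sum_(j < N) coeff P f j ^+ 2 <= L2norm L f ^+ 2.
Proof.
move=> f2; have := L2norm_dist_sum N (coeff P f) f2.
under [X in _ + X]eq_bigr do rewrite subrr expr0n/=.
by rewrite sumr_const mul0rn addr0 -subr_ge0 => <-; exact: sqr_ge0.
Qed.

Lemma Bessel_from f (m N : nat) : in_L2 L f ->
  \sum_(m <= j < N) coeff P f j ^+ 2 <= L2norm L f ^+ 2.
Proof.
move=> f2; apply: le_trans (Bessel N f2); rewrite -(big_mkord xpredT (fun j => coeff P f j ^+ 2)).
have [mN|Nm] := leqP m N.
  rewrite [leRHS](big_cat_nat (leq0n m) mN)//= lerDr sumr_ge0// => j _; exact: sqr_ge0.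
by rewrite [leLHS]big_geq ?(ltnW Nm)// sumr_ge0// => j _; exact: sqr_ge0.
Qed.

(** Completeness of the basis only gives some finite combination near [f]; the partial
    Fourier sums are at least as near, by [L2norm_dist_sum]. *)
Lemma Fourier_cvg f : in_L2 L f ->
  L2norm L (fun x => f x - \sum_(j < N) coeff P f j * e j x) @[N --> \oo] --> 0.
Proof.
move=> f2; apply/cvgrPdist_lt => /= eps eps0.
have [_ [[[_ _ /(_ _ f2 _ eps0)[M [q qe]]] _ _] _]] := ok.
exists M => // N /= MN; rewrite sub0r normrN ger0_norm ?L2norm_ge0//.
apply: le_lt_trans qe.
rewrite -(@ler_pXn2r _ 2)// ?nnegrE ?L2norm_ge0// !L2norm_dist_sum//.
under [X in _ + X <= _]eq_bigr do rewrite subrr expr0n/=.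
rewrite sumr_const mul0rn addr0.
apply: (@le_trans _ _ (L2norm L f ^+ 2 - \sum_(j < M) coeff P f j ^+ 2)).
  rewrite lerD2l lerN2.
  rewrite -!(big_mkord xpredT (fun j => coeff P f j ^+ 2)).
  rewrite [leRHS](big_cat_nat (leq0n M) MN)//= lerDl sumr_ge0// => j _; exact: sqr_ge0.
by rewrite lerDl sumr_ge0// => j _; exact: sqr_ge0.
Qed.

Lemma Parseval f g : in_L2 L f -> in_L2 L g ->
  \sum_(j < N) coeff P f j * coeff P g j @[N --> \oo] --> L2inner L f g.
Proof.
move=> f2 g2.
suff h : L2inner L (fun x => \sum_(j < N) coeff P f j * e j x) g @[N --> \oo]
    --> L2inner L f g.
  apply: cvg_trans h; apply: near_eq_cvg; near=> N.
  by rewrite L2inner_suml//; apply: eq_bigr => j _; rewrite [in RHS]/coeff (L2innerC _ g).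
apply: (functional_cvg (bounded_functional_L2inner g2)) => //.
  by near=> N; exact: in_L2_sum.
apply: cvg_trans (Fourier_cvg f2); apply: near_eq_cvg; near=> N.
by rewrite (L2norm_distC (f := f))//; exact: in_L2_sum.
Unshelve. all: by end_near. Qed.

Lemma opA_in_L2 f f1 f2 : is_domA L f f1 f2 -> in_L2 L (opA c f f2).
Proof.
move=> [[ff [f22 _]] _ _]; apply: (in_L2D f22); apply: in_L2M_Loo plant_c _.
exact: H1_in_L2 ff.
Qed.

(** Two integrations by parts, whose boundary terms vanish since both functions are 0
    at the two ends. *)
Lemma coeff_opA f f1 f2 j : is_domA L f f1 f2 ->
  coeff P (opA c f f2) j = lam j * coeff P f j.
Proof.
move=> [[ff ff1] f0 fL]; have [[ee ee1] ej0 ejL] := peig_domA j.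
have fin := H1_in_L2 L0 ff.
have f2in : in_L2 L f2 by have [] := ff1.
have e2in : in_L2 L (e2 j) by have [] := ee1.
have cf : in_L2 L (fun x => c x * f x) by apply: in_L2M_Loo plant_c _.
have ce : in_L2 L (fun x => c x * e j x) by apply: in_L2M_Loo plant_c _.
rewrite /coeff; have -> : opA c f f2 = f2 + (fun x => c x * f x) by [].
rewrite L2innerDl//.
have := integration_by_parts_H1 L0 ff1 ee.
rewrite ejL ej0 !mulr0 subrr => /eqP; rewrite addr_eq0 => /eqP ->.
have := integration_by_parts_H1 L0 ff ee1.
rewrite fL f0 !mul0r subrr => /eqP; rewrite addr_eq0 => /eqP ->; rewrite opprK.
have -> : L2inner L (fun x => c x * f x) (peig P j) =
    L2inner L f (fun x => c x * e j x).
  by apply: eq_Rintegral => x _; rewrite [RHS]mulrCA mulrA.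
rewrite -L2innerDr// -L2innerZr//.
rewrite ![L2inner _ f _]L2innerC; apply: L2inner_ae_eq => //.
- exact: in_L2D.
- exact: in_L2Z.
by have [_ [[_ _ h] _]] := ok; exact: h.
Qed.

(** Equal to 1 at 0 and to 0 at [L]: integrating by parts against it isolates the slope
    at 0. *)
Let g1 : R -> R := fun x => 1 + - L^-1 * x.
Let cg1 : R -> R := fun x => c x * g1 x.

Let g1_H1 : is_H1 L g1 (fun=> - L^-1).
Proof. exact: is_H1_affine. Qed.

Let g1_L2 : in_L2 L g1.
Proof. refine (H1_in_L2 L0 g1_H1). Qed.

Let cg1_L2 : in_L2 L cg1.
Proof. exact: in_L2M_Loo plant_c g1_L2. Qed.

Let left_slope f f1 f2 : is_domA L f f1 f2 ->
  f1 0 = L2inner L f cg1 - L2inner L (opA c f f2) g1.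
Proof.
move=> [[ff ff1] f0 fL].
have fin := H1_in_L2 L0 ff.
have f2in : in_L2 L f2 by have [] := ff1.
have cf : in_L2 L (fun x => c x * f x) by apply: in_L2M_Loo plant_c _.
have -> : opA c f f2 = f2 + (fun x => c x * f x) by [].
rewrite L2innerDl//.
have -> : L2inner L (fun x => c x * f x) g1 = L2inner L f cg1.
  by apply: eq_Rintegral => x _; rewrite /cg1 mulrCA mulrA.
rewrite opprD addrCA subrr addr0.
have := integration_by_parts_H1 L0 ff1 g1_H1.
have -> : g1 L = 0 by rewrite /g1 mulNr mulVf ?subrr// gt_eqF.
have -> : g1 0 = 1 by rewrite /g1 mulr0 addr0.
have := integration_by_parts_H1 L0 ff (is_H1_affine L (- L^-1) 0).
rewrite fL f0 !mul0r subrr.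
have -> : L2inner L f1 (fun x => - L^-1 + 0 * x) = L2inner L f1 (fun=> - L^-1).
  by apply: eq_Rintegral => x _; rewrite mul0r addr0.
have -> : L2inner L f (fun=> 0) = 0.
  by rewrite /L2inner; under eq_Rintegral do rewrite mulr0; rewrite Rintegral_cst// mul0r.
rewrite addr0 => ->; rewrite !addr0 mulr0 mulr1 sub0r => ->.
by rewrite opprK.
Qed.

Let eig_slope j : e1 j 0 = coeff P cg1 j - lam j * coeff P g1 j.
Proof.
rewrite /e1 (left_slope (peig_domA j)) L2innerC; congr (_ - _).
rewrite [in RHS]/coeff (L2innerC L g1) -L2innerZl//.
apply: L2inner_ae_eq => //.
- exact: opA_in_L2 (peig_domA j).
- exact: in_L2Z.
by have [_ [[_ _ h] _]] := ok; exact: h.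
Qed.

(** The weight of the [j]-th mode of [A f] in the slope of [f] at 0. *)
Definition slope_weight j := peig1 P j 0 / plam P j.

Let lam_lt0 j : (n <= j)%N -> lam j < 0.
Proof. by move=> nj; apply: le_lt_trans plam_n_lt0; exact: plam_neg. Qed.

(** By [eig_slope] the weight is [coeff cg1 j / lam j - coeff g1 j]: since the
    eigenvalues of index at least [n] stay away from 0, Bessel applies to both terms. *)
Lemma slope_weight_summable : exists2 Kap : R, 0 <= Kap &
  forall N, \sum_(pn P <= j < N) slope_weight j ^+ 2 <= Kap.
Proof.
pose Kap := 2 * (lam n)^-2 * L2norm L cg1 ^+ 2 + 2 * L2norm L g1 ^+ 2.
exists Kap => [|N].
  rewrite /Kap; apply: addr_ge0; apply: mulr_ge0; rewrite ?sqr_ge0//.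
  by rewrite mulr_ge0// invr_ge0 sqr_ge0.
apply: (@le_trans _ _ (\sum_(n <= j < N) (2 * (lam n)^-2 * coeff P cg1 j ^+ 2
    + 2 * coeff P g1 j ^+ 2))); last first.
  rewrite big_split/= -!mulr_sumr lerD// ler_wpM2l//; try exact: Bessel_from.
  by rewrite mulr_ge0 ?invr_ge0 ?sqr_ge0.
apply: ler_sum_nat => j /andP[nj _].
have lj := lam_lt0 nj; have ln := plam_n_lt0.
have -> : slope_weight j = coeff P cg1 j / lam j - coeff P g1 j.
  by rewrite /slope_weight -/(e1 j) eig_slope mulrBl mulrAC divff ?mul1r// lt_eqF.
set a := coeff P cg1 j; set b := coeff P g1 j.
apply: (@le_trans _ _ (2 * (a / lam j) ^+ 2 + 2 * b ^+ 2)).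
  rewrite -subr_ge0.
  have -> : 2 * (a / lam j) ^+ 2 + 2 * b ^+ 2 - (a / lam j - b) ^+ 2 =
    (a / lam j + b) ^+ 2 by ring.
  exact: sqr_ge0.
rewrite lerD2r -mulrA ler_wpM2l// exprMn mulrC ler_wpM2r ?sqr_ge0//.
rewrite exprVn lef_pV2 ?posrE; last 2 first.
- by rewrite -sqrrN exprn_gt0// oppr_gt0.
- by rewrite -sqrrN exprn_gt0// oppr_gt0.
have := plam_neg nj; rewrite -/lam -/n => h.
by rewrite -(sqrrN (lam n)) -(sqrrN (lam j)) lerXn2r ?nnegrE ?oppr_ge0 ?lerN2// ltW.
Qed.

(** A product of two square summable sequences; convergence has to be proved before
    the value of the limit operator in [tail_sum] means anything. *)
Lemma tail_sum_cvg f : in_L2 L f ->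
  \sum_(pn P <= j < N) slope_weight j * coeff P f j @[N --> \oo]
    --> tail_sum P (coeff P f).
Proof.
move=> f2; have [Kap Kap0 hK] := slope_weight_summable.
suff h : cvgn (fun N => \sum_(pn P <= j < N) slope_weight j * coeff P f j) by exact: h.
pose u j := if (n <= j)%N then slope_weight j * coeff P f j else 0.
have u0 j : (j < n)%N -> u j = 0 by rewrite /u ltnNge => /negbTE ->.
have sum_u (h : R -> R) N : h 0 = 0 ->
    \sum_(0 <= j < N) h (u j) = \sum_(n <= j < N) h (slope_weight j * coeff P f j).
  move=> h0; have [nN|Nn] := leqP n N.
    rewrite (big_cat_nat (leq0n n) nN)/= [X in X + _](_ : _ = 0) ?add0r.
      by apply: eq_big_nat => j /andP[nj _]; rewrite /u nj.
    by rewrite big_nat; apply: big1 => j /andP[_ /u0 ->].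
  rewrite [RHS]big_geq ?(ltnW Nn)// big_nat; apply: big1 => j /andP[_ jN].
  by rewrite u0 ?(ltn_trans jN Nn).
have -> : (fun N => \sum_(pn P <= j < N) slope_weight j * coeff P f j) = series u.
  by apply/funext => N; rewrite /series/= (sum_u id).
apply: normed_cvg; rewrite /normed_series_of.
apply: nondecreasing_is_cvgn.
  by apply: nondecreasing_series => j _ _; exact: normr_ge0.
exists (Kap + L2norm L f ^+ 2) => _ [N _ <-].
apply: (@le_trans _ _ (\sum_(n <= j < N) (slope_weight j ^+ 2 + coeff P f j ^+ 2))); last first.
  by rewrite big_split/= lerD// Bessel_from.
rewrite /series/= (sum_u (@Num.norm _ R)) ?normr0//.
apply: ler_sum_nat => j _.
set a := slope_weight j; set b := coeff P f j.
have h1 := sqr_ge0 (a - b); have h2 := sqr_ge0 (a + b).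
have h3 := sqr_ge0 a; have h4 := sqr_ge0 b.
move: h1 h2; rewrite sqrrB sqrrD => h1 h2.
by rewrite ler_norml; apply/andP; split; lra.
Qed.

Lemma tail_sum_bound : exists2 Kap : R, 0 <= Kap & forall f M, in_L2 L f ->
  (forall N, \sum_(pn P <= j < N) coeff P f j ^+ 2 <= M) ->
  tail_sum P (coeff P f) ^+ 2 <= Kap * M.
Proof.
have [Kap Kap0 hK] := slope_weight_summable; exists Kap => // f M f2 fM.
have h := tail_sum_cvg f2.
have h2 : (\sum_(pn P <= j < N) slope_weight j * coeff P f j) *
    (\sum_(pn P <= j < N) slope_weight j * coeff P f j) @[N --> \oo]
    --> tail_sum P (coeff P f) * tail_sum P (coeff P f) by exact: cvgM.
rewrite expr2; apply: (cvgr_to_le h2).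
near=> N; rewrite -expr2.
apply: (le_trans (sum_Cauchy_Schwarz _ _ _ _)).
by apply: ler_pM => //; apply: sumr_ge0 => j _; exact: sqr_ge0.
Unshelve. all: by end_near. Qed.

Lemma bounded_functional_tail_sum :
  bounded_functional L (fun f => tail_sum P (coeff P f)).
Proof.
split=> [a f g f2 g2|].
  have h := tail_sum_cvg (in_L2D (in_L2Z a f2) g2).
  have h2 : a * (\sum_(pn P <= j < N) slope_weight j * coeff P f j) +
      \sum_(pn P <= j < N) slope_weight j * coeff P g j @[N --> \oo]
      --> a * tail_sum P (coeff P f) + tail_sum P (coeff P g).
    by apply: cvgD; [apply: cvgM; [exact: cvg_cst|exact: tail_sum_cvg]|exact: tail_sum_cvg].
  apply: (cvg_unique _ h) => //; apply: cvg_trans h2; apply: near_eq_cvg.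
  near=> N; rewrite mulr_sumr -big_split/=.
  apply: eq_bigr => j _; rewrite coeffD ?coeffZ//; last exact: in_L2Z.
  by rewrite mulrDr mulrCA.
have [Kap Kap0 hK] := tail_sum_bound.
exists (Num.sqrt Kap) => [|f f2]; first exact: sqrtr_ge0.
rewrite -(@ler_pXn2r _ 2) ?nnegrE ?mulr_ge0 ?sqrtr_ge0 ?L2norm_ge0//.
rewrite real_normK ?num_real// exprMn sqr_sqrtr//; apply: hK => // N.
exact: Bessel_from.
Unshelve. all: by end_near. Qed.

(** Parseval expands [left_slope] over the modes, and [eig_slope] recognises the weight
    of each.  The high modes are those of [A f] and not of [f] because the slopes
    of the eigenfunctions are square summable only after division by the eigenvalues. *)
Lemma left_slope_modal f f1 f2 : is_domA L f f1 f2 ->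
  f1 0 = \sum_(j < pn P) peig1 P j 0 * coeff P f j
         + tail_sum P (coeff P (opA c f f2)).
Proof.
move=> fA; have [[ff ff1] f0 fL] := fA.
have fin := H1_in_L2 L0 ff; have Af := opA_in_L2 fA.
rewrite (left_slope fA).
have h : (\sum_(j < N) coeff P f j * coeff P cg1 j) -
    \sum_(j < N) coeff P (opA c f f2) j * coeff P g1 j @[N --> \oo]
    --> L2inner L f cg1 - L2inner L (opA c f f2) g1.
  by apply: cvgB; exact: Parseval.
have h2 : \sum_(j < pn P) peig1 P j 0 * coeff P f j +
    \sum_(pn P <= j < N) slope_weight j * coeff P (opA c f f2) j @[N --> \oo]
    --> \sum_(j < pn P) peig1 P j 0 * coeff P f j + tail_sum P (coeff P (opA c f f2)).
  by apply: cvgD; [exact: cvg_cst|exact: tail_sum_cvg].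
apply: (cvg_unique _ h) => //; apply: cvg_trans h2; apply: near_eq_cvg.
near=> N; have nN : (n <= N)%N by near: N; exact: nbhs_infty_ge.
rewrite -sumrB.
rewrite -(big_mkord xpredT (fun j => coeff P f j * coeff P cg1 j -
  coeff P (opA c f f2) j * coeff P g1 j)).
rewrite -(big_mkord xpredT (fun j => peig1 P j 0 * coeff P f j)).
rewrite [RHS](big_cat_nat (leq0n n) nN)//=; congr (_ + _).
  apply: eq_big_nat => j _; rewrite (coeff_opA j fA) -/e1 eig_slope; ring.
apply: eq_big_nat => j /andP[nj _]; rewrite (coeff_opA j fA) /slope_weight -/e1 eig_slope.
by rewrite -/(lam j); field; rewrite lt_eqF// lam_lt0.
Unshelve. all: by end_near. Qed.

End spectral.

(** * Derivatives and the matrix exponential *)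

Section derivatives.
Context {R : realType}.
Implicit Types (f g : R -> R) (t : R).

Lemma is_deriveDr f g t (df dg : R) : is_derive t 1 f df -> is_derive t 1 g dg ->
  is_derive t 1 (fun x => f x + g x) (df + dg).
Proof. by move=> ? ?; exact: is_deriveD. Qed.

Lemma is_deriveBr f g t (df dg : R) : is_derive t 1 f df -> is_derive t 1 g dg ->
  is_derive t 1 (fun x => f x - g x) (df - dg).
Proof. by move=> ? ?; exact: is_deriveB. Qed.

Lemma is_deriveMr f g t (df dg : R) : is_derive t 1 f df -> is_derive t 1 g dg ->
  is_derive t 1 (fun x => f x * g x) (df * g t + f t * dg).
Proof.
move=> hf hg; have := is_deriveM hf hg.
rewrite -[f t *: dg]/(f t * dg) -[g t *: df]/(g t * df) addrC [g t * _]mulrC.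
exact.
Qed.

Lemma is_deriveZr (a : R) f t (df : R) : is_derive t 1 f df ->
  is_derive t 1 (fun x => a * f x) (a * df).
Proof.
move=> hf; have := is_deriveMr (is_derive_cst a t 1) hf.
by rewrite mul0r add0r.
Qed.

Lemma is_derive_sumr (I : Type) (r : seq I) (Q : pred I) (f : I -> R -> R)
    (df : I -> R) t : (forall i, Q i -> is_derive t 1 (f i) (df i)) ->
  is_derive t 1 (fun x => \sum_(i <- r | Q i) f i x) (\sum_(i <- r | Q i) df i).
Proof.
move=> h; elim: r => [|i r ih].
  under eq_fun do rewrite big_nil; rewrite big_nil; exact: is_derive_cst.
under eq_fun do rewrite big_cons; rewrite big_cons.
by case: (boolP (Q i)) => // Qi; apply: is_deriveDr => //; exact: h.
Qed.

Lemma is_derive_translate f t (a df : R) : is_derive (t - a) 1 f df ->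
  is_derive t 1 (fun x => f (x - a)) df.
Proof.
move=> h; have h2 : is_derive t 1 (fun x : R => x - a) (1 - 0).
  exact: (is_deriveBr (is_derive_id t 1) (is_derive_cst a t 1)).
have := @is_derive1_comp _ f (fun x => x - a) t _ _ h h2.
by rewrite subr0 mulr1.
Qed.

Lemma is_derive_reflect f t (a df : R) : is_derive (a - t) 1 f df ->
  is_derive t 1 (fun x => f (a - x)) (- df).
Proof.
move=> h; have h2 : is_derive t 1 (fun x : R => a - x) (0 - 1).
  exact: (is_deriveBr (is_derive_cst a t 1) (is_derive_id t 1)).
have := @is_derive1_comp _ f (fun x => a - x) t _ _ h h2.
by rewrite sub0r mulrN1.
Qed.

Lemma is_derive_near f g t (df : R) : (\forall s \near t, f s = g s) ->
  is_derive t 1 f df -> is_derive t 1 g df.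
Proof.
move=> fg h; apply: near_eq_is_derive h => //.
Qed.

Lemma is_derive_continuous f t (df : R) : is_derive t 1 f df -> {for t, continuous f}.
Proof.
by move=> [df1 _]; apply: differentiable_continuous; exact/derivable1_diffP.
Qed.

End derivatives.

Lemma cvg_sumr {R : realType} {T I : Type} {F : set_system T} {FF : Filter F}
    (r : seq I) (f : I -> T -> R) (l : I -> R) :
  (forall i, f i x @[x --> F] --> l i) ->
  \sum_(i <- r) f i x @[x --> F] --> \sum_(i <- r) l i.
Proof.
move=> h; elim: r => [|i r ih].
  by under eq_fun do rewrite big_nil; rewrite big_nil; exact: cvg_cst.
under eq_fun do rewrite big_cons; rewrite big_cons.
by apply: cvgD; [exact: h|exact: ih].
Qed.

Section matrix_exponential.
Context {R : realType} {n : nat}.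
Variable M : 'M[R]_n.
Implicit Types (i j : 'I_n) (t : R).

Let B : R := \sum_i \sum_j `|M i j|.

Let B0 : 0 <= B.
Proof. by apply: sumr_ge0 => i _; apply: sumr_ge0. Qed.

Let exp_bound k i j : `|(M ^+ k : 'M[R]_n) i j| <= B ^+ k.
Proof.
elim: k i => [|k ih] i.
  by rewrite !expr0 mxE; case: (_ == _); rewrite ?normr1 ?normr0.
rewrite exprS [(M * _)]/(M *m _) mxE exprS (le_trans (ler_norm_sum _ _ _))//.
apply: (@le_trans _ _ (\sum_l `|M i l| * B ^+ k)).
  by apply: ler_sum => l _; rewrite normrM ler_wpM2l.
rewrite -mulr_suml ler_wpM2r ?exprn_ge0// /B [leRHS](bigD1 i)//= lerDl.
by apply: sumr_ge0 => l _; exact: sumr_ge0.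
Qed.

Let exprZmx t k : (t *: M) ^+ k = t ^+ k *: (M ^+ k : 'M[R]_n).
Proof.
elim: k => [|k ih]; first by rewrite !expr0 scale1r.
rewrite !exprS ih -[LHS]/((t *: M) *m (t ^+ k *: (M ^+ k : 'M[R]_n))).
by rewrite -scalemxAl -scalemxAr scalerA.
Qed.

Let cvg_pseries_fact (u : nat -> R) (C : R) t : 0 <= C ->
  (forall k, `|u k| <= C * B ^+ k / k`!%:R) -> cvgn (pseries u t).
Proof.
move=> C0 uC; apply: normed_cvg.
have h : cvgn (series (exp_coeff (B * `|t|))) by exact: is_cvg_series_exp_coeff.
have := @is_cvg_seriesZ _ _ C h.
apply: series_le_cvg => [k|k|k]; first exact: normr_ge0.
  rewrite -[(_ *: _) k]/(C * exp_coeff (B * `|t|) k) mulr_ge0// exp_coeff_ge0//.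
  by rewrite mulr_ge0.
rewrite -[(_ *: _) k]/(C * exp_coeff (B * `|t|) k) /exp_coeff /= normrM normrX exprMn.
apply: (le_trans (ler_wpM2r (exprn_ge0 k (normr_ge0 t)) (uC k))).
by rewrite le_eqVlt; apply/orP; left; apply/eqP; ring.
Qed.

Let a i j k := (k`!%:R)^-1 * (M ^+ k : 'M[R]_n) i j.

Let expm_pseries t i j : expm (t *: M) i j = limn (pseries (a i j) t).
Proof.
rewrite mxE; congr (lim (_ @ \oo)); apply/funext => N.
rewrite /pseries /series /= big_mkord summxE; apply: eq_bigr => k _.
by rewrite exprZmx !mxE /a; ring.
Qed.

Let a_bound i j k : `|a i j k| <= 1 * B ^+ k / k`!%:R.
Proof.
by rewrite /a normrM ger0_norm ?invr_ge0// mulrC ler_wpM2r ?invr_ge0// mul1r.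
Qed.

Let factS_inv k : k.+1%:R * (k.+1`!%:R)^-1 = (k`!%:R)^-1 :> R.
Proof. by rewrite factS natrM invfM mulVKf// pnatr_eq0. Qed.

Let diffs_a i j k : pseries_diffs (a i j) k = (k`!%:R)^-1 * (M ^+ k.+1 : 'M[R]_n) i j.
Proof. by rewrite /pseries_diffs /a mulrA factS_inv. Qed.

Let diffs2_a i j k : pseries_diffs (pseries_diffs (a i j)) k =
  (k`!%:R)^-1 * (M ^+ k.+2 : 'M[R]_n) i j.
Proof. by rewrite {1}/pseries_diffs diffs_a mulrA factS_inv. Qed.

Let cvg_a t i j : cvgn (pseries (a i j) t).
Proof. exact: cvg_pseries_fact ler01 (a_bound i j). Qed.

Let cvg_diffs t i j : cvgn (pseries (pseries_diffs (a i j)) t).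
Proof.
apply: cvg_pseries_fact B0 _ => k; rewrite diffs_a normrM ger0_norm ?invr_ge0//.
by rewrite mulrC ler_wpM2r ?invr_ge0// -exprS.
Qed.

Let cvg_diffs2 t i j : cvgn (pseries (pseries_diffs (pseries_diffs (a i j))) t).
Proof.
apply: cvg_pseries_fact (sqr_ge0 B) _ => k.
rewrite diffs2_a normrM ger0_norm ?invr_ge0//.
by rewrite mulrC ler_wpM2r ?invr_ge0// -exprD add2n.
Qed.

Let lim_diffs_l t i j : limn (pseries (pseries_diffs (a i j)) t) =
  (M *m expm (t *: M)) i j.
Proof.
rewrite mxE; apply/cvg_lim => //.
rewrite (_ : pseries _ _ = (fun N => \sum_l M i l * pseries (a l j) t N)).
  apply: (cvg_sumr (f := fun l N => M i l * pseries (a l j) t N)) => l.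
  by apply: cvgM; [exact: cvg_cst|rewrite expm_pseries; exact: cvg_a].
apply/funext => N; rewrite /pseries /series/=.
under [RHS]eq_bigr do rewrite mulr_sumr; rewrite exchange_big/=.
apply: eq_bigr => k _; rewrite diffs_a exprS [(M * _)]/(M *m _) mxE mulr_sumr mulr_suml.
by apply: eq_bigr => l _; rewrite /a; ring.
Qed.

Let lim_diffs_r t i j : limn (pseries (pseries_diffs (a i j)) t) =
  (expm (t *: M) *m M) i j.
Proof.
rewrite mxE; apply/cvg_lim => //.
rewrite (_ : pseries _ _ = (fun N => \sum_l pseries (a i l) t N * M l j)).
  apply: (cvg_sumr (f := fun l N => pseries (a i l) t N * M l j)) => l.
  by apply: cvgM; [rewrite expm_pseries; exact: cvg_a|exact: cvg_cst].
apply/funext => N; rewrite /pseries /series/=.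
under [RHS]eq_bigr do rewrite mulr_suml; rewrite exchange_big/=.
apply: eq_bigr => k _; rewrite diffs_a exprSr [(_ * M)]/(_ *m M) mxE mulr_sumr mulr_suml.
by apply: eq_bigr => l _; rewrite /a; ring.
Qed.

Lemma expm_comm t : M *m expm (t *: M) = expm (t *: M) *m M.
Proof. by apply/matrixP => i j; rewrite -lim_diffs_l lim_diffs_r. Qed.

(** Each entry is a power series in [t], differentiated term by term. *)
Lemma expm_is_derive t i j :
  is_derive t 1 (fun s => expm (s *: M) i j) ((M *m expm (t *: M)) i j).
Proof.
rewrite -lim_diffs_l.
rewrite (_ : (fun s => _) = (fun s => limn (pseries (a i j) s))); last first.
  by apply/funext => s; rewrite expm_pseries.
apply: (@pseries_snd_diffs _ _ (`|t| + 1)) => //.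
by rewrite [ltRHS]ger0_norm ?ltrDl// addr_ge0.
Qed.

Lemma expm0 : expm (0 *: M) = 1%:M.
Proof.
apply/matrixP => i j; rewrite expm_pseries; apply/cvg_lim => //.
rewrite -(cvg_shiftn 1).
rewrite (_ : (fun N => _) = cst ((1%:M : 'M[R]_n) i j)); first exact: cvg_cst.
apply/funext => N; rewrite /pseries /series/= addn1 big_nat_recl//= big1 ?addr0.
  by rewrite /a fact0 invr1 mul1r !expr0 mulr1.
by move=> k _; rewrite exprS mul0r mulr0.
Qed.

(** The derivative in [x] of [expm ((c - x) *: M) *m expm (x *: M)] is 0, as [M]
    commutes with its exponential. *)
Lemma expmD s t : expm (s *: M) *m expm (t *: M) = expm ((s + t) *: M).
Proof.
pose c := s + t; have -> : s = c - t by rewrite /c addrK.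
rewrite subrK; apply/matrixP => i j.
pose F := fun x : R => \sum_l expm ((c - x) *: M) i l * expm (x *: M) l j.
have F0 (x : R) : is_derive x 1 F 0.
  pose G x := fun l => - (M *m expm ((c - x) *: M)) i l * expm (x *: M) l j +
    expm ((c - x) *: M) i l * (M *m expm (x *: M)) l j.
  have -> : 0 = \sum_l G x l.
    have := congr1 (fun A : 'M[R]_n => A i j)
      (mulmxA (expm ((c - x) *: M)) M (expm (x *: M))).
    rewrite -expm_comm !mxE => E; rewrite /G big_split/= E -big_split/= big1// => l _.
    by rewrite mulNr addNr.
  apply: is_derive_sumr => l _; apply: is_deriveMr; last exact: expm_is_derive.
  exact: (is_derive_reflect (expm_is_derive _ _ _)).
have := @is_derive_0_is_cst _ F t 0 F0.
rewrite /F subr0 expm0 => E; rewrite mxE E.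
by have := congr1 (fun A : 'M[R]_n => A i j) (mulmx1 (expm (c *: M))); rewrite mxE.
Qed.

Lemma expm_continuous i j : continuous (fun t => expm (t *: M) i j).
Proof. by move=> t; apply: is_derive_continuous; exact: expm_is_derive. Qed.

End matrix_exponential.

(** * Vanishing functions and Gronwall estimates *)

Section vanishing_functions.
Context {R : realType}.
Implicit Types (rho f : R -> R).

(** By monotonicity [rho s] bounds [rho] at all later times; it costs nothing for the
    errors of interest, by [vanishing_majorant]. *)
Definition vanishing rho := [/\ forall s t, 0 <= s -> s <= t -> rho t <= rho s,
  forall t, 0 <= t -> 0 <= rho t & rho t @[t --> +oo] --> 0].

Lemma vanishingD rho1 rho2 : vanishing rho1 -> vanishing rho2 ->
  vanishing (fun t => rho1 t + rho2 t).
Proof.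
move=> [m1 p1 c1] [m2 p2 c2]; split=> [s t s0 st|t t0|].
- by rewrite lerD ?m1 ?m2.
- by rewrite addr_ge0 ?p1 ?p2.
- by rewrite -[X in _ --> X]addr0; exact: cvgD.
Qed.

Lemma vanishingZ a rho : 0 <= a -> vanishing rho -> vanishing (fun t => a * rho t).
Proof.
move=> a0 [m1 p1 c1]; split=> [s t s0 st|t t0|].
- by rewrite ler_wpM2l ?m1.
- by rewrite mulr_ge0 ?p1.
- by rewrite -[X in _ --> X](mulr0 a); apply: cvgM => //; exact: cvg_cst.
Qed.

Lemma vanishing0 : vanishing (fun=> 0).
Proof. by split => //; exact: cvg_cst. Qed.

Lemma vanishing_sum (I : Type) (r : seq I) (rho : I -> R -> R) :
  (forall i, vanishing (rho i)) -> vanishing (fun t => \sum_(i <- r) rho i t).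
Proof.
move=> h; elim: r => [|i r ih].
  by under eq_fun do rewrite big_nil; exact: vanishing0.
by under eq_fun do rewrite big_cons; exact: vanishingD.
Qed.

Lemma cvg_expR_decay (k : R) : 0 < k -> expR (- k * t) @[t --> +oo] --> (0 : R).
Proof.
move=> k0; apply/cvgrPdist_lt => /= e e0.
exists (- ln e / k); split; first by rewrite num_real.
move=> t; rewrite ltr_pdivrMr// => h.
rewrite sub0r normrN ger0_norm ?expR_ge0// -[ltRHS]lnK ?posrE// ltr_expR.
by rewrite mulNr ltrNl mulrC.
Qed.

Lemma vanishing_exp (k : R) : 0 < k -> vanishing (fun t => expR (- k * t)).
Proof.
move=> k0; split=> [s t s0 st|t t0|]; last exact: cvg_expR_decay.
  by rewrite ler_expR !mulNr lerN2 ler_pM2l.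
exact: expR_ge0.
Qed.

Lemma vanishing_comp rho (g : R -> R) : vanishing rho ->
  (forall s t, 0 <= s -> s <= t -> g s <= g t) -> (forall t, 0 <= t -> 0 <= g t) ->
  g t @[t --> +oo] --> +oo -> vanishing (fun t => rho (g t)).
Proof.
move=> [m1 p1 c1] gm g0 gy; split=> [s t s0 st|t t0|].
- by apply: m1; [exact: g0|exact: gm].
- by apply: p1; exact: g0.
- exact: cvg_comp gy c1.
Qed.

Lemma vanishing_delay rho (D : R) : vanishing rho ->
  vanishing (fun t => rho (Num.max 0 (t - D))).
Proof.
move=> h; apply: (vanishing_comp h) => [s t s0 st|t t0|].
- by rewrite ge_max !le_max lexx /= lerD2r st orbT.
- by rewrite le_max lexx.
apply/cvgryPge => A; near=> t; rewrite le_max; apply/orP; right.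
by rewrite lerBrDr; near: t; apply: nbhs_pinfty_ge; exact: num_real.
Unshelve. all: by end_near. Qed.

Lemma vanishing_mid rho (s0 : R) : 0 <= s0 -> vanishing rho ->
  vanishing (fun t => rho ((s0 + t) / 2)).
Proof.
move=> s00 h; apply: (vanishing_comp h) => [s t _ st|t t0|].
- by rewrite ler_pM2r// lerD2l.
- by rewrite divr_ge0// addr_ge0.
apply/cvgryPge => A; near=> t; rewrite ler_pdivlMr// -lerBlDl.
by near: t; apply: nbhs_pinfty_ge; exact: num_real.
Unshelve. all: by end_near. Qed.

Lemma bounded_half_line f (l : R) : {within `[0, +oo[, continuous f} ->
  f t @[t --> +oo] --> l -> exists B, forall t, 0 <= t -> `|f t| <= B.
Proof.
move=> cf fl.
have /cvgrPdist_lt/(_ 1 ltr01)[A [_ hA]] := fl.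
pose T := Num.max 0 A + 1.
have T0 : 0 <= T by rewrite addr_ge0// le_max lexx.
have AT : A < T by rewrite /T (le_lt_trans (y := Num.max 0 A)) ?ltrDl// le_max lexx orbT.
have cfT : {within `[0, T], continuous f}.
  by apply: continuous_subspaceW cf; apply: subset_itvl.
have [B [_ hB]] := compact_bounded (continuous_compact cfT (@segment_compact R 0 T)).
exists (Num.max (B + 1) (`|l| + 1)) => t t0; rewrite le_max; apply/orP.
have [tT|Tt] := leP t T.
  left; apply: (hB (B + 1)); first by rewrite ltrDl.
  by exists t => //=; rewrite in_itv/= t0.
right; have := hA t (lt_trans AT Tt) => /= h.
rewrite -[f t](subrK l) (le_trans (ler_normD _ _))// addrC lerD2l.
by rewrite distrC ltW.
Qed.

(** The majorant is the running supremum of the norm. *)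
Lemma vanishing_majorant f : {within `[0, +oo[, continuous f} ->
  f t @[t --> +oo] --> 0 ->
  exists2 rho, vanishing rho & forall t, 0 <= t -> `|f t| <= rho t.
Proof.
move=> cf f0; have [B hB] := bounded_half_line cf f0.
pose A t := [set `|f s| | s in [set s | 0 <= s /\ t <= s]].
have Aub t : has_ubound (A t) by exists B => _ [s [s0 _] <-]; exact: hB.
have An0 t : A t !=set0.
  by exists `|f (Num.max 0 t)|, (Num.max 0 t) => //=; rewrite !le_max !lexx orbT.
pose rho t := sup (A t).
have frho t : 0 <= t -> `|f t| <= rho t.
  by move=> t0; apply: ub_le_sup => //; exists t.
exists rho => //; split=> [s t s0 st|t t0|].
- apply: ge_sup => // _ [x [x0 tx] <-]; apply: ub_le_sup => //.
  by exists x => //=; split => //; exact: le_trans tx.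
- by apply: le_trans (frho _ t0).
apply/cvgrPdist_le => /= e e0.
have /cvgrPdist_lt/(_ e e0)[T [_ hT]] := f0.
exists (Num.max 0 T); split; first by rewrite num_real.
move=> t; rewrite gt_max => /andP[t0 Tt].
rewrite sub0r normrN ger0_norm ?(le_trans _ (frho _ (ltW t0)))//.
apply: ge_sup => // _ [x [x0 tx] <-].
by have := hT x (lt_le_trans Tt tx); rewrite sub0r normrN => /ltW.
Qed.

End vanishing_functions.

Section Gronwall.
Context {R : realType}.
Implicit Types (V dV : R -> R).

(** The point [e] accounts for the time at which the derivative of an energy is not
    defined, because of the jump of the delayed control. *)
Lemma nonincreasing_off_point V dV (s t e : R) : s <= t ->
  {within `[s, t], continuous V} ->
  (forall x, s < x < t -> x != e -> is_derive x 1 V (dV x) /\ dV x <= 0) ->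
  V t <= V s.
Proof.
move=> st cV dVx.
have base a b : s <= a -> a <= b -> b <= t -> (forall x, a < x < b -> x != e) -> V b <= V a.
  move=> sa ab bt abe.
  have d x : x \in `]a, b[ -> derivable V x 1 /\ derive1 V x <= 0.
    rewrite in_itv/= => xab; have [||dx dx0] := dVx x.
    - case/andP: xab => ax xb.
      by rewrite (le_lt_trans sa ax) (lt_le_trans xb bt).
    - exact: abe.
    by split; [exact: ex_derive|rewrite derive1E derive_val].
  apply: (@ler0_derive1_le_cc _ V a b) => //.
  - by move=> x /d[].
  - by move=> x /d[].
  - by apply: continuous_subspaceW cV; apply: subset_itv; rewrite bnd_simp.
  - by rewrite in_itv/= lexx ab.
  - by rewrite in_itv/= lexx ab.
have [/andP[se et]|nse] := boolP (s < e < t); last first.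
  apply: base => // x xst; apply: contraNneq nse => <-//.
apply: (@le_trans _ _ (V e)); apply: base => //; rewrite ?(ltW se) ?(ltW et)//.
  by move=> x /andP[ex _]; rewrite gt_eqF.
by move=> x /andP[_ xe]; rewrite lt_eqF.
Qed.

(** The function decays at rate [2k] under a forcing of rate [k], so that no resonant
    factor [t] appears. *)
Lemma Gronwall V dV (s t e k M N : R) : s <= t -> 0 < k -> 0 <= M -> 0 <= N ->
  {within `[s, t], continuous V} ->
  (forall x, s < x < t -> x != e -> is_derive x 1 V (dV x) /\
    dV x <= - (2 * k) * V x + N * expR (- k * x) + M) ->
  V t <= expR (- (2 * k) * (t - s)) * V s + N / k * expR (- k * t) + M / (2 * k).
Proof.
move=> st k0 M0 N0 cV dVx.
(* [U] solves the differential equation exactly. *)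
pose U (x : R) := N / k * expR (- k * x) + M / (2 * k).
pose W (x : R) := expR (2 * k * x) * (V x - U x).
have dexp (a x : R) : is_derive x 1 (fun x => expR (a * x)) (a * expR (a * x)).
  have h := is_deriveZr a (is_derive_id x 1).
  have := @is_derive1_comp _ expR _ x _ _ (is_derive_expR (a * x)) h.
  by rewrite mulr1 mulrC.
have dU (x : R) : is_derive x 1 U (- N * expR (- k * x)).
  have := is_deriveDr (is_deriveZr (N / k) (dexp (- k) x)) (is_derive_cst (M / (2 * k)) x 1).
  by rewrite addr0 mulrA mulrN divfK ?gt_eqF.
have cexp a : {within `[s, t], continuous (fun x : R => expR (a * x))}.
  by apply: continuous_within => x; exact: is_derive_continuous (dexp a x).
have : W t <= W s.
  pose dW x := 2 * k * expR (2 * k * x) * (V x - U x) +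
    expR (2 * k * x) * (dV x - - N * expR (- k * x)).
  apply: (@nonincreasing_off_point W dW s t e st).
    apply: within_continuousM => //; apply: within_continuousBr => //.
    by apply: continuous_within => x; exact: is_derive_continuous (dU x).
  move=> x xst xe; have [dx dxle] := dVx _ xst xe; split.
    by apply: is_deriveMr => //; exact: is_deriveBr.
  rewrite /dW.
  have -> : 2 * k * expR (2 * k * x) * (V x - U x) +
      expR (2 * k * x) * (dV x - - N * expR (- k * x)) =
    expR (2 * k * x) * (dV x - (- (2 * k) * V x + N * expR (- k * x) + M)).
    by rewrite /U; field; rewrite gt_eqF.
  by rewrite pmulr_rle0 ?expR_gt0// subr_le0.
rewrite /W -ler_pdivlMl ?expR_gt0// -expRN mulrA -expRD.
rewrite (_ : - (2 * k * t) + 2 * k * s = - (2 * k) * (t - s)); last by ring.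
rewrite lerBlDr => /le_trans; apply; rewrite -addrA lerD2r mulrBr gerBl.
apply: mulr_ge0; first exact: expR_ge0.
apply: addr_ge0; last by rewrite divr_ge0// mulr_ge0// ltW.
by rewrite mulr_ge0 ?expR_ge0// divr_ge0// ltW.
Qed.

Lemma expR_le1 (x : R) : x <= 0 -> expR x <= 1.
Proof. by move=> x0; rewrite -[leRHS]expR0 ler_expR. Qed.

(** Gronwall from [s0] to [m] and then from [m] to [t], where [m] is halfway from [s0] to [t]:
    on the second half [rho] is at most [rho m], which vanishes, and the energy at time [m]
    has half of the interval to be damped at rate [2k], hence by a factor [exp (- k t)].
    The order of the quantifiers matters: [rho'] serves every [V], in particular
    every initial condition and every number of modes. *)
Lemma decay_step (k s0 A : R) rho : 0 < k -> 0 <= s0 -> 0 <= A -> vanishing rho ->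
  exists2 rho', vanishing rho' & forall (N C0 J e : R) V dV,
    0 <= N -> 0 <= C0 -> 0 <= J ->
    {within `[s0, +oo[, continuous V} ->
    (forall t, s0 < t -> t != e -> is_derive t 1 V (dV t) /\
      dV t <= - (2 * k) * V t + N * J * expR (- k * t) + rho t) ->
    V s0 <= C0 * J + A ->
    forall t, s0 <= t ->
      V t <= expR (k * s0) * (C0 + 2 * N / k) * J * expR (- k * t) + rho' t.
Proof.
move=> k0 s00 A0 vrho; have [rm rp rc] := vrho.
have k20 : 0 < 2 * k by rewrite mulr_gt0.
pose rho' t := expR (k * s0) * (A + rho s0 / (2 * k)) * expR (- k * t) +
  (2 * k)^-1 * rho ((s0 + t) / 2).
exists rho'.
  apply: vanishingD; apply: vanishingZ.
  - by rewrite mulr_ge0 ?expR_ge0// addr_ge0// divr_ge0 ?rp// ltW.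
  - exact: vanishing_exp.
  - by rewrite invr_ge0 ltW.
  - exact: vanishing_mid.
move=> N C0 J e V dV N0 C00 J0 cV dVt Vs0 t s0t.
pose m := (s0 + t) / 2.
have [s0m mt] : s0 <= m /\ m <= t by rewrite /m; split; lra.
have m0 : 0 <= m by exact: le_trans s0m.
have NJ0 : 0 <= N * J by rewrite mulr_ge0.
have G a b : s0 <= a -> a <= b ->
  V b <= expR (- (2 * k) * (b - a)) * V a + N * J / k * expR (- k * b) + rho a / (2 * k).
  move=> s0a ab; apply: (@Gronwall V dV a b e) => //.
  - by apply: rp; exact: le_trans s0a.
  - by apply: continuous_subspaceW cV; apply: subset_itv; rewrite bnd_simp.
  move=> x /andP[ax xb] xe; have s0x : s0 < x by exact: le_lt_trans ax.
  have [dx dxle] := dVt _ s0x xe; split=> //; apply: (le_trans dxle).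
  by rewrite lerD2l rm ?(le_trans _ s0a)// ltW.
have h1 := G s0 m (lexx _) s0m; have h2 := G m t s0m mt.
have Em : expR (- (2 * k) * (t - m)) = expR (k * s0) * expR (- k * t).
  by rewrite -expRD; congr expR; rewrite /m; field.
have Es : expR (- (2 * k) * (m - s0)) = expR (k * s0) * expR (- k * t).
  by rewrite -expRD; congr expR; rewrite /m; field.
set E := expR (k * s0) * expR (- k * t) in Em Es.
have E0 : 0 <= E by rewrite mulr_ge0 ?expR_ge0.
have E1 : E <= 1.
  by rewrite -Em expR_le1// mulNr oppr_le0 mulr_ge0 ?subr_ge0// ltW.
have em1 : expR (- k * m) <= 1.
  by rewrite expR_le1// mulNr oppr_le0 mulr_ge0// ltW.
have et : expR (- k * t) <= E.
  by rewrite /E ler_peMl ?expR_ge0// -[leLHS]expR0 ler_expR mulr_ge0// ltW.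
have NJk : 0 <= N * J / k by rewrite divr_ge0// ltW.
have Vm : V m <= C0 * J + A + N * J / k + rho s0 / (2 * k).
  apply: (le_trans h1); rewrite lerD2r; apply: lerD.
    rewrite Es; apply: (le_trans (ler_wpM2l E0 Vs0)).
    by rewrite ler_piMl// addr_ge0// mulr_ge0.
  by rewrite ler_piMr.
apply: (le_trans h2); rewrite Em.
apply: (@le_trans _ _ (E * (C0 * J + A + N * J / k + rho s0 / (2 * k)) +
    N * J / k * E + rho m / (2 * k))).
  by rewrite lerD2r lerD// ler_wpM2l.
rewrite /rho' -/m [leRHS](_ : _ = E * (C0 * J + A + N * J / k + rho s0 / (2 * k)) +
    N * J / k * E + rho m / (2 * k))//.
by rewrite /E; field; rewrite gt_eqF.
Qed.

End Gronwall.

(** * Linear systems with a Hurwitz matrix *)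

Section Hurwitz_decay.
Context {R : realType}.

Lemma row_functional_bound (n : nat) (q : 'rV[R]_n) : exists2 c : R, 0 <= c &
  forall (G : 'cV[R]_n) (m : R), (forall i, (G i 0) ^+ 2 <= m) ->
    ((q *m G) 0 0) ^+ 2 <= c * m.
Proof.
exists ((\sum_i `|q 0 i|) ^+ 2) => [|G m Gm]; first exact: sqr_ge0.
case: n q G Gm => [|n] q G Gm.
  by rewrite mxE !big_ord0 expr0n/= mul0r.
have m0 : 0 <= m by apply: le_trans (Gm ord0); exact: sqr_ge0.
rewrite -[X in _ * X]sqr_sqrtr// -exprMn -real_normK ?num_real//.
rewrite lerXn2r ?nnegrE ?mulr_ge0 ?sqrtr_ge0//; first exact: sumr_ge0.
rewrite mxE (le_trans (ler_norm_sum _ _ _))// mulr_suml; apply: ler_sum => i _.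
by rewrite normrM ler_wpM2l// -sqrtr_sqr ler_wsqrtr.
Qed.

(** Differentiability is not asked for at time [e]: in the closed loop, the evolution
    equation need not hold at the time at which the delayed control jumps. *)
Definition linear_system (n : nat) (M : 'M[R]_n) (e : R) (G Z : R -> 'cV[R]_n) :=
  (forall i, {within `[0, +oo[, continuous (fun t => Z t i 0)}) /\
  (forall t, 0 < t -> t != e -> forall i,
    is_derive t 1 (fun s => Z s i 0) ((M *m Z t + G t) i 0)).

Local Notation C := R[i].

Lemma row_derive (n : nat) (q : 'rV[R]_n) (Z : R -> 'cV[R]_n) (dZ : 'cV[R]_n) (t : R) :
  (forall i, is_derive t 1 (fun s => Z s i 0) (dZ i 0)) ->
  is_derive t 1 (fun s => (q *m Z s) 0 0) ((q *m dZ) 0 0).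
Proof.
move=> h; rewrite mxE; under eq_fun do rewrite mxE.
by apply: is_derive_sumr => i _; apply: is_deriveZr.
Qed.

Lemma row_continuous (n : nat) (q : 'rV[R]_n) (Z : R -> 'cV[R]_n) (A : set R) :
  (forall i, {within A, continuous (fun t => Z t i 0)}) ->
  {within A, continuous (fun t => (q *m Z t) 0 0)}.
Proof.
move=> h; under eq_fun do rewrite mxE.
by apply: within_continuous_sum => i _; exact: within_continuousZ.
Qed.

(** The system is real but the rows to follow are complex, as the roots are: their real
    and imaginary parts are treated together. *)
Let Rew (n : nat) (Q : 'rV[C]_n) : 'rV[R]_n := map_mx (@complex.Re R) Q.
Let Imw (n : nat) (Q : 'rV[C]_n) : 'rV[R]_n := map_mx (@complex.Im R) Q.
Let cplx (n : nat) (M : 'M[R]_n) : 'M[C]_n := map_mx (real_complex R) M.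

Let Rew_step (n : nat) (M : 'M[R]_n) (z : C) (Q : 'rV[C]_n) :
  Rew (Q *m (cplx M - z%:M)) =
  Rew Q *m M - (complex.Re z *: Rew Q - complex.Im z *: Imw Q).
Proof.
apply/rowP => j; rewrite mulmxBr mul_mx_scalar !mxE raddfB/=; congr (_ - _).
  rewrite raddf_sum/=; apply: eq_bigr => l _; rewrite !mxE.
  by case: (Q 0 l) => a b /=; rewrite mulr0 subr0.
by case: (Q 0 j) => a b; case: z => x y.
Qed.

Let Imw_step (n : nat) (M : 'M[R]_n) (z : C) (Q : 'rV[C]_n) :
  Imw (Q *m (cplx M - z%:M)) =
  Imw Q *m M - (complex.Im z *: Rew Q + complex.Re z *: Imw Q).
Proof.
apply/rowP => j; rewrite mulmxBr mul_mx_scalar !mxE raddfB/=; congr (_ - _).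
  rewrite raddf_sum/=; apply: eq_bigr => l _; rewrite !mxE.
  by case: (Q 0 l) => a b /=; rewrite mulr0 add0r.
by case: (Q 0 j) => a b; case: z => x y /=; rewrite addrC.
Qed.

Lemma Young_sqr (k p a b : R) : 0 < k ->
  2 * p * (a + b) <= 2 * k * p ^+ 2 + (a ^+ 2 + b ^+ 2) / k.
Proof.
move=> k0; rewrite -subr_ge0.
have -> : 2 * k * p ^+ 2 + (a ^+ 2 + b ^+ 2) / k - 2 * p * (a + b) =
  ((k * p - a) ^+ 2 + (k * p - b) ^+ 2) / k by field; rewrite gt_eqF.
by rewrite divr_ge0 ?addr_ge0 ?sqr_ge0// ltW.
Qed.

(** Induction on the sequence [s] of roots.  The function [Q *m Z] is damped at rate
    [Re z] and forced by [Q *m (M - z) *m Z], where the row [Q *m (M - z)] is annihilated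
    by the remaining factors and so decays by induction.  This takes the place
    of a Jordan form. *)
Lemma annihilated_row_decay (n : nat) (M : 'M[R]_n) (k : R) (s : seq C)
    (Q : 'rV[C]_n) : 0 < k -> all (fun z => complex.Re z <= - (2 * k)) s ->
  Q *m foldr (fun z A => (cplx M - z%:M) *m A) 1%:M s = 0 ->
  exists2 K, 0 <= K & forall rho, vanishing rho ->
  exists2 rho', vanishing rho' & forall e J G Z, linear_system M e G Z ->
    (forall t, 0 <= t -> forall i, (G t i 0) ^+ 2 <= rho t) ->
    (forall i, (Z 0 i 0) ^+ 2 <= J) -> 0 <= J ->
    forall t, 0 <= t ->
      ((Rew Q *m Z t) 0 0) ^+ 2 + ((Imw Q *m Z t) 0 0) ^+ 2
        <= K * J * expR (- k * t) + rho' t.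
Proof.
move=> k0; elim: s Q => [|z s ih] Q /=.
  rewrite mulmx1 => _ ->; exists 0 => // rho vrho; exists (fun=> 0).
    exact: vanishing0.
  move=> e J G Z _ _ _ J0 t t0.
  have -> : Rew (0 : 'rV[C]_n) = 0 by apply/rowP => j; rewrite !mxE.
  have -> : Imw (0 : 'rV[C]_n) = 0 by apply/rowP => j; rewrite !mxE.
  by rewrite !mul0mx mxE expr0n/= !mul0r !addr0.
move=> /andP[zk sk]; rewrite mulmxA => /(ih _ sk)[K1 K10 h1].
have [c1 c10 hc1] := row_functional_bound (Rew Q).
have [c2 c20 hc2] := row_functional_bound (Imw Q).
exists (expR (k * 0) * ((c1 + c2) + 2 * (K1 / k) / k)).
  rewrite mulr_ge0 ?expR_ge0// addr_ge0//; first exact: addr_ge0.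
  by apply: divr_ge0; [rewrite mulr_ge0// divr_ge0// ltW|exact: ltW].
move=> rho vrho; have [rho1 vrho1 {}h1] := h1 rho vrho.
have vrho2 : vanishing (fun t => k^-1 * (rho1 t + (c1 + c2) * rho t)).
  apply: vanishingZ; first by rewrite invr_ge0 ltW.
  by apply: vanishingD => //; apply: vanishingZ => //; exact: addr_ge0.
have [rho' vrho' h] := decay_step k0 (lexx 0) (lexx 0) vrho2.
exists rho' => // e J G Z sys Grho Z0J J0.
have {}h1 := h1 e J G Z sys Grho Z0J J0.
have [cZ dZ] := sys.
pose p t := (Rew Q *m Z t) 0 0; pose q t := (Imw Q *m Z t) 0 0.
pose dp t := (Rew Q *m (M *m Z t + G t)) 0 0.
pose dq t := (Imw Q *m (M *m Z t + G t)) 0 0.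
pose hp t := (Rew (Q *m (cplx M - z%:M)) *m Z t) 0 0.
pose hq t := (Imw (Q *m (cplx M - z%:M)) *m Z t) 0 0.
pose gp t := (Rew Q *m G t) 0 0; pose gq t := (Imw Q *m G t) 0 0.
have dpE t : dp t = hp t + gp t + (complex.Re z * p t - complex.Im z * q t).
  rewrite /dp /hp /gp Rew_step !mulmxDr !mulmxBl -!scalemxAl mulmxA.
  by rewrite ![(_ + _ : 'M[R]_1) _ _]mxE /p /q; rewrite !mxE; ring.
have dqE t : dq t = hq t + gq t + (complex.Im z * p t + complex.Re z * q t).
  rewrite /dq /hq /gq Imw_step !mulmxDr !mulmxBl !mulmxDl -!scalemxAl mulmxA.
  by rewrite ![(_ + _ : 'M[R]_1) _ _]mxE /p /q; rewrite !mxE; ring.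
pose V t := p t * p t + q t * q t.
pose dV t := (dp t * p t + p t * dp t) + (dq t * q t + q t * dq t).
have VE t : p t ^+ 2 + q t ^+ 2 = V t by rewrite !expr2.
move=> t t0; rewrite -/(p t) -/(q t) VE.
rewrite -[_ * J]mulrA -[X in X * _]mulr1.
apply: le_trans (h (K1 / k) (c1 + c2) J e V dV _ _ J0 _ _ _ t t0) _ => //.
- by rewrite divr_ge0// ltW.
- exact: addr_ge0.
- by apply: within_continuousDr; apply: within_continuousM; exact: row_continuous.
- move=> x x0 xe; split.
    by apply: is_deriveDr; apply: is_deriveMr; apply: row_derive; exact: dZ.
  have Y1 := Young_sqr (p x) (hp x) (gp x) k0.
  have Y2 := Young_sqr (q x) (hq x) (gq x) k0.
  have -> : dV x = 2 * complex.Re z * (p x ^+ 2 + q x ^+ 2)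
      + 2 * p x * (hp x + gp x) + 2 * q x * (hq x + gq x).
    by rewrite /dV dpE dqE; ring.
  have H := h1 x (ltW x0); rewrite -/(hp x) -/(hq x) in H.
  have Gp : gp x ^+ 2 <= c1 * rho x by apply: hc1; exact: Grho (ltW x0).
  have Gq : gq x ^+ 2 <= c2 * rho x by apply: hc2; exact: Grho (ltW x0).
  have V0 : 0 <= p x ^+ 2 + q x ^+ 2 by rewrite addr_ge0 ?sqr_ge0.
  have S : k^-1 * (hp x ^+ 2 + gp x ^+ 2 + (hq x ^+ 2 + gq x ^+ 2)) <=
      k^-1 * (K1 * J * expR (- k * x) + rho1 x + (c1 + c2) * rho x).
    by rewrite ler_wpM2l ?invr_ge0 ?(ltW k0)//; lra.
  have zV : 2 * complex.Re z * (p x ^+ 2 + q x ^+ 2) <=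
      2 * (- (2 * k)) * (p x ^+ 2 + q x ^+ 2).
    by apply: ler_wpM2r => //; rewrite ler_pM2l.
  rewrite /V -!expr2; move: Y1 Y2 S zV; rewrite !(mulrC _ k^-1).
  rewrite -[k^-1 * K1 * J * _]mulrA -[k^-1 * K1 * _]mulrA mulrA !mulrDr; lra.
- rewrite addr0 /V -!expr2 mulrDl lerD//; [exact: hc1|exact: hc2].
by rewrite mulr1 mulrA.
Qed.

(** Cayley-Hamilton, the characteristic polynomial being split over the complex numbers. *)
Lemma Hurwitz_roots (n : nat) (M : 'M[R]_n) : Hurwitz M ->
  exists (k : R) (s : seq C), [/\ 0 < k,
    all (fun z => complex.Re z <= - (2 * k)) s &
    foldr (fun z A => (cplx M - z%:M) *m A) 1%:M s = 0 :> 'M[C]_n].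
Proof.
move=> HM.
have [s Es] := closed_field_poly_normal (char_poly (cplx M)).
rewrite (monicP (char_poly_monic _)) scale1r in Es.
have sneg z : z \in s -> complex.Re z < 0.
  move=> zs; apply: HM; rewrite eigenvalue_root_char Es.
  by rewrite root_prod_XsubC.
have [k k0 ks] : exists2 k : R, 0 < k & all (fun z => complex.Re z <= - (2 * k)) s.
  elim: s sneg {Es} => [|z s ih] sneg; first by exists 1.
  have [|k k0 ks] := ih; first by move=> x xs; apply: sneg; rewrite inE xs orbT.
  have z0 := sneg z (mem_head _ _).
  exists (Num.min k (- complex.Re z / 2)); first by rewrite lt_min k0 divr_gt0// oppr_gt0.
  rewrite /=; apply/andP; split.
    rewrite lerNr mulrC -ler_pdivlMr// ge_min; apply/orP; right.
    by [].
  apply: sub_all ks => x /le_trans; apply; rewrite lerN2 ler_pM2l// ge_min lexx.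
  by [].
exists k, s; split => //.
case: n M HM s Es sneg ks => [|n] M HM s Es sneg ks.
  by apply/matrixP => -[].
have -> : foldr (fun z A => (cplx M - z%:M) *m A) 1%:M s =
    horner_mx (cplx M) (\prod_(z <- s) ('X - z%:P)).
  elim: s {Es sneg ks} => [|z s ih]; first by rewrite big_nil [RHS]rmorph1.
  by rewrite big_cons rmorphM rmorphB/= horner_mx_X horner_mx_C /= ih.
by rewrite -Es Cayley_Hamilton.
Qed.

(** The rate can be any number up to [k0]: it will also have to fit the spectral gap of
    the high modes. *)
Theorem Hurwitz_decay (n : nat) (M : 'M[R]_n) : Hurwitz M ->
  exists2 k0, 0 < k0 & forall k, 0 < k <= k0 ->
  exists2 K, 0 <= K & forall rho, vanishing rho ->
  exists2 rho', vanishing rho' & forall e J G Z, linear_system M e G Z ->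
    (forall t, 0 <= t -> forall i, (G t i 0) ^+ 2 <= rho t) ->
    (forall i, (Z 0 i 0) ^+ 2 <= J) -> 0 <= J ->
    forall t, 0 <= t -> forall i,
      (Z t i 0) ^+ 2 <= K * J * expR (- k * t) + rho' t.
Proof.
move=> /Hurwitz_roots[k0 [s [k00 sk0 s0]]]; exists k0 => // k /andP[kpos kk0].
have sk : all (fun z : C => complex.Re z <= - (2 * k)) s.
  by apply: sub_all sk0 => x /le_trans; apply; rewrite lerN2 ler_pM2l.
have H (i : 'I_n) : exists K, 0 <= K /\ forall rho, vanishing rho ->
  exists2 rho', vanishing rho' & forall e J G Z, linear_system M e G Z ->
    (forall t, 0 <= t -> forall i, (G t i 0) ^+ 2 <= rho t) ->
    (forall i, (Z 0 i 0) ^+ 2 <= J) -> 0 <= J ->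
    forall t, 0 <= t -> (Z t i 0) ^+ 2 <= K * J * expR (- k * t) + rho' t.
  have [|K K0 hK] := @annihilated_row_decay n M k s (delta_mx 0 i) kpos sk.
    by rewrite s0 mulmx0.
  exists K; split=> // rho /hK[rho' vrho' h]; exists rho' => // e J G Z sys GG ZJ J0 t t0.
  apply: le_trans (h e J G Z sys GG ZJ J0 t t0).
  have -> : Rew (delta_mx 0 i) = delta_mx 0 i.
    by apply/rowP => j; rewrite !mxE; case: (_ && _).
  by rewrite -rowE mxE lerDl sqr_ge0.
have [K hK] := choice H.
exists (\sum_i K i) => [|rho vrho]; first by apply: sumr_ge0 => i _; exact: (hK i).1.
have H2 i : exists rho', vanishing rho' /\ forall e J G Z, linear_system M e G Z ->
    (forall t, 0 <= t -> forall i, (G t i 0) ^+ 2 <= rho t) ->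
    (forall i, (Z 0 i 0) ^+ 2 <= J) -> 0 <= J ->
    forall t, 0 <= t -> (Z t i 0) ^+ 2 <= K i * J * expR (- k * t) + rho' t.
  by have [rho' v h] := (hK i).2 rho vrho; exists rho'; split.
have [rho' hrho'] := choice H2.
exists (fun t => \sum_i rho' i t).
  by apply: vanishing_sum => i; exact: (hrho' i).1.
move=> e J G Z sys GG ZJ J0 t t0 i.
apply: le_trans ((hrho' i).2 e J G Z sys GG ZJ J0 t t0) _.
apply: lerD.
  rewrite -!mulrA ler_wpM2r ?mulr_ge0 ?expR_ge0// (bigD1 i)//= lerDl.
  by apply: sumr_ge0 => l _; exact: (hK l).1.
rewrite (bigD1 i)//= lerDl; apply: sumr_ge0 => l _.
by have [[_ p _] _] := hrho' l; exact: p.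
Qed.

End Hurwitz_decay.

(** * Running integrals and the block structure of the model *)

Section running_integral.
Context {R : realType}.
Let mu : {measure set (measurableTypeR R) -> \bar R} := @lebesgue_measure R.
Implicit Types (f g : R -> R).

Definition locally_integrable_ge0 f :=
  forall t, 0 < t -> (@lebesgue_measure R).-integrable `[0, t] (EFin \o f).

Definition running_integral f t := (\int[@lebesgue_measure R]_(s in `[0%R, t]) f s)%R.

Lemma running_integral_lt0 f t : t < 0 -> running_integral f t = 0.
Proof.
by move=> t0; rewrite /running_integral set_itv_ge ?Rintegral_set0// bnd_simp -ltNge.
Qed.

Lemma running_integral0 f : running_integral f 0 = 0.
Proof. by rewrite /running_integral set_itv1 Rintegral_set1. Qed.

Lemma locally_integrable_mul f g : continuous g -> locally_integrable_ge0 f ->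
  locally_integrable_ge0 (fun t => g t * f t).
Proof.
move=> cg fi t t0.
have cgt : {within `[0, t], continuous g} by exact: continuous_within.
have -> : EFin \o (fun x => g x * f x) = ((EFin \o g) \* (EFin \o f))%E by [].
apply: integrableMr => //; last exact: fi.
  exact: subspace_continuous_measurable_fun.
have [B [_ hB]] := compact_bounded (continuous_compact cgt (@segment_compact R 0 t)).
exists B; split; first by rewrite num_real.
by move=> y By x xt; apply: hB => //; exists x.
Qed.

Section regularity.
Variable f : R -> R.
Hypothesis fi : locally_integrable_ge0 f.

Let f0 := f \_ `[0, +oo[.

Let f0i a t : a < 0 -> 0 < t -> mu.-integrable `[a, t] (EFin \o f0).
Proof.
move=> a0 t0; rewrite /f0 -restrict_EFin.
apply/integrable_restrict; [exact: measurable_itv|exact: measurable_itv|].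
have -> : `[a, t] `&` `[0, +oo[ = (`[0, t]%classic : set (measurableTypeR R)).
  apply/seteqP; split => x /=; rewrite !in_itv/= ?andbT.
    by move=> [/andP[ax xt] x0]; rewrite x0.
  by move=> /andP[x0 xt]; rewrite x0 xt (le_trans (ltW a0)).
exact: fi.
Qed.

Let running_f0 a t : a < 0 -> running_integral f t = parameterized_integral mu a t f0.
Proof.
move=> a0; rewrite /running_integral /parameterized_integral /f0.
rewrite Rintegral_mkcond [RHS]Rintegral_mkcond; apply: eq_Rintegral => x _.
rewrite !patchE !mem_setE !in_itv/= andbT.
case: (leP 0 x) => x0; case: (leP x t) => xt; rewrite ?andbF//= ?andbT.
  by rewrite (le_trans (ltW a0)).
by case: ifP.
Qed.

Lemma running_integral_continuous : continuous (running_integral f).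
Proof.
move=> t.
pose b := `|t| + 1; have b0 : 0 < b by rewrite ltr_wpDl.
have nb0 : - b < 0 by rewrite oppr_lt0.
have -> : running_integral f = fun t => parameterized_integral mu (- b) t f0.
  by apply/funext => s; exact: running_f0.
have h : {within `[- b, b], continuous (fun t => parameterized_integral mu (- b) t f0)}.
  by apply: parameterized_integral_continuous; [exact: (ltW (lt_trans nb0 b0))|exact: f0i].
have [hoo _ _] := (continuous_within_itvP _ (lt_trans nb0 b0)).1 h.
apply: hoo; rewrite in_itv/=.
have := ler_norm t; have := ler_norm (- t); rewrite normrN /b => h1 h2.
by apply/andP; split; lra.
Qed.

Lemma running_integral_is_derive t : 0 < t -> {for t, continuous f} ->
  is_derive t 1 (running_integral f) (f t).
Proof.
move=> t0 cf.
have t1 : t < t + 1 by rewrite ltrDl.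
have [d1 d2] := @continuous_FTC1_closed R f 0 t (t + 1) t1 (fi (lt_trans t0 t1)) t0 cf.
by apply: DeriveDef; [exact: d1|rewrite -derive1E; exact: d2].
Qed.

Lemma running_integral_is_derive_lt0 (t : R) : t < 0 ->
  is_derive t 1 (running_integral f) 0.
Proof.
move=> t0; have h := is_derive_cst (0 : R) t 1; apply: is_derive_near h.
near=> s; rewrite running_integral_lt0//; near: s; exact: lt_nbhsl.
Unshelve. all: by end_near. Qed.

Lemma running_integralB a t : (forall s, s < 0 -> f s = 0) -> a <= t -> 0 <= t ->
  (\int[mu]_(s in `[a, t]) f s)%R = running_integral f t - running_integral f a.
Proof.
move=> f00 at_ t0; have [a0|a0] := ltP a 0.
  rewrite (running_integral_lt0 _ a0) subr0 /running_integral.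
  rewrite Rintegral_mkcond [RHS]Rintegral_mkcond; apply: eq_Rintegral => x _.
  rewrite !patchE !mem_setE !in_itv/=.
  case: (leP 0 x) => x0; first by rewrite (le_trans (ltW a0) x0).
  by case: ifP => // _; rewrite f00.
have fit : mu.-integrable `[0, t] (EFin \o f).
  by apply: integrableS (fi (_ : 0 < t + 1)) => //; [apply: subset_itvl; rewrite bnd_simp lerDl|rewrite ltr_wpDl].
rewrite /running_integral Rintegral_itvB// Rintegral_itv_obnd_cbnd//.
by apply: integrableS fit => //; apply: subset_itv; rewrite bnd_simp.
Qed.

Lemma locally_integrable_itv a t : (forall s, s < 0 -> f s = 0) ->
  mu.-integrable `[a, t] (EFin \o f).
Proof.
move=> f00; pose b := `|t| + 1; have b0 : 0 < b by rewrite ltr_wpDl.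
pose c := - (`|a| + 1); have c0 : c < 0 by rewrite oppr_lt0 ltr_wpDl.
have E : f0 = f.
  by apply/funext => x; rewrite /f0 patchE mem_setE in_itv/= andbT; case: leP => // /f00 ->.
have := f0i c0 b0; rewrite E; apply: integrableS => //.
apply: subset_itv; rewrite bnd_simp /c /b.
  by have := ler_norm (- a); rewrite normrN; lra.
by have := ler_norm t; lra.
Qed.

End regularity.
End running_integral.

Section stack.
Context {R : realType}.
Variable n : nat.

(** Coordinates are treated block by block through the projections [usubmx] and [dsubmx],
    without arithmetic on indices. *)
Lemma stackP (Pi : ('cV[R]_(1 + n + 1) -> R) -> Prop) :
  Pi (fun X => usubmx (usubmx X) 0 0) ->
  (forall j : 'I_n, Pi (fun X => dsubmx (usubmx X) j 0)) ->
  Pi (fun X => dsubmx X 0 0) ->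
  forall i, Pi (fun X => X i 0).
Proof.
move=> hu hq hs i; rewrite -(fintype.splitK i); case: (fintype.split i) => [k|k] /=; last first.
  by move: hs; under eq_fun do rewrite mxE; rewrite (ord1 k).
rewrite -(fintype.splitK k); case: (fintype.split k) => [l|l] /=.
  by move: hu; under eq_fun do rewrite !mxE; rewrite (ord1 l).
by move: (hq l); under eq_fun do rewrite !mxE.
Qed.

Lemma stack_entry_u (X : 'cV[R]_(1 + n + 1)) :
  usubmx (usubmx X) 0 0 = X (lshift 1 (lshift n ord0)) 0.
Proof. by rewrite !mxE; congr (X _ _); exact: val_inj. Qed.

Lemma stack_entry_q (X : 'cV[R]_(1 + n + 1)) (j : 'I_n) :
  dsubmx (usubmx X) j 0 = X (lshift 1 (rshift 1 j)) 0.
Proof. by rewrite !mxE. Qed.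

Lemma stack_u u q s : usubmx (usubmx (stack n u q s)) 0 0 = u :> R.
Proof. by rewrite !col_mxKu mxE eqxx mulr1n. Qed.

Lemma stack_q u q s (j : 'I_n) : dsubmx (usubmx (stack n u q s)) j 0 = q j :> R.
Proof. by rewrite col_mxKu col_mxKd mxE. Qed.

Lemma stack_s u q s : dsubmx (stack n u q s) 0 0 = s :> R.
Proof. by rewrite col_mxKd mxE eqxx mulr1n. Qed.

Lemma stackD u q s u' q' s' : stack n u q s + stack n u' q' s' =
  stack n (u + u') (fun j => q j + q' j) (s + s') :> 'cV[R]_(1 + n + 1).
Proof.
rewrite /stack !add_col_mx; congr (col_mx (col_mx _ _) _); last by rewrite raddfD.
  by rewrite raddfD.
by apply/colP => j; rewrite !mxE.
Qed.

Lemma stackN u q s : - stack n u q s =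
  stack n (- u) (fun j => - q j) (- s) :> 'cV[R]_(1 + n + 1).
Proof.
rewrite /stack !opp_col_mx; congr (col_mx (col_mx _ _) _); last by rewrite raddfN.
  by rewrite raddfN.
by apply/colP => j; rewrite !mxE.
Qed.

Lemma stack_is_derive (X : R -> 'cV[R]_(1 + n + 1)) (u : R) (q : nat -> R) (s t : R) :
  is_derive t 1 (fun x => usubmx (usubmx (X x)) 0 0) u ->
  (forall j : 'I_n, is_derive t 1 (fun x => dsubmx (usubmx (X x)) j 0) (q j)) ->
  is_derive t 1 (fun x => dsubmx (X x) 0 0) s ->
  forall i, is_derive t 1 (fun x => X x i 0) (stack n u q s i 0).
Proof.
move=> hu hq hs.
apply: (stackP (Pi := fun f => is_derive t 1 (fun x => f (X x)) (f (stack n u q s)))).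
- by rewrite stack_u.
- by move=> j; rewrite stack_q.
- by rewrite stack_s.
Qed.

Lemma stack_eta (X : 'cV[R]_(1 + n + 1)) (q : nat -> R) :
  (forall j : 'I_n, q j = dsubmx (usubmx X) j 0) ->
  X = stack n (usubmx (usubmx X) 0 0) q (dsubmx X 0 0).
Proof.
move=> hq; rewrite /stack -[LHS]vsubmxK; congr col_mx; last first.
  by rewrite -mx11_scalar.
rewrite -[LHS]vsubmxK; congr col_mx; first by rewrite -mx11_scalar.
by apply/colP => j; rewrite !mxE hq !mxE.
Qed.

End stack.

Section modal_dynamics.
Context {R : realType}.
Variable P : plant R.

(** Serves both the trajectory, with the delayed control as [x], and the equilibrium,
    with [x = 0]. *)
Lemma stack_dynamics u (q : nat -> R) s x (r : R) (d : R -> R) :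
  matA P *m stack (pn P) u q s + x *: matB P + Gamma_e P r d =
  stack (pn P) x
    (fun j => plam P j * q j + acoef P j * u + bcoef P j * x + coeff P d j)
    (alpha P * u + \sum_(j < pn P) peig1 P j 0 * q j + beta_ P * x - r
       - tail_sum P (coeff P d)).
Proof.
rewrite /matA /matB /matA1 /matB1 /matL1 /Gamma_e /stack.
rewrite !mul_block_col !mul0mx !addr0 mul_row_col !scale_col_mx !add_col_mx.
congr (col_mx (col_mx _ _) _).
- by apply/matrixP => i j; rewrite !ord1 !mxE/= !mulr1n mulr1 add0r addr0.
- apply/colP => j; rewrite !mxE big_ord1 !mxE eqxx mulr1n; congr (_ + _ + _).
    rewrite addrC; congr (_ + _).
    rewrite (bigD1 j)//= !mxE eqxx mulr1n big1 ?addr0// => k kj.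
    by rewrite !mxE eq_sym (negbTE kj) mulr0n mul0r.
  by rewrite mulrC.
have -> : \row_(j < pn P) peig1 P j 0 *m \col_j q j =
    (\sum_(j < pn P) peig1 P j 0 * q j)%:M.
  apply/matrixP => i j; rewrite !ord1 !mxE mulr1n.
  by apply: eq_bigr => k _; rewrite !mxE.
by rewrite -scalar_mxM scale_scalar_mx -!raddfD/= (mulrC x) opprD addrA.
Qed.

End modal_dynamics.

(** * The closed loop *)

Lemma within_continuous_at (R : realType) (f : R -> R) (t : R) :
  {within `[0, +oo[, continuous f} -> 0 < t -> {for t, continuous f}.
Proof.
move=> /subspace_continuousP cf t0.
have t0' : `[0, +oo[%classic t by rewrite /= in_itv/= (ltW t0).
apply: cvg_trans (cf t t0') => A /= hA.
have near0 : \forall s \near t, `[0, +oo[%classic s.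
  by near=> s; rewrite /= in_itv/= andbT; near: s; exact: lt_le_nbhsr.
by move: near0; apply: filter_app; exact: hA.
Unshelve. all: by end_near. Qed.

Lemma L2derivative_continuous (R : realType) (L : R) (f : R -> R -> R) (t : R)
    (g : R -> R) :
  (forall s, 0 <= s -> in_L2 L (f s)) -> in_L2 L g -> 0 <= t ->
  L2derivative_at L f t g -> L2continuous_at L f t.
Proof.
move=> f2 g2 t0 fg; apply/cvgrPdist_lt => /= e e0.
have C0 : 0 < L2norm L g + 1 by rewrite ltr_wpDl// L2norm_ge0.
have /cvgrPdist_lt/(_ 1 ltr01) := fg.
rewrite !near_withinE => h.
have h2 : \forall s \near t, `|s - t| < e / (L2norm L g + 1).
  by near=> s; rewrite distrC; near: s; apply: cvgr_dist_lt; [exact: cvg_id|exact: divr_gt0].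
move: h h2; apply: filterS2 => s h st s0.
rewrite sub0r normrN ger0_norm ?L2norm_ge0//.
have [->|nst] := eqVneq s t.
  rewrite (_ : (fun x => _) = 0 *: f t); last by apply/funext => x; rewrite subrr scale0r.
  by rewrite L2normZ ?normr0 ?mul0r//; exact: f2.
have fst2 := in_L2B (f2 _ s0) (f2 _ t0).
have sl2 := in_L2Z (s - t)^-1 fst2.
have {}h := h nst s0; rewrite sub0r normrN ger0_norm ?L2norm_ge0// in h.
rewrite (_ : (fun x => _) = (s - t) *: ((s - t)^-1 *: (f s - f t))); last first.
  by rewrite scalerA divff ?scale1r// subr_eq0.
rewrite L2normZ//.
have : L2norm L ((s - t)^-1 *: (f s - f t)) < L2norm L g + 1.
  have := L2normD (in_L2B sl2 g2) g2; rewrite subrK => /le_lt_trans; apply.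
  by rewrite addrC ltrD2l.
move=> h3; apply: (@le_lt_trans _ _ (`|s - t| * (L2norm L g + 1))).
  by rewrite ler_wpM2l// ltW.
by rewrite -ltr_pdivlMr.
Unshelve. all: by end_near. Qed.

Lemma Rintegral_sum (R : realType) (A : set R) (I : Type) (s : seq I)
    (f : I -> R -> R) : measurable A ->
  (forall i, (@lebesgue_measure R).-integrable A (EFin \o f i)) ->
  (\int[@lebesgue_measure R]_(x in A) (\sum_(i <- s) f i x))%R =
  \sum_(i <- s) (\int[@lebesgue_measure R]_(x in A) f i x)%R.
Proof.
move=> mA fi.
suff [] : (\int[@lebesgue_measure R]_(x in A) (\sum_(i <- s) f i x))%R =
    \sum_(i <- s) (\int[@lebesgue_measure R]_(x in A) f i x)%R /\
    (@lebesgue_measure R).-integrable A (EFin \o (fun x => \sum_(i <- s) f i x)) by [].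
elim: s => [|i s [ih1 ih2]].
  under eq_fun do rewrite big_nil; rewrite big_nil; split.
    by rewrite Rintegral_cst// mul0r.
  have -> : EFin \o (fun=> 0 : R) = cst 0%E by [].
  exact: integrable0.
under eq_fun do rewrite big_cons; rewrite big_cons -ih1; split.
  by rewrite RintegralD.
have -> : EFin \o (fun x => f i x + \sum_(j <- s) f j x) =
  ((EFin \o f i) \+ (EFin \o (fun x => \sum_(j <- s) f j x)%R))%E by [].
exact: integrableD.
Qed.

Section closed_loop_dynamics.
Context {R : realType}.
Variables (P : plant R) (K : 'rV[R]_(1 + pn P + 1)).
Hypothesis ok : plant_ok P.
Variables (r : R -> R) (d d' : R -> R -> R).
Hypothesis d_C1 : L2C1 (pL P) d d'.
Variables (y0 : R -> R) (z0 : R) (T : traj R).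
Hypothesis cl : closed_loop K r d y0 z0 T.

Let L := pL P.
Let D := pD P.
Let L0 : 0 < L := plant_L0 ok.
Let D0 : 0 < D := plant_D0 ok.
Let b : R -> R := fun x => - (x / L).
Let ac : R -> R := fun x => x / L * pc P x.

Let d_L2 t : 0 <= t -> in_L2 L (d t).
Proof. by move=> /d_C1[]. Qed.

Lemma bcoef_in_L2 : in_L2 (pL P) (fun x => - (x / pL P)).
Proof.
have := H1_in_L2 L0 (is_H1_affine L 0 (- L^-1)).
rewrite (_ : (fun x => _) = b)//.
by apply/funext => x; rewrite add0r mulNr mulrC.
Qed.

Lemma acoef_in_L2 : in_L2 (pL P) (fun x => x / pL P * pc P x).
Proof.
rewrite (_ : (fun x => _) = (fun x => pc P x * (- (1 : R) *: b) x)).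
  by apply: in_L2M_Loo (plant_c ok) _; apply: in_L2Z; exact: bcoef_in_L2.
by apply/funext => x; rewrite /b -[(_ *: _) x]/(- 1 * - (x / L)) mulrNN mul1r mulrC.
Qed.

Lemma ty_in_L2 t : 0 <= t -> in_L2 (pL P) (ty T t).
Proof. by move=> t0; have [_ [[/(_ _ t0)[/(H1_in_L2 L0)]]]] := cl. Qed.

Lemma w_decomp t : w P T t = uD P T t *: b + ty T t.
Proof.
apply/funext => x; rewrite -[RHS]/(uD P T t * - (x / L) + ty T t x).
by rewrite mulrN addrC mulrC.
Qed.

Lemma w_in_L2 t : 0 <= t -> in_L2 (pL P) (w P T t).
Proof.
move=> t0; rewrite w_decomp; apply: in_L2D; last exact: ty_in_L2.
by apply: in_L2Z; exact: bcoef_in_L2.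
Qed.

Lemma functional_w (phi : (R -> R) -> R) t : bounded_functional L phi -> 0 <= t ->
  phi (w P T t) = uD P T t * phi b + phi (ty T t).
Proof.
move=> phi_bl t0; rewrite w_decomp phi_bl.1//; [exact: bcoef_in_L2|exact: ty_in_L2].
Qed.

Lemma w_domA t : 0 <= t -> is_domA (pL P) (w P T t) (wx P T t) (wxx T t).
Proof.
move=> t0; have [_ [[/(_ _ t0)[y1 y2] /(_ _ t0)[yy0 yL] _ _ _] _]] := cl.
split; last 2 first.
- by rewrite /w yy0 !mul0r subr0.
- by rewrite /w yL divff ?gt_eqF// mul1r subrr.
have a1 := is_H1_affine L 0 (L^-1 * uD P T t).
have a2 := is_H1_affine L (L^-1 * uD P T t) 0.
split.
  have := is_H1B y1 a1; congr is_H1; apply/funext => x.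
  by rewrite -[LHS]/(ty T t x - (0 + L^-1 * uD P T t * x)) add0r /w -/L; ring.
have := is_H1B y2 a2; congr is_H1; apply/funext => x.
  by rewrite -[LHS]/(tyx T t x - (L^-1 * uD P T t + 0 * x)) mul0r addr0.
by rewrite -[LHS]/(tyxx T t x - 0) subr0.
Qed.

Lemma tv_lt0 t : t < 0 -> tv T t = 0.
Proof. by have [[_ h _] _] := cl; exact: h. Qed.

Lemma tv_locally_integrable : locally_integrable_ge0 (tv T).
Proof. by have [[h _ _] _] := cl. Qed.

Lemma tv_feedback t : 0 <= t -> tv T t = (K *m Zstate P T t) 0 0.
Proof. by have [[_ _ h] _] := cl; exact: h. Qed.

Lemma uDE t : uD P T t = running_integral (tv T) (t - D).
Proof.
rewrite /uD /uinput; case: ltP => // h.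
by rewrite running_integral_lt0.
Qed.

Lemma uD_continuous (A : set R) : {within A, continuous (uD P T)}.
Proof.
apply: continuous_within; rewrite (_ : uD P T = running_integral (tv T) \o (fun t => t - D)).
  move=> t; apply: continuous_comp; last exact: running_integral_continuous tv_locally_integrable _.
  by apply: continuousB; [exact: cvg_id|exact: cst_continuous].
by apply/funext => t; exact: uDE.
Qed.

Lemma w_functional_continuous (phi : (R -> R) -> R) : bounded_functional L phi ->
  {within `[0, +oo[, continuous (fun t => phi (w P T t))}.
Proof.
move=> phi_bl.
have h : {within `[0, +oo[, continuous (fun t => uD P T t * phi b + phi (ty T t))}.
  apply: within_continuousDr.
    by apply: within_continuousM; [exact: uD_continuous|exact: within_continuous_cst].
  apply: functional_continuous phi_bl ty_in_L2 _.
  by have [_ [[_ _ h _ _] _]] := cl.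
apply: subspace_eq_continuous h => t; rewrite inE/= in_itv/= andbT => t0.
by rewrite /from_subspace functional_w.
Qed.

Lemma Xstate_continuous i : {within `[0, +oo[, continuous (fun t => Xstate P T t i 0)}.
Proof.
move: i; apply: (stackP (Pi := fun f => {within `[0, +oo[, continuous (fun t => f (Xstate P T t))})).
- by rewrite (_ : (fun t => _) = uD P T); [exact: uD_continuous|apply/funext => t; rewrite stack_u].
- move=> j; rewrite (_ : (fun t => _) = (fun t => coeff P (w P T t) j)); last first.
    by apply/funext => t; rewrite stack_q.
  exact: w_functional_continuous (bounded_functional_coeff ok j).
rewrite (_ : (fun t => _) = zeta P T); last by apply/funext => t; rewrite stack_s.
apply: within_continuousBr; first by have [_ [_ []]] := cl.
exact: w_functional_continuous (bounded_functional_tail_sum ok).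
Qed.

(** * The predictor term *)

Let E (t : R) := expm (t *: matA P).
Let h k (s : R) : R := (E (- s) *m matB P) k 0.
Let H k := running_integral (fun s => h k s * tv T s).
Let dH t : 'cV[R]_(1 + pn P + 1) := \col_k (H k t - H k (t - D)).

Definition predictor t : 'cV[R]_(1 + pn P + 1) :=
  \col_i (\int[@lebesgue_measure R]_(s in `[(t - pD P)%R, t])
    ((expm ((t - pD P - s) *: matA P) *m matB P) i 0 * tv T s))%R.

Let h_continuous k : continuous (h k).
Proof.
move=> s; rewrite /h; under eq_fun do rewrite mxE.
apply: (cvg_sumr (f := fun l x => E (- x) k l * matB P l 0)) => l.
apply: cvgM; last exact: cvg_cst.
apply: (@continuous_comp _ _ _ (fun x : R => - x) (fun x => E x k l)).
  exact: oppr_continuous.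
exact: expm_continuous.
Qed.

Let hv_int k : locally_integrable_ge0 (fun s => h k s * tv T s).
Proof.
apply: (@locally_integrable_mul R (tv T) (h k)); first exact: h_continuous.
exact: tv_locally_integrable.
Qed.

Let hv_lt0 k s : s < 0 -> h k s * tv T s = 0.
Proof. by move=> /tv_lt0 ->; rewrite mulr0. Qed.

Lemma predictor_split t i s :
  (expm ((t - pD P - s) *: matA P) *m matB P) i 0 =
  \sum_k E (t - D) i k * h k s.
Proof. by rewrite -expmD -mulmxA mxE. Qed.

(** Factoring [E (t - D)] out of the integral leaves running integrals of functions that
    do not depend on [t], whose derivatives are given by the fundamental theorem. *)
Lemma predictorE t : 0 <= t -> predictor t = E (t - D) *m dH t.
Proof.
move=> t0; apply/colP => i; rewrite !mxE.
have -> : (\int[@lebesgue_measure R]_(s in `[(t - pD P)%R, t])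
    ((expm ((t - pD P - s) *: matA P) *m matB P) i 0 * tv T s))%R =
  (\int[@lebesgue_measure R]_(s in `[(t - pD P)%R, t])
    (\sum_k E (t - D) i k * (h k s * tv T s)))%R.
  apply: eq_Rintegral => s _; rewrite predictor_split mulr_suml.
  by apply: eq_bigr => k _; rewrite mulrA.
have tD : t - D <= t by rewrite gerBl ltW.
have int k : (@lebesgue_measure R).-integrable `[t - D, t] (EFin \o (fun s => h k s * tv T s)).
  by apply: locally_integrable_itv; [exact: hv_int|exact: hv_lt0].
have intZ k : (@lebesgue_measure R).-integrable `[t - D, t]
    (EFin \o (fun s => E (t - D) i k * (h k s * tv T s))).
  rewrite (_ : EFin \o _ = (fun s => (E (t - D) i k)%:E * (EFin \o (fun s => h k s * tv T s)%R) s)%E)//.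
  exact: integrableZl.
rewrite Rintegral_sum//; apply: eq_bigr => k _.
rewrite RintegralZl//; congr (_ * _); rewrite [RHS]mxE.
by apply: running_integralB; [exact: hv_int|exact: hv_lt0|..].
Qed.

Lemma ZstateE t : Zstate P T t = Xstate P T t + predictor t.
Proof. by []. Qed.

Let E_continuous (A : set R) i k : {within A, continuous (fun t => E (t - D) i k)}.
Proof.
apply: continuous_within => t.
apply: (@continuous_comp _ _ _ (fun x : R => x - D) (fun x => E x i k)).
  by apply: continuousB; [exact: cvg_id|exact: cst_continuous].
exact: expm_continuous.
Qed.

Let H_continuous k : continuous (H k).
Proof. by apply: running_integral_continuous; exact: hv_int. Qed.

Let dH_continuous (A : set R) k : {within A, continuous (fun t => dH t k 0)}.
Proof.
rewrite (_ : (fun t => _) = (fun t => H k t - H k (t - D))); last first.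
  by apply/funext => t; rewrite mxE.
apply: continuous_within => t; apply: continuousB; first exact: H_continuous.
apply: (@continuous_comp _ _ _ (fun x : R => x - D) (H k)).
  by apply: continuousB; [exact: cvg_id|exact: cst_continuous].
exact: H_continuous.
Qed.

Lemma Zstate_continuous i : {within `[0, +oo[, continuous (fun t => Zstate P T t i 0)}.
Proof.
have c : {within `[0, +oo[, continuous (fun t => Xstate P T t i 0 +
    \sum_k E (t - D) i k * dH t k 0)}.
  apply: within_continuousDr; first exact: Xstate_continuous.
  apply: within_continuous_sum => k _; apply: within_continuousM.
    exact: E_continuous.
  exact: dH_continuous.
apply: subspace_eq_continuous c => t; rewrite inE/= in_itv/= andbT => t0.
by rewrite /from_subspace ZstateE predictorE// [RHS]mxE; congr (_ + _); rewrite [RHS]mxE.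
Qed.

Lemma feedback_continuous : {within `[0, +oo[, continuous (fun t => (K *m Zstate P T t) 0 0)}.
Proof. exact: row_continuous Zstate_continuous. Qed.

Lemma tv_continuous_at t : 0 < t -> {for t, continuous (tv T)}.
Proof.
move=> t0; have c := within_continuous_at feedback_continuous t0.
rewrite /prop_for /continuous_at (tv_feedback (ltW t0)).
apply: cvg_trans c; apply: near_eq_cvg; near=> s; rewrite tv_feedback//.
by near: s; exact: lt_le_nbhsr.
Unshelve. all: by end_near. Qed.

Let running_is_derive (f : R -> R) t : locally_integrable_ge0 f ->
  (forall s, s < 0 -> f s = 0) -> t != 0 -> (0 < t -> {for t, continuous f}) ->
  is_derive t 1 (running_integral f) (f t).
Proof.
move=> fi f0 + cf; case: (ltgtP t 0) => // [tn|tp] _.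
  by rewrite f0//; exact: running_integral_is_derive_lt0.
exact: running_integral_is_derive (cf tp).
Qed.

Lemma uD_is_derive t : t != D -> is_derive t 1 (uD P T) (tv T (t - D)).
Proof.
move=> tD; rewrite (_ : uD P T = (fun t => running_integral (tv T) (t - D))).
  apply: (@is_derive_translate _ (running_integral (tv T))).
  apply: running_is_derive; [exact: tv_locally_integrable|exact: tv_lt0| |].
    by rewrite subr_eq0.
  exact: tv_continuous_at.
by apply/funext => s; exact: uDE.
Qed.

Let H_is_derive k (t : R) : t != 0 -> is_derive t 1 (H k) (h k t * tv T t).
Proof.
move=> t0; apply: (@running_is_derive (fun s => h k s * tv T s) t) => //.
  exact: hv_lt0.
move=> tp; apply: continuousM; first exact: h_continuous.
exact: tv_continuous_at.
Qed.

Lemma predictor_is_derive t i : 0 < t -> t != D ->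
  is_derive t 1 (fun s => predictor s i 0)
    ((matA P *m predictor t + tv T t *: (expm (- pD P *: matA P) *m matB P)
       - tv T (t - D) *: matB P) i 0).
Proof.
move=> t0 tD.
apply: (is_derive_near (f := fun s => \sum_k E (s - D) i k * dH s k 0)).
  near=> s; rewrite predictorE; first by rewrite mxE.
  by near: s; exact: lt_le_nbhsr.
have key : \sum_k ((matA P *m E (t - D)) i k * dH t k 0 +
    E (t - D) i k * (h k t * tv T t - h k (t - D) * tv T (t - D))) =
    (matA P *m predictor t + tv T t *: (expm (- pD P *: matA P) *m matB P)
       - tv T (t - D) *: matB P) i 0.
  have e1 : E (t - D) *m E (- t) = expm (- pD P *: matA P).
    by rewrite /E expmD addrAC subrr add0r.
  have e2 : E (t - D) *m E (- (t - D)) = 1%:M by rewrite /E expmD subrr expm0.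
  have e3 : matB P = E (t - D) *m (E (- (t - D)) *m matB P).
    by rewrite mulmxA e2 mul1mx.
  have X1 : (matA P *m predictor t) i 0 =
      \sum_k (matA P *m E (t - D)) i k * dH t k 0.
    by rewrite predictorE ?(ltW t0)// mulmxA mxE.
  have X2 : (expm (- pD P *: matA P) *m matB P) i 0 = \sum_k E (t - D) i k * h k t.
    by rewrite -e1 -mulmxA mxE.
  have X3 : matB P i 0 = \sum_k E (t - D) i k * h k (t - D).
    by rewrite {1}e3 mxE.
  have addE (x y : 'cV[R]_(1 + pn P + 1)) : (x + y) i 0 = x i 0 + y i 0 by rewrite mxE.
  have oppE (x : 'cV[R]_(1 + pn P + 1)) : (- x) i 0 = - x i 0 by rewrite mxE.
  have scaleE a (x : 'cV[R]_(1 + pn P + 1)) : (a *: x) i 0 = a * x i 0 by rewrite mxE.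
  rewrite !addE oppE !scaleE X1 X2 X3 !mulr_sumr -sumrN -!big_split/=.
  have alg (x1 x2 x3 x4 x5 x6 x7 : R) :
      x1 * x2 + x3 * (x4 * x5 - x6 * x7) = x1 * x2 + x5 * (x3 * x4) - x7 * (x3 * x6).
    by ring.
  by apply: eq_bigr => k _; exact: alg.
rewrite -key; apply: is_derive_sumr => k _; apply: is_deriveMr.
  exact: (is_derive_translate (expm_is_derive _ _ _ _)).
rewrite (_ : (fun s => dH s k 0) = (fun s => H k s - H k (s - D))); last first.
  by apply/funext => s; rewrite mxE.
apply: is_deriveBr; first by apply: H_is_derive; rewrite gt_eqF.
apply: (@is_derive_translate _ (H k)); apply: H_is_derive.
by rewrite subr_eq0.
Unshelve. all: by end_near. Qed.

(** * Modal equations *)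

Let yt t := fun x => tyxx T t x + pc P x * ty T t x + d t x.

Let yt_decomp t : yt t = opA (pc P) (w P T t) (wxx T t) + (uD P T t *: ac + d t).
Proof.
apply/funext => x.
rewrite -[RHS]/(tyxx T t x + pc P x * (ty T t x - x / L * uD P T t) +
  (uD P T t * (x / L * pc P x) + d t x)) /yt; ring.
Qed.

Let Aw_L2 t : 0 <= t -> in_L2 L (opA (pc P) (w P T t) (wxx T t)).
Proof. by move=> t0; exact: (opA_in_L2 ok (w_domA t0)). Qed.

Let functional_yt (phi : (R -> R) -> R) t : bounded_functional L phi -> 0 <= t ->
  phi (yt t) = phi (opA (pc P) (w P T t) (wxx T t)) + (uD P T t * phi ac + phi (d t)).
Proof.
move=> phi_bl t0; have ac2 := acoef_in_L2; have d2 := d_L2 t0.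
by rewrite yt_decomp (functionalD phi_bl) ?phi_bl.1//; [exact: Aw_L2|exact: (in_L2D (in_L2Z _ ac2) d2)].
Qed.

Let yt_L2 t : 0 <= t -> in_L2 L (yt t).
Proof.
move=> t0; rewrite yt_decomp; apply: in_L2D; first exact: Aw_L2.
by apply: in_L2D (in_L2Z _ acoef_in_L2) (d_L2 t0).
Qed.

(** The lifting [x / L * uD] moves the boundary input into the equation, as source terms
    proportional to the delayed input and to its derivative. *)
Lemma functional_w_is_derive (phi : (R -> R) -> R) t : bounded_functional L phi ->
  0 < t -> t != pD P ->
  is_derive t 1 (fun s => phi (w P T s))
    (phi (opA (pc P) (w P T t) (wxx T t)) + uD P T t * phi (fun x => x / pL P * pc P x)
      + phi (d t) + tv T (t - pD P) * phi (fun x => - (x / pL P))).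
Proof.
move=> phi_bl t0 tD.
apply: (is_derive_near (f := fun s => uD P T s * phi b + phi (ty T s))).
  near=> s; rewrite functional_w//.
  by near: s; exact: lt_le_nbhsr.
have [_ [[_ _ _ /(_ t t0 tD) yd _] _]] := cl.
have dy := functional_is_derive phi_bl t0 ty_in_L2 (yt_L2 (ltW t0)) yd.
have := is_deriveDr (is_deriveMr (uD_is_derive tD) (is_derive_cst (phi b) t 1)) dy.
rewrite mulr0 addr0 functional_yt ?(ltW t0)// addrC -!addrA.
by [].
Unshelve. all: by end_near. Qed.

Lemma wcoef_is_derive j t : 0 < t -> t != pD P ->
  is_derive t 1 (fun s => coeff P (w P T s) j)
    (plam P j * coeff P (w P T t) j + acoef P j * uD P T t + coeff P (d t) j
      + bcoef P j * tv T (t - pD P)).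
Proof.
move=> t0 tD; have := functional_w_is_derive (bounded_functional_coeff ok j) t0 tD.
rewrite (coeff_opA ok j (w_domA (ltW t0))) (mulrC (uD P T t)) (mulrC (tv T _)).
by [].
Qed.

(** The tail sum subtracted from [tz T] is what it takes to cancel, in the derivative, the
    contribution of the high modes to the slope at 0. *)
Lemma zeta_is_derive t : 0 < t -> t != pD P ->
  is_derive t 1 (zeta P T)
    (alpha P * uD P T t + \sum_(j < pn P) peig1 P j 0 * coeff P (w P T t) j
      + beta_ P * tv T (t - pD P) - r t - tail_sum P (coeff P (d t))).
Proof.
move=> t0 tD.
have dt := functional_w_is_derive (bounded_functional_tail_sum ok) t0 tD.
have dz : is_derive t 1 (tz T) (tyx T t 0 - r t).
  by have [_ [_ [_ hz _]]] := cl; exact: hz.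
have := is_deriveBr dz dt.
have := left_slope_modal ok (w_domA (ltW t0)).
rewrite /wx => /eqP; rewrite subr_eq => /eqP ->.
set S := \sum_(_ < _) _; set tA := tail_sum P (coeff P (opA _ _ _)).
have -> : S + tA + (pL P)^-1 * uD P T t - r t -
   (tA + uD P T t * tail_sum P (coeff P (fun x => x / pL P * pc P x)) +
    tail_sum P (coeff P (d t)) +
    tv T (t - pD P) * tail_sum P (coeff P (fun x => - (x / pL P)))) =
  alpha P * uD P T t + S + beta_ P * tv T (t - pD P) - r t - tail_sum P (coeff P (d t)).
  by rewrite /alpha /beta_ /acoef /bcoef; ring.
by [].
Qed.

Lemma Xstate_is_derive t i : 0 < t -> t != pD P ->
  is_derive t 1 (fun s => Xstate P T s i 0)
    ((matA P *m Xstate P T t + tv T (t - pD P) *: matB P + Gamma_e P (r t) (d t)) i 0).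
Proof.
move=> t0 tD; rewrite {2}/Xstate stack_dynamics; apply: stack_is_derive.
- rewrite (_ : (fun x => _) = uD P T); first exact: uD_is_derive.
  by apply/funext => s; rewrite stack_u.
- move=> j; rewrite (_ : (fun x => _) = (fun s => coeff P (w P T s) j)).
    by have := wcoef_is_derive j t0 tD; rewrite addrAC.
  by apply/funext => s; rewrite stack_q.
rewrite (_ : (fun x => _) = zeta P T); first exact: zeta_is_derive.
by apply/funext => s; rewrite stack_s.
Qed.

(** Differentiating the predictor term replaces the delayed control in the equation of
    [Xstate] by the present one, for which the feedback law can be inserted. *)
Lemma Zstate_is_derive t i : 0 < t -> t != pD P ->
  is_derive t 1 (fun s => Zstate P T s i 0)
    ((matAK K *m Zstate P T t + Gamma_e P (r t) (d t)) i 0).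
Proof.
move=> t0 tD.
have := is_deriveDr (Xstate_is_derive i t0 tD) (predictor_is_derive i t0 tD).
set dX := (_ : 'cV_(_)) i 0; set dF := (_ : 'cV_(_)) i 0.
have -> : dX + dF = (matAK K *m Zstate P T t + Gamma_e P (r t) (d t)) i 0.
  rewrite /dX /dF /matAK ZstateE.
  have -> : (matA P + expm (- pD P *: matA P) *m matB P *m K) *m
      (Xstate P T t + predictor t) =
    matA P *m Xstate P T t + matA P *m predictor t +
    tv T t *: (expm (- pD P *: matA P) *m matB P).
    rewrite mulmxDl mulmxDr; congr (_ + _).
    rewrite -mulmxA [K *m _]mx11_scalar mul_mx_scalar.
    by rewrite -ZstateE -tv_feedback ?(ltW t0).
  have addE (x y : 'cV[R]_(1 + pn P + 1)) : (x + y) i 0 = x i 0 + y i 0 by rewrite mxE.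
  have oppE (x : 'cV[R]_(1 + pn P + 1)) : (- x) i 0 = - x i 0 by rewrite mxE.
  rewrite !addE oppE.
  have alg (x1 x2 x3 x4 x5 : R) : x1 + x2 + x3 + (x4 + x5 - x2) = x1 + x4 + x5 + x3.
    by ring.
  exact: alg.
rewrite (_ : (fun x => _) = (fun s => Zstate P T s i 0))//.
by apply/funext => s; rewrite [RHS]mxE.
Qed.

End closed_loop_dynamics.

(** * The equilibrium *)

Section equilibrium.
Context {R : realType}.
Variables (P : plant R) (K : 'rV[R]_(1 + pn P + 1)).
Hypothesis ok : plant_ok P.
Hypothesis HK : Hurwitz (matAK K).
Variables (re : R) (de we we1 we2 : R -> R).
Hypothesis de_L2 : in_L2 (pL P) de.
Hypothesis is_we : is_w_e K re de we we1 we2.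

Lemma Hurwitz_unit (n : nat) (M : 'M[R]_n) : Hurwitz M -> M \in unitmx.
Proof.
move=> HM; apply: contraT => nM.
suff /HM : eigenvalue (map_mx (real_complex R) M) 0 by rewrite ltxx.
by rewrite /eigenvalue /eigenspace raddf0 subr0 kermx_eq0 row_free_unit map_unitmx.
Qed.

Lemma X_e_equation : matAK K *m X_e K re de = - Gamma_e P re de.
Proof. by rewrite /X_e mulmxN mulKVmx// Hurwitz_unit. Qed.

Lemma matA_first_row (X : 'cV[R]_(1 + pn P + 1)) : usubmx (usubmx (matA P *m X)) = 0.
Proof.
rewrite -[X]vsubmxK /matA mul_block_col mul0mx addr0 col_mxKu.
by rewrite -[usubmx X]vsubmxK /matA1 mul_block_col !mul0mx addr0 col_mxKu.
Qed.

Let i0 : 'I_(1 + pn P + 1) := lshift 1 (lshift (pn P) ord0).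

Let topE (X : 'cV[R]_(1 + pn P + 1)) : usubmx (usubmx X) 0 0 = X i0 0.
Proof. exact: stack_entry_u. Qed.

(** The first component of the model is driven by the control alone, so the
    first row of the exponential is constant. *)
Lemma expm_matA_first_row t (X : 'cV[R]_(1 + pn P + 1)) :
  usubmx (usubmx (expm (t *: matA P) *m X)) 0 0 = usubmx (usubmx X) 0 0.
Proof.
have rowE s j : expm (s *: matA P) i0 j = (i0 == j)%:R.
  have d0 (x : R) : is_derive x 1 (fun x => expm (x *: matA P) i0 j) 0.
    have -> : 0 = (matA P *m expm (x *: matA P)) i0 j.
      transitivity ((matA P *m col j (expm (x *: matA P))) i0 0).
        by rewrite -topE matA_first_row mxE.
      by rewrite [LHS]mxE [RHS]mxE; apply: eq_bigr => k _; rewrite [col _ _ _ _]mxE.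
    exact: expm_is_derive.
  rewrite (@is_derive_0_is_cst _ (fun x => expm (x *: matA P) i0 j) s 0 d0).
  by rewrite expm0 mxE.
rewrite !topE mxE (bigD1 i0)//= rowE eqxx mul1r big1 ?addr0// => j ji.
by rewrite rowE eq_sym (negbTE ji) mul0r.
Qed.

(** The control is at rest at the equilibrium: in the first row of [X_e_equation] the
    row of [matA P] vanishes, the entry of [expm (- D *: A) *m B] is 1, and the
    right-hand side is 0. *)
Lemma K_X_e : (K *m X_e K re de) 0 0 = 0.
Proof.
have := congr1 (fun X : 'cV[R]_(1 + pn P + 1) => usubmx (usubmx X) 0 0) X_e_equation.
rewrite /matAK mulmxDl -!mulmxA [K *m _]mx11_scalar.
set k := (K *m _) 0 0.
rewrite !mul_mx_scalar -scalemxAr.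
rewrite [in X in X -> _]raddfD/= [in X in X -> _]raddfD/= mxE matA_first_row mxE add0r.
rewrite /Gamma_e stackN stack_u oppr0.
rewrite !linearZ/= mxE expm_matA_first_row.
rewrite /matB /matB1 !col_mxKu mxE mulr1n mulr1.
by move=> k0; rewrite mxE mulr1n.
Qed.

Lemma X_e_steady : matA P *m X_e K re de + Gamma_e P re de = 0.
Proof.
have := X_e_equation.
rewrite /matAK mulmxDl -!mulmxA [K *m _]mx11_scalar K_X_e.
rewrite (_ : 0%:M = 0); last by apply/matrixP => i j; rewrite !mxE mul0rn.
by rewrite !mulmx0 addr0 => ->; rewrite addNr.
Qed.

Lemma X_e_stack : X_e K re de =
  stack (pn P) (u_e K re de) (wcoef_e K re de) (zeta_e K re de).
Proof. by apply: stack_eta => j; rewrite /wcoef_e valK. Qed.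

Let steady := stack_dynamics P (u_e K re de) (wcoef_e K re de) (zeta_e K re de) 0 re de.

Lemma wcoef_e_steady j :
  plam P j * wcoef_e K re de j + acoef P j * u_e K re de + coeff P de j = 0.
Proof.
have [jn|nj] := ltnP j (pn P).
  have := steady; rewrite scale0r addr0 -X_e_stack X_e_steady.
  move=> /(congr1 (fun X : 'cV[R]_(1 + pn P + 1) => dsubmx (usubmx X) (Ordinal jn) 0)).
  by rewrite stack_q !mxE mulr0 addr0.
rewrite /wcoef_e insubF; last by rewrite ltnNge nj.
have lj : plam P j < 0 by apply: le_lt_trans (plam_n_lt0 ok); exact: plam_neg.
by field; rewrite lt_eqF.
Qed.

Lemma coeff_we j : coeff P we j = wcoef_e K re de j.
Proof.
have [weA wecvg] := is_we.
have [[we_H1 _] _ _] := weA; have we_L2 := H1_in_L2 (plant_L0 ok) we_H1.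
have h : coeff P (fun x => \sum_(i < N) wcoef_e K re de i * peig P i x) j @[N --> \oo]
    --> coeff P we j.
  apply: (functional_cvg (bounded_functional_coeff ok j)) => //.
  by near=> N; apply: in_L2_sum; exact: peig_in_L2.
apply: (cvg_unique _ h) => //.
apply: (@cvg_trans _ (wcoef_e K re de j @[N --> \oo])); last exact: cvg_cst.
apply: near_eq_cvg; near=> N; rewrite (coeff_sum ok) ifT//.
by near: N; exact: nbhs_infty_gt.
Unshelve. all: by end_near. Qed.

(** The last row of the steady state equation: this is the effect of the integral action
    on [z]. *)
Lemma equilibrium_slope : re = we1 0 + (pL P)^-1 * u_e K re de.
Proof.
have [weA _] := is_we.
have := steady; rewrite scale0r addr0 -X_e_stack X_e_steady.
move=> /(congr1 (fun X : 'cV[R]_(1 + pn P + 1) => dsubmx X 0 0)).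
rewrite stack_s !mxE mulr0 addr0 => E.
have -> := left_slope_modal ok weA.
have ts : tail_sum P (coeff P (opA (pc P) we we2)) =
    - (u_e K re de) * tail_sum P (acoef P) - tail_sum P (coeff P de).
  have h := tail_sum_cvg ok (opA_in_L2 ok weA).
  apply: (cvg_unique _ h) => //.
  have h2 : - (u_e K re de) * (\sum_(pn P <= j < N) slope_weight P j * acoef P j) -
      \sum_(pn P <= j < N) slope_weight P j * coeff P de j @[N --> \oo] -->
      - (u_e K re de) * tail_sum P (acoef P) - tail_sum P (coeff P de).
    apply: cvgB; last exact: tail_sum_cvg.
    by apply: cvgM; [exact: cvg_cst|exact: (tail_sum_cvg ok (acoef_in_L2 ok))].
  apply: cvg_trans h2; apply: near_eq_cvg; near=> N.
  rewrite mulr_sumr -sumrB; apply: eq_bigr => j _.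
  rewrite (coeff_opA ok j weA) coeff_we.
  have /eqP := wcoef_e_steady j; rewrite -addrA addr_eq0 => /eqP ->; ring.
rewrite ts; under eq_bigr do rewrite coeff_we.
have {}E : re = alpha P * u_e K re de +
   \sum_(j < pn P) peig1 P j 0 * wcoef_e K re de j - tail_sum P (coeff P de).
  apply/eqP; rewrite eq_sym -subr_eq0 addrAC; apply/eqP; exact: esym E.
by rewrite [LHS]E /alpha; ring.
Unshelve. all: by end_near. Qed.

End equilibrium.

(** * Decay of the deviations *)

Lemma vanishing_sqr (R : realType) (rho : R -> R) : vanishing rho ->
  vanishing (fun t => rho t ^+ 2).
Proof.
move=> [m p c]; split=> [s t s0 st|t t0|]; last 2 first.
- exact: sqr_ge0.
- have : rho t * rho t @[t --> +oo] --> (0 * 0 : R) by exact: cvgM.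
  by rewrite mulr0; under eq_fun do rewrite -expr2.
by rewrite lerXn2r ?nnegrE ?p ?m// (le_trans s0).
Qed.

Lemma within_continuous_translate (R : realType) (f : R -> R) (a : R) :
  {within `[0, +oo[, continuous f} ->
  {within `[a, +oo[, continuous (fun t => f (t - a))}.
Proof.
move=> /subspace_continuousP cf; apply/subspace_continuousP => t.
rewrite /= in_itv/= andbT => at_.
have ta0 : `[0, +oo[%classic (t - a) by rewrite /= in_itv/= andbT subr_ge0.
apply: cvg_comp (cf _ ta0).
have h : (fun x : R => x - a) x @[x --> t] --> t - a.
  by apply: cvgB; [exact: cvg_id|exact: cvg_cst].
move=> A hA.
have hA' : nbhs (t - a) (fun x => `[0, +oo[%classic x -> A x) := hA.
have : \forall x \near t, `[0, +oo[%classic (x - a) -> A (x - a) := h _ hA'.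
apply: filterS => x /= Ax.
by rewrite in_itv/= andbT => ax; apply: Ax; rewrite in_itv/= andbT subr_ge0.
Qed.

Lemma subr_mxE (R : realType) (m n : nat) (A B : 'M[R]_(m, n)) i j :
  (A - B) i j = A i j - B i j.
Proof. by rewrite !mxE. Qed.

Lemma row_functional_sum (R : realType) (n : nat) (q : 'rV[R]_n) :
  exists2 c : R, 0 <= c &
  forall G : 'cV[R]_n, ((q *m G) 0 0) ^+ 2 <= c * \sum_i (G i 0) ^+ 2.
Proof.
have [c c0 hc] := row_functional_bound q; exists c => // G; apply: hc => i.
by rewrite (bigD1 i)//= lerDl sumr_ge0// => j _; exact: sqr_ge0.
Qed.

Section decay.
Context {R : realType}.
Variables (P : plant R) (K : 'rV[R]_(1 + pn P + 1)).
Hypothesis ok : plant_ok P.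
Hypothesis HK : Hurwitz (matAK K).

Let L := pL P.
Let D := pD P.
Let n := pn P.
Let D0 : 0 < D := plant_D0 ok.

(** All that the remainder is allowed to depend on, as opposed to the trajectory. *)
Record data := Data {
  dre : R; dde : R -> R; dwe : R -> R; dwe1 : R -> R; dwe2 : R -> R;
  dr : R -> R; dd : R -> R -> R; dd' : R -> R -> R }.

Definition data_ok (q : data) :=
  [/\ in_L2 (pL P) (dde q), is_w_e K (dre q) (dde q) (dwe q) (dwe1 q) (dwe2 q),
      {within `[0, +oo[, continuous (dr q)} & L2C1 (pL P) (dd q) (dd' q)] /\
  [/\ dr q t @[t --> +oo] --> dre q, L2cvg (pL P) +oo (dd q) (dde q)
    & L2cvg (pL P) +oo (dd' q) (fun=> 0)].

Definition solution (q : data) (T : traj R) :=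
  exists y0 z0, closed_loop K (dr q) (dd q) y0 z0 T.

Definition dev0 (q : data) (T : traj R) :=
  initial_deviation K (dre q) (dde q) (dwe q) (dwe1 q) (dwe2 q) T.

Variable k : R.
Hypothesis k0 : 0 < k.
Hypothesis k_lam : plam P (pn P) <= - (2 * k).

(** The constant comes before the data and the remainder before the trajectory, as in
    the theorem.  The index [N] is there for partial sums over the modes, which must be
    bounded uniformly in their length. *)
Definition decays (g : nat -> data -> traj R -> R -> R) :=
  exists2 C, 0 <= C & forall q, data_ok q ->
  exists2 rho, vanishing rho & forall N T, solution q T ->
    forall t, 0 <= t -> g N q T t <= C * dev0 q T ^+ 2 * expR (- k * t) + rho t.

Implicit Types (g : nat -> data -> traj R -> R -> R) (q : data) (T : traj R).

Lemma decaysD g1 g2 : decays g1 -> decays g2 ->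
  decays (fun N q T t => g1 N q T t + g2 N q T t).
Proof.
move=> [C1 C10 h1] [C2 C20 h2]; exists (C1 + C2); first exact: addr_ge0.
move=> q qok; have [rho1 v1 {}h1] := h1 q qok; have [rho2 v2 {}h2] := h2 q qok.
exists (fun t => rho1 t + rho2 t); first exact: vanishingD.
move=> N T sol t t0; have := lerD (h1 N T sol t t0) (h2 N T sol t t0).
by move=> /le_trans; apply; rewrite le_eqVlt; apply/orP; left; apply/eqP; ring.
Qed.

Lemma decaysZ a g : 0 <= a -> decays g -> decays (fun N q T t => a * g N q T t).
Proof.
move=> a0 [C C0 h]; exists (a * C); first exact: mulr_ge0.
move=> q qok; have [rho v {}h] := h q qok.
exists (fun t => a * rho t); first exact: vanishingZ.
move=> N T sol t t0.
have -> : a * C * dev0 q T ^+ 2 * expR (- k * t) + a * rho t =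
  a * (C * dev0 q T ^+ 2 * expR (- k * t) + rho t) by ring.
by rewrite ler_wpM2l// h.
Qed.

Lemma decays_le g g' : (forall N q T t, data_ok q -> solution q T -> 0 <= t ->
  g N q T t <= g' N q T t) -> decays g' -> decays g.
Proof.
move=> gg' [C C0 h]; exists C => // q qok; have [rho v {}h] := h q qok.
exists rho => // N T sol t t0; apply: le_trans (h N T sol t t0).
exact: gg'.
Qed.

Lemma decays_data (f : data -> R -> R) :
  (forall q, data_ok q -> exists2 rho, vanishing rho & forall t, 0 <= t -> f q t <= rho t) ->
  decays (fun _ q _ t => f q t).
Proof.
move=> h; exists 0 => // q /h[rho v hr]; exists rho => // N T sol t t0.
by rewrite !mul0r add0r hr.
Qed.

(** Looking back over a window of length [D] costs a factor [exp (k D)] and delays the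
    remainder, which still vanishes. *)
Lemma decays_window g g' a : 0 <= a -> decays g ->
  (forall N q T t B, data_ok q -> solution q T -> 0 <= t -> 0 <= B ->
    (forall s, 0 <= s -> t - D <= s <= t -> g N q T s <= B) -> g' N q T t <= a * B) ->
  decays g'.
Proof.
move=> a0 [C C0 h] gg'; exists (a * (expR (k * D) * C)).
  by rewrite !mulr_ge0 ?expR_ge0.
move=> q qok; have [rho v {}h] := h q qok; have [rm rp _] := v.
exists (fun t => a * rho (Num.max 0 (t - D))).
  by apply: vanishingZ => //; exact: vanishing_delay.
move=> N T sol t t0.
have -> : a * (expR (k * D) * C) * dev0 q T ^+ 2 * expR (- k * t) +
  a * rho (Num.max 0 (t - D)) =
  a * (C * dev0 q T ^+ 2 * expR (- k * (t - D)) + rho (Num.max 0 (t - D))).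
  have -> : expR (- k * (t - D)) = expR (- k * t) * expR (k * D).
    by rewrite -expRD; congr expR; ring.
  by ring.
have m0 : 0 <= Num.max 0 (t - D) by rewrite le_max lexx.
apply: gg' => //.
  apply: addr_ge0; last exact: rp.
  by rewrite mulr_ge0 ?expR_ge0// mulr_ge0 ?sqr_ge0.
move=> s s0 /andP[ts st]; apply: le_trans (h N T sol s s0) _; apply: lerD.
  apply: ler_wpM2l; first by rewrite mulr_ge0 ?sqr_ge0.
  by rewrite ler_expR !mulNr lerN2 ler_pM2l.
by apply: rm => //; rewrite ge_max s0.
Qed.

Lemma decays_delay g : (forall N q T t, 0 <= g N q T t) -> decays g ->
  decays (fun N q T t => if t < D then 0 else g N q T (t - D)).
Proof.
move=> g0 dg; apply: (decays_window ler01 dg) => N q T t B qok sol t0 B0 hB.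
rewrite mul1r; case: ltP => // Dt; apply: hB; first by rewrite subr_ge0.
by rewrite lexx gerBl ltW.
Qed.

(** * Disturbance and reference *)

Section data_facts.
Variable q : data.
Hypothesis qok : data_ok q.

Lemma dd_in_L2 t : 0 <= t -> in_L2 (pL P) (dd q t).
Proof. by case: qok => -[_ _ _ h] _ /h[]. Qed.

Lemma dd'_in_L2 t : 0 <= t -> in_L2 (pL P) (dd' q t).
Proof. by case: qok => -[_ _ _ h] _ /h[]. Qed.

Lemma dd_L2continuous t : 0 <= t -> L2continuous_at (pL P) (dd q) t.
Proof.
move=> t0; have [[_ _ _ h] _] := qok; have [d1 d2 d3 _] := h t t0.
exact: L2derivative_continuous dd_in_L2 d2 t0 d3.
Qed.

Lemma dr_majorant : exists2 rho, vanishing rho &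
  forall t, 0 <= t -> (dr q t - dre q) ^+ 2 <= rho t.
Proof.
have [[_ _ rc _] [rl _ _]] := qok.
have [||rho v h] := @vanishing_majorant R (fun t => dr q t - dre q).
- by apply: within_continuousBr => //; exact: within_continuous_cst.
- by rewrite -(subrr (dre q)); apply: cvgB => //; exact: cvg_cst.
exists (fun t => rho t ^+ 2); first exact: vanishing_sqr.
move=> t t0; rewrite -real_normK ?num_real// lerXn2r ?nnegrE ?h//.
by have [_ p _] := v; exact: p.
Qed.

Let norm_majorant (f : R -> R -> R) (g : R -> R) :
  (forall t, 0 <= t -> in_L2 L (f t)) -> in_L2 L g ->
  (forall t, 0 <= t -> L2continuous_at L f t) -> L2cvg L +oo f g ->
  exists2 rho, vanishing rho &
    forall t, 0 <= t -> L2norm L (f t - g) ^+ 2 <= rho t.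
Proof.
move=> f2 g2 fc fg; have [||rho v h] := @vanishing_majorant R (fun t => L2norm L (f t - g)).
- exact: L2norm_continuous.
- exact: fg.
exists (fun t => rho t ^+ 2); first exact: vanishing_sqr.
move=> t t0; have := h t t0; rewrite ger0_norm ?L2norm_ge0// => ht.
by rewrite lerXn2r ?nnegrE ?L2norm_ge0// (le_trans _ ht) ?L2norm_ge0.
Qed.

Lemma dd_majorant : exists2 rho, vanishing rho &
  forall t, 0 <= t -> L2norm (pL P) (dd q t - dde q) ^+ 2 <= rho t.
Proof.
have [[de2 _ _ _] [_ dl _]] := qok.
exact: norm_majorant dd_in_L2 de2 dd_L2continuous dl.
Qed.

Lemma dd'_majorant : exists2 rho, vanishing rho &
  forall t, 0 <= t -> L2norm (pL P) (dd' q t) ^+ 2 <= rho t.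
Proof.
have [[_ _ _ h] [_ _ dl]] := qok.
have c t : 0 <= t -> L2continuous_at (pL P) (dd' q) t by move=> /h[].
have [rho v hr] := norm_majorant dd'_in_L2 (in_L2_cst _ 0) c dl.
exists rho => // t t0; have := hr t t0.
by rewrite (_ : dd' q t - _ = dd' q t)//; apply/funext => x; exact: subr0.
Qed.

End data_facts.

Lemma decays_dd : decays (fun _ q _ t => L2norm L (dd q t - dde q) ^+ 2).
Proof. by apply: decays_data => q; exact: dd_majorant. Qed.

Lemma decays_dd' : decays (fun _ q _ t => L2norm L (dd' q t) ^+ 2).
Proof. by apply: decays_data => q; exact: dd'_majorant. Qed.

Let sqrD_le (x y : R) : (x + y) ^+ 2 <= 2 * x ^+ 2 + 2 * y ^+ 2.
Proof.
rewrite -subr_ge0 (_ : _ - _ = (x - y) ^+ 2); first exact: sqr_ge0.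
by ring.
Qed.

Let sqrD3_le (x y z : R) : (x + y + z) ^+ 2 <= 3 * (x ^+ 2 + y ^+ 2 + z ^+ 2).
Proof.
rewrite -subr_ge0 (_ : _ - _ = (x - y) ^+ 2 + (y - z) ^+ 2 + (z - x) ^+ 2).
  by rewrite !addr_ge0 ?sqr_ge0.
by ring.
Qed.

Let sqrD4_le (x y z u : R) :
  (x + y + z + u) ^+ 2 <= 4 * (x ^+ 2 + y ^+ 2 + z ^+ 2 + u ^+ 2).
Proof.
rewrite -subr_ge0 (_ : _ - _ = (x - y) ^+ 2 + (x - z) ^+ 2 + (x - u) ^+ 2 +
  (y - z) ^+ 2 + (y - u) ^+ 2 + (z - u) ^+ 2).
  by rewrite !addr_ge0 ?sqr_ge0.
by ring.
Qed.

Definition dGamma q t := Gamma_e P (dr q t) (dd q t) - Gamma_e P (dre q) (dde q).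

Lemma Gamma_majorant q : data_ok q -> exists2 rho, vanishing rho &
  forall t, 0 <= t -> forall i, (dGamma q t i 0) ^+ 2 <= rho t.
Proof.
move=> qok; have [rr vr hr] := dr_majorant qok; have [rd vd hd] := dd_majorant qok.
have [Kt Kt0 hKt] := tail_sum_bound ok.
have [[de2 _ _ _] _] := qok.
exists (fun t => (1 + 2 * Kt) * rd t + 2 * rr t).
  by apply: vanishingD; apply: vanishingZ => //; rewrite addr_ge0// mulr_ge0.
move=> t t0; have d2 := dd_in_L2 qok t0.
have rd0 : 0 <= rd t by have [_ p _] := vd; exact: p.
have rr0 : 0 <= rr t by have [_ p _] := vr; exact: p.
have Ktrd : 0 <= Kt * rd t by exact: mulr_ge0.
rewrite /dGamma /Gamma_e stackN stackD.
apply: (stackP (Pi := fun f => f (stack _ _ _ _) ^+ 2 <= _)).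
- by rewrite stack_u subrr expr0n/=; lra.
- move=> j; rewrite stack_q -coeffB//.
  apply: (@le_trans _ _ (rd t)); last by lra.
  apply: le_trans (hd t t0); have := Bessel_from ok j j.+1 (in_L2B d2 de2).
  by rewrite big_nat1.
rewrite stack_s -(opprD (dre q)) opprK.
have -> : - dr q t - tail_sum P (coeff P (dd q t)) +
    (dre q + tail_sum P (coeff P (dde q))) =
  - (dr q t - dre q) + - (tail_sum P (coeff P (dd q t)) - tail_sum P (coeff P (dde q))).
  by ring.
rewrite -(functionalB (bounded_functional_tail_sum ok))//.
apply: (le_trans (sqrD_le _ _)); rewrite !sqrrN.
have h1 := hr t t0.
have h2 : tail_sum P (coeff P (dd q t - dde q)) ^+ 2 <= Kt * rd t.
  apply: hKt; first exact: in_L2B.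
  by move=> N; apply: le_trans (hd t t0); apply: Bessel_from => //; exact: in_L2B.
by lra.
Qed.

(** * Initial values *)

Section initial_values.
Variables (q : data) (T : traj R).
Hypothesis qok : data_ok q.
Hypothesis sol : solution q T.

Let ue := u_e K (dre q) (dde q).
Let J := dev0 q T.

Let parts : [/\ `|uD P T 0 - ue| <= J, `|zeta P T 0 - zeta_e K (dre q) (dde q)| <= J,
  L2norm L (wx P T 0 - dwe1 q) <= J,
  L2norm L (opA (pc P) (w P T 0 - dwe q) (wxx T 0 - dwe2 q)) <= J & 0 <= J].
Proof.
rewrite /J /dev0 /initial_deviation -/ue.
have h1 := normr_ge0 (uD P T 0 - ue).
have h2 := normr_ge0 (zeta P T 0 - zeta_e K (dre q) (dde q)).
have h3 := L2norm_ge0 L (wx P T 0 - dwe1 q).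
have h4 := L2norm_ge0 L (opA (pc P) (w P T 0 - dwe q) (wxx T 0 - dwe2 q)).
have e3 : L2norm (pL P) (fun x => wx P T 0 x - dwe1 q x) =
  L2norm L (wx P T 0 - dwe1 q) by [].
have e4 : L2norm (pL P) (opA (pc P) (fun x => w P T 0 x - dwe q x)
    (fun x => wxx T 0 x - dwe2 q x)) =
  L2norm L (opA (pc P) (w P T 0 - dwe q) (wxx T 0 - dwe2 q)) by [].
by rewrite e3 e4; split; lra.
Qed.

Lemma dev0_ge0 : 0 <= dev0 q T. Proof. by have [] := parts. Qed.

Lemma uD0_dev : (uD P T 0 - u_e K (dre q) (dde q)) ^+ 2 <= dev0 q T ^+ 2.
Proof.
have [h _ _ _ J0] := parts.
by rewrite -real_normK ?num_real// lerXn2r ?nnegrE.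
Qed.

Lemma zeta0_dev : (zeta P T 0 - zeta_e K (dre q) (dde q)) ^+ 2 <= dev0 q T ^+ 2.
Proof.
have [_ h _ _ J0] := parts.
by rewrite -real_normK ?num_real// lerXn2r ?nnegrE.
Qed.

Lemma Aw0_dev :
  L2norm (pL P) (opA (pc P) (w P T 0 - dwe q) (wxx T 0 - dwe2 q)) ^+ 2 <= dev0 q T ^+ 2.
Proof.
have [_ _ _ h J0] := parts.
by rewrite lerXn2r ?nnegrE ?L2norm_ge0.
Qed.

Lemma dw_domA t : 0 <= t ->
  is_domA (pL P) (w P T t - dwe q) (wx P T t - dwe1 q) (wxx T t - dwe2 q).
Proof.
move=> t0; have [y0 [z0 cl]] := sol; have [[_ [weA _] _ _] _] := qok.
have [[H1 H2] w0 wL] := w_domA ok cl t0; have [[G1 G2] we0 weL] := weA.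
split; first by split; exact: is_H1B.
- by rewrite -[LHS]/(w P T t 0 - dwe q 0) w0 we0 subrr.
- by rewrite -[LHS]/(w P T t (pL P) - dwe q (pL P)) wL weL subrr.
Qed.

Lemma w0_dev j : (coeff P (w P T 0) j - wcoef_e K (dre q) (dde q) j) ^+ 2 <=
  L2norm (pL P) (fun=> 1) ^+ 4 * dev0 q T ^+ 2.
Proof.
have [[de2 we_ok _ _] _] := qok; have [weA _] := we_ok; have [y0 [z0 cl]] := sol.
have [[H1 _] dw0 _] := dw_domA (lexx 0).
have [[we_H1 _] _ _] := weA; have we2 := H1_in_L2 (plant_L0 ok) we_H1.
rewrite -(coeff_we ok we_ok) -coeffB//; last exact: (w_in_L2 ok cl (lexx 0)).
have dw2 := H1_in_L2 (plant_L0 ok) H1.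
have := Bessel_from ok j j.+1 dw2; rewrite big_nat1 => /le_trans; apply.
have [_ _ h _ J0] := parts.
rewrite -[4%N]/(2 * 2)%N exprM -exprMn lerXn2r ?nnegrE ?mulr_ge0 ?L2norm_ge0 ?sqr_ge0//.
apply: (le_trans (Poincare (plant_L0 ok) H1 dw0)).
by rewrite ler_wpM2l ?sqr_ge0.
Qed.

End initial_values.

(** * Finite-dimensional part *)

Variable Kz : R.
Hypothesis Kz0 : 0 <= Kz.
Hypothesis Kz_decay : forall rho, vanishing rho ->
  exists2 rho', vanishing rho' & forall e J G Z, linear_system (matAK K) e G Z ->
    (forall t, 0 <= t -> forall i, (G t i 0) ^+ 2 <= rho t) ->
    (forall i, (Z 0 i 0) ^+ 2 <= J) -> 0 <= J ->
    forall t, 0 <= t -> forall i,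
      (Z t i 0) ^+ 2 <= Kz * J * expR (- k * t) + rho' t.

Definition dZ q T t := Zstate P T t - X_e K (dre q) (dde q).

Let C1 : R := 1 + L2norm L (fun=> 1) ^+ 4.

Let C10 : 0 <= C1.
Proof. by rewrite addr_ge0// exprn_ge0// L2norm_ge0. Qed.

Lemma X0_dev q T i : data_ok q -> solution q T ->
  ((Xstate P T 0 - X_e K (dre q) (dde q)) i 0) ^+ 2 <= C1 * dev0 q T ^+ 2.
Proof.
move=> qok sol; rewrite X_e_stack stackN /Xstate stackD; move: i.
have N0 : 0 <= L2norm L (fun=> 1) ^+ 4 by rewrite exprn_ge0// L2norm_ge0.
have d0 : 0 <= dev0 q T ^+ 2 by exact: sqr_ge0.
have Nd : 0 <= L2norm L (fun=> 1) ^+ 4 * dev0 q T ^+ 2 by exact: mulr_ge0.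
apply: (stackP (Pi := fun f => f (stack _ _ _ _) ^+ 2 <= _)).
- by rewrite stack_u /C1 mulrDl mul1r (le_trans (uD0_dev q T))// lerDl.
- by move=> j; rewrite stack_q /C1 mulrDl mul1r (le_trans (w0_dev qok sol j))// lerDr.
- by rewrite stack_s /C1 mulrDl mul1r (le_trans (zeta0_dev q T))// lerDl.
Qed.

Let kernel (i : 'I_(1 + pn P + 1)) (s : R) : R := (expm (s *: matA P) *m matB P) i 0.

Let kernel_continuous i : continuous (kernel i).
Proof.
move=> s; rewrite /kernel; under eq_fun do rewrite mxE.
apply: (cvg_sumr (f := fun l x => expm (x *: matA P) i l * matB P l 0)) => l.
by apply: cvgM; [exact: expm_continuous|exact: cvg_cst].
Qed.

Let kernel_integrable q T i a : solution q T ->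
  locally_integrable_ge0 (fun s => kernel i (a - s) * tv T s).
Proof.
move=> [y0 [z0 cl]].
apply: (@locally_integrable_mul R (tv T) (fun s => kernel i (a - s))).
  move=> s; apply: (@continuous_comp _ _ _ (fun x : R => a - x) (kernel i)).
    by apply: continuousB; [exact: cst_continuous|exact: cvg_id].
  exact: kernel_continuous.
exact: (tv_locally_integrable cl).
Qed.

Let kernel_lt0 q T i a s : solution q T -> s < 0 -> kernel i (a - s) * tv T s = 0.
Proof. by move=> [y0 [z0 cl]] s0; rewrite (tv_lt0 cl s0) mulr0. Qed.

Lemma predictor0 q T : solution q T -> predictor P T 0 = 0.
Proof.
move=> sol; apply/colP => i; rewrite !mxE.
transitivity (\int[@lebesgue_measure R]_(s in `[(0 - D)%R, 0%R])
    (kernel i (0 - D - s) * tv T s))%R => //.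
have ki := kernel_integrable i (0 - D) sol.
have kz s : s < 0 -> kernel i (0 - D - s) * tv T s = 0 by exact: kernel_lt0 sol.
rewrite (running_integralB ki kz) ?lexx//; last by rewrite sub0r oppr_le0 ltW.
by rewrite running_integral0 running_integral_lt0 ?subrr// sub0r oppr_lt0.
Qed.

Lemma decays_dZ : decays (fun _ q T t => \sum_i (dZ q T t i 0) ^+ 2).
Proof.
exists (\sum_(i < 1 + pn P + 1) Kz * C1) => [|q qok].
  by apply: sumr_ge0 => i _; exact: mulr_ge0.
have [rho v h] := Gamma_majorant qok.
have [rho' v' h'] := Kz_decay v.
exists (fun t => \sum_(i < 1 + pn P + 1) rho' t); first exact: vanishing_sum.
move=> _ T sol t t0; rewrite !mulr_suml -big_split/=; apply: ler_sum => i _.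
have [y0 [z0 cl]] := sol.
rewrite -(mulrA Kz).
apply: (h' (pD P) (C1 * dev0 q T ^+ 2) (dGamma q) (dZ q T)) => //.
- split=> [j|s s0 sD j].
    rewrite (_ : (fun t => _) = (fun t => Zstate P T t j 0 - X_e K (dre q) (dde q) j 0)).
      apply: within_continuousBr; last exact: within_continuous_cst.
      exact: (Zstate_continuous ok cl).
    by apply/funext => x; rewrite subr_mxE.
  rewrite (_ : (fun t => _) = (fun t => Zstate P T t j 0 - X_e K (dre q) (dde q) j 0)); last first.
    by apply/funext => x; rewrite subr_mxE.
  have -> : matAK K *m dZ q T s + dGamma q s =
      matAK K *m Zstate P T s + Gamma_e P (dr q s) (dd q s).
    rewrite /dZ /dGamma mulmxBr (X_e_equation HK) opprK addrACA.
    by rewrite [X in _ + X]addrC addNr addr0.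
  have [[_ _ _ dC1] _] := qok.
  have := is_deriveBr (Zstate_is_derive ok dC1 cl j s0 sD)
    (is_derive_cst (X_e K (dre q) (dde q) j 0) s 1).
  by rewrite subr0.
- move=> j; rewrite /dZ ZstateE (predictor0 sol) addr0; exact: X0_dev.
- by rewrite mulr_ge0// sqr_ge0.
Qed.

Lemma tv_deviation q T t : data_ok q -> solution q T -> 0 <= t ->
  tv T t = (K *m dZ q T t) 0 0.
Proof.
move=> qok [y0 [z0 cl]] t0; rewrite (tv_feedback cl t0) /dZ mulmxBr.
by rewrite subr_mxE (K_X_e HK) subr0.
Qed.

Lemma decays_tv : decays (fun _ _ T t => tv T t ^+ 2).
Proof.
have [c c0 hc] := row_functional_sum K.
apply: decays_le (decaysZ c0 decays_dZ) => N q T t qok sol t0.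
by rewrite (tv_deviation qok sol t0); exact: hc.
Qed.

Lemma decays_vD : decays (fun _ _ T t => tv T (t - D) ^+ 2).
Proof.
apply: decays_le (decays_delay _ decays_tv) => [N q T t _ [y0 [z0 cl]] t0|N q T t].
  by case: ltP => // tD; rewrite (tv_lt0 cl) ?subr_lt0// expr0n.
exact: sqr_ge0.
Qed.

(** The derivative of the control, as read off the closed-loop equation of [Z]. *)
Definition dv q T t := (K *m (matAK K *m dZ q T t + dGamma q t)) 0 0.

Lemma decays_dv : decays (fun _ q T t => if t < D then 0 else dv q T (t - D) ^+ 2).
Proof.
apply: (decays_delay (g := fun _ q T t => dv q T t ^+ 2)) => [N q T t|].
  exact: sqr_ge0.
have [c1 c10 h1] := row_functional_sum (K *m matAK K).
have [c2 c20 h2] := row_functional_bound K.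
have dG : decays (fun _ q _ t => ((K *m dGamma q t) 0 0) ^+ 2).
  apply: decays_data => q qok; have [rho v h] := Gamma_majorant qok.
  exists (fun t => c2 * rho t); first exact: vanishingZ.
  by move=> t t0; apply: h2; exact: h.
apply: decays_le (decaysD (decaysZ (_ : 0 <= 2) (decaysZ c10 decays_dZ))
  (decaysZ (_ : 0 <= 2) dG)) => // N q T t qok sol t0.
rewrite /dv mulmxDr mulmxA mxE; apply: (le_trans (sqrD_le _ _)).
by rewrite lerD2r ler_wpM2l// h1.
Qed.

(** The kernel is bounded over the window, and so is the control by [decays_tv]. *)
Lemma decays_predictor i : decays (fun _ _ T t => (predictor P T t i 0) ^+ 2).
Proof.
have [B [_ hB]] := compact_bounded (continuous_compact
  (continuous_within (A := `[- D, 0]%classic) (@kernel_continuous i))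
  (@segment_compact R (- D) 0)).
pose b := Num.max 0 (B + 1).
have b0 : 0 <= b by rewrite le_max lexx.
have fb s : - D <= s <= 0 -> `|kernel i s| <= b.
  move=> sD; rewrite le_max; apply/orP; right; apply: (hB (B + 1)); first by rewrite ltrDl.
  by exists s.
apply: (decays_window (_ : 0 <= (b * D) ^+ 2) decays_tv); first exact: sqr_ge0.
move=> N q T t M qok sol t0 M0 hM; have [y0 [z0 cl]] := sol.
rewrite -[X in _ * X]sqr_sqrtr// -exprMn -real_normK ?num_real//.
rewrite lerXn2r ?nnegrE ?mulr_ge0 ?sqrtr_ge0 ?(ltW D0)//.
rewrite mxE.
have fvi : (@lebesgue_measure R).-integrable `[t - D, t]
    (EFin \o (fun s => kernel i (t - D - s) * tv T s)).
  apply: locally_integrable_itv; first exact: kernel_integrable sol.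
  by move=> s; exact: kernel_lt0 sol.
apply: (@le_trans _ _ (\int[@lebesgue_measure R]_(s in `[(t - D)%R, t])
    `|kernel i (t - D - s) * tv T s|)%R).
  by apply: (le_normr_Rintegral _ fvi); exact: measurable_itv.
have -> : b * D * Num.sqrt M =
    (\int[@lebesgue_measure R]_(s in `[(t - D)%R, t]) (b * Num.sqrt M))%R.
  rewrite Rintegral_cst//.
  transitivity (b * Num.sqrt M * fine ((@lebesgue_measure R : set (measurableTypeR R) -> \bar R) `[t - D, t]%classic)) => //.
  rewrite lebesgue_measure_itv/= lte_fin ltrBlDr ltrDl D0 -EFinD/=; ring.
apply: le_Rintegral => //.
- exact: integrable_norm.
- apply: continuous_compact_integrable; first exact: segment_compact.
  exact: within_continuous_cst.
move=> s; rewrite /= in_itv/= => /andP[s1 s2]; rewrite normrM.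
apply: ler_pM => //.
  by apply: fb; apply/andP; split; lra.
have [s0|s0] := ltP s 0; first by rewrite (tv_lt0 cl)// normr0 sqrtr_ge0.
by rewrite -sqrtr_sqr ler_wsqrtr// hM// s1 s2.
Qed.

Lemma decays_X i : decays (fun _ q T t => ((Xstate P T t - X_e K (dre q) (dde q)) i 0) ^+ 2).
Proof.
apply: decays_le (decaysD (decaysZ (ler0n _ 2) decays_dZ)
  (decaysZ (ler0n _ 2) (decays_predictor i))) => N q T t qok sol t0.
have -> : Xstate P T t - X_e K (dre q) (dde q) = dZ q T t - predictor P T t.
  by rewrite /dZ ZstateE addrAC addrK.
rewrite subr_mxE; apply: (le_trans (sqrD_le _ _)); rewrite sqrrN lerD2r ler_wpM2l//.
by rewrite (bigD1 i)//= lerDl sumr_ge0// => j _; exact: sqr_ge0.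
Qed.

Lemma decays_uD : decays (fun _ q T t => (uD P T t - u_e K (dre q) (dde q)) ^+ 2).
Proof.
apply: decays_le (decays_X (lshift 1 (lshift (pn P) ord0))) => N q T t qok sol t0.
rewrite X_e_stack stackN /Xstate stackD.
by rewrite -stack_entry_u stack_u.
Qed.

Lemma decays_w (j : 'I_(pn P)) : decays (fun _ q T t =>
  (coeff P (w P T t) j - wcoef_e K (dre q) (dde q) j) ^+ 2).
Proof.
apply: decays_le (decays_X (lshift 1 (rshift 1 j))) => N q T t qok sol t0.
rewrite X_e_stack stackN /Xstate stackD.
by rewrite -stack_entry_q stack_q.
Qed.

(** * High modes *)

Let na := L2norm L (fun x => x / pL P * pc P x) ^+ 2.
Let nb := L2norm L (fun x => - (x / pL P)) ^+ 2.
Let na0 : 0 <= na. Proof. exact: sqr_ge0. Qed.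
Let nb0 : 0 <= nb. Proof. exact: sqr_ge0. Qed.

Let sum_a N : \sum_(n <= j < N) acoef P j ^+ 2 <= na.
Proof. exact: (Bessel_from ok _ _ (acoef_in_L2 ok)). Qed.

Let sum_b N : \sum_(n <= j < N) bcoef P j ^+ 2 <= nb.
Proof. exact: (Bessel_from ok _ _ (bcoef_in_L2 ok)). Qed.

(** The time derivative of the [j]-th mode without its term in the delayed control,
    which jumps at time [D]. *)
Definition mode_rate q T j t :=
  plam P j * coeff P (w P T t) j + acoef P j * uD P T t + coeff P (dd q t) j.

Section high_modes.
Variables (q : data) (T : traj R).
Hypothesis qok : data_ok q.
Hypothesis sol : solution q T.

Let dC1 : L2C1 (pL P) (dd q) (dd' q). Proof. by case: qok => -[]. Qed.

(** Subtracting the steady state equation of the [j]-th mode, which has value 0. *)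
Lemma mode_rate_deviation j t : 0 <= t -> mode_rate q T j t =
  coeff P (opA (pc P) (w P T t - dwe q) (wxx T t - dwe2 q)) j +
  acoef P j * (uD P T t - u_e K (dre q) (dde q)) + coeff P (dd q t - dde q) j.
Proof.
move=> t0; have [[de2 we_ok _ _] _] := qok; have [weA _] := we_ok.
have [[we_H1 _] _ _] := weA; have we2 := H1_in_L2 (plant_L0 ok) we_H1.
have [y0 [z0 cl]] := sol.
rewrite (coeff_opA ok j (dw_domA qok sol t0)) (coeffB ok j (dd_in_L2 qok t0) de2).
rewrite (coeffB ok j (w_in_L2 ok cl t0) we2) (coeff_we ok we_ok) /mode_rate.
apply/eqP; rewrite -subr_eq0; apply/eqP.
by rewrite -[RHS](wcoef_e_steady ok HK (dre q) (dde q) j); ring.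
Qed.

Lemma mode_rate_continuous j : {within `[0, +oo[, continuous (mode_rate q T j)}.
Proof.
have [y0 [z0 cl]] := sol.
apply: within_continuousDr; first apply: within_continuousDr.
- apply: within_continuousZ.
  exact: (w_functional_continuous ok cl (bounded_functional_coeff ok j)).
- by apply: within_continuousZ; exact: (uD_continuous cl).
exact: (functional_continuous (bounded_functional_coeff ok j) (dd_in_L2 qok) (dd_L2continuous qok)).
Qed.

Lemma mode_rate_is_derive j t : 0 < t -> t != D -> is_derive t 1 (mode_rate q T j)
  (plam P j * (mode_rate q T j t + bcoef P j * tv T (t - D)) +
   acoef P j * tv T (t - D) + coeff P (dd' q t) j).
Proof.
move=> t0 tD; have [y0 [z0 cl]] := sol.
have [d1 d2 d3 _] := dC1 (ltW t0).
apply: is_deriveDr; first apply: is_deriveDr.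
- by apply: is_deriveZr; exact: (wcoef_is_derive ok dC1 cl j t0 tD).
- by apply: is_deriveZr; exact: (uD_is_derive ok cl tD).
exact: (functional_is_derive (bounded_functional_coeff ok j) t0 (dd_in_L2 qok) d2 d3).
Qed.

(** Half of the damping, [2l m^2 <= - 4k m^2], absorbs the cross term by completing the
    square. *)
Let energy_term (l m p : R) : l <= - (2 * k) ->
  (l * m + p) * m + m * (l * m + p) <= - (2 * k) * (m * m) + (2 * k)^-1 * p ^+ 2.
Proof.
move=> lk; rewrite -subr_ge0.
have -> : - (2 * k) * (m * m) + (2 * k)^-1 * p ^+ 2 - ((l * m + p) * m + m * (l * m + p)) =
  2 * (- (2 * k) - l) * m ^+ 2 + (2 * k)^-1 * (2 * k * m - p) ^+ 2.
  by field; rewrite gt_eqF.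
rewrite addr_ge0// mulr_ge0 ?sqr_ge0//; first by rewrite mulr_ge0// subr_ge0.
by rewrite invr_ge0 mulr_ge0// ltW.
Qed.

Let energy_sum N (m p : nat -> R) :
  \sum_(n <= j < N) ((plam P j * m j + p j) * m j + m j * (plam P j * m j + p j)) <=
  - (2 * k) * (\sum_(n <= j < N) m j * m j) + (2 * k)^-1 * \sum_(n <= j < N) p j ^+ 2.
Proof.
rewrite !mulr_sumr -big_split/=; apply: ler_sum_nat => j /andP[nj _].
by apply: energy_term; apply: le_trans k_lam; exact: plam_neg.
Qed.

Let energy0 N t := \sum_(n <= j < N) mode_rate q T j t * mode_rate q T j t.

Lemma energy0_initial N : energy0 N 0 <=
  3 * ((1 + na) * dev0 q T ^+ 2 + L2norm L (dd q 0 - dde q) ^+ 2).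
Proof.
have [[de2 _ _ _] _] := qok; have d2 := in_L2B (dd_in_L2 qok (lexx 0)) de2.
have Aw2 := opA_in_L2 ok (dw_domA qok sol (lexx 0)).
rewrite /energy0; under eq_bigr do rewrite -expr2 mode_rate_deviation//.
apply: (@le_trans _ _ (\sum_(n <= j < N) 3 *
  (coeff P (opA (pc P) (w P T 0 - dwe q) (wxx T 0 - dwe2 q)) j ^+ 2 +
   acoef P j ^+ 2 * (uD P T 0 - u_e K (dre q) (dde q)) ^+ 2 +
   coeff P (dd q 0 - dde q) j ^+ 2))).
  by apply: ler_sum_nat => j _; rewrite -exprMn; exact: sqrD3_le.
rewrite -mulr_sumr ler_wpM2l// !big_split/= -mulr_suml mulrDl mul1r.
apply: lerD; last exact: Bessel_from.
apply: lerD; first by apply: (le_trans (Bessel_from ok _ _ Aw2)); exact: Aw0_dev.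
apply: ler_pM => //; first by apply: sumr_ge0 => j _; exact: sqr_ge0.
  exact: sqr_ge0.
exact: uD0_dev.
Qed.

(** Up to time [D] the delayed control is 0, and Gronwall applies on a bounded interval
    with a bounded forcing. *)
Lemma energy0_early N M t : 0 <= t <= D ->
  (forall s, 0 <= s -> L2norm L (dd' q s) ^+ 2 <= M) ->
  energy0 N t <= energy0 N 0 + (2 * k)^-1 * M / (2 * k).
Proof.
move=> /andP[t0 tD] hM; have [y0 [z0 cl]] := sol.
have M0 : 0 <= M by apply: le_trans (hM 0 (lexx _)); exact: sqr_ge0.
have k20 : 0 < 2 * k by rewrite mulr_gt0.
have M20 : 0 <= (2 * k)^-1 * M by rewrite mulr_ge0// invr_ge0 ltW.
pose dm j s := plam P j * mode_rate q T j s + coeff P (dd' q s) j.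
have := @Gronwall R (energy0 N) (fun s => \sum_(n <= j < N)
  (dm j s * mode_rate q T j s + mode_rate q T j s * dm j s)) 0 t D k
  ((2 * k)^-1 * M) 0 t0 k0 M20 (lexx _) _ _.
rewrite mul0r mul0r addr0 subr0 => h; apply: (le_trans (h _ _)).
- apply: within_continuous_sum => j _.
  have c : {within `[0, t], continuous (mode_rate q T j)}.
    by apply: continuous_subspaceW (@mode_rate_continuous j); apply: subset_itvl.
  exact: within_continuousM.
- move=> s /andP[s0 st] sD; split.
    apply: is_derive_sumr => j _.
    have := mode_rate_is_derive j s0 sD.
    rewrite (tv_lt0 cl) ?subr_lt0 ?(lt_le_trans st)// !mulr0 !addr0.
    by move=> dj; exact: is_deriveMr.
  apply: (le_trans (energy_sum N (fun j => mode_rate q T j s) (fun j => coeff P (dd' q s) j))).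
  rewrite mul0r addr0 lerD2l ler_wpM2l ?invr_ge0 ?(ltW k20)//.
  apply: le_trans (hM s (ltW s0)); apply: (Bessel_from ok).
  exact: (dd'_in_L2 qok (ltW s0)).
rewrite lerD2r ler_piMl//; first by apply: sumr_ge0 => j _; rewrite -expr2 sqr_ge0.
by rewrite expR_le1// mulNr oppr_le0 mulr_ge0// ltW.
Qed.

(** The derivative of a mode after time [D], where [kz], continuous on the half-line,
    stands for the control, which jumps at time 0. *)
Let kz t := (K *m Zstate P T t) 0 0.
Let late j t := mode_rate q T j t + bcoef P j * kz (t - D).
Let energy1 N t := \sum_(n <= j < N) late j t * late j t.

Let kz_tv t : D <= t -> kz (t - D) = tv T (t - D).
Proof.
by move=> Dt; have [y0 [z0 cl]] := sol; rewrite (tv_feedback cl) ?subr_ge0.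
Qed.

Let kz_is_derive t : D < t -> t != D + D ->
  is_derive t 1 (fun s => kz (s - D)) (dv q T (t - D)).
Proof.
move=> Dt tDD; have [y0 [z0 cl]] := sol.
apply: is_derive_translate; rewrite /kz /dv.
have tD0 : 0 < t - D by rewrite subr_gt0.
have tDD' : t - D != D by rewrite subr_eq.
have -> : matAK K *m dZ q T (t - D) + dGamma q (t - D) =
    matAK K *m Zstate P T (t - D) + Gamma_e P (dr q (t - D)) (dd q (t - D)).
  rewrite /dZ /dGamma mulmxBr (X_e_equation HK) opprK addrACA.
  by rewrite [X in _ + X]addrC addNr addr0.
by apply: row_derive => i; exact: (Zstate_is_derive ok dC1 cl i tD0 tDD').
Qed.

Let late_continuous j : {within `[D, +oo[, continuous (late j)}.
Proof.
have [y0 [z0 cl]] := sol.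
apply: within_continuousDr.
  by apply: continuous_subspaceW (@mode_rate_continuous j); apply: subset_itvr; rewrite bnd_simp ltW.
apply: within_continuousZ; apply: within_continuous_translate.
exact: (feedback_continuous ok cl).
Qed.

Let late_is_derive j t : D < t -> t != D + D -> is_derive t 1 (late j)
  (plam P j * late j t + (acoef P j * tv T (t - D) + coeff P (dd' q t) j +
     bcoef P j * dv q T (t - D))).
Proof.
move=> Dt tDD.
have t0 : 0 < t by exact: lt_trans Dt.
have tD : t != D by rewrite gt_eqF.
have -> : plam P j * late j t + (acoef P j * tv T (t - D) + coeff P (dd' q t) j +
     bcoef P j * dv q T (t - D)) =
  plam P j * (mode_rate q T j t + bcoef P j * tv T (t - D)) +
   acoef P j * tv T (t - D) + coeff P (dd' q t) j + bcoef P j * dv q T (t - D).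
  by rewrite /late (kz_tv (ltW Dt)); ring.
exact: is_deriveDr (mode_rate_is_derive j t0 tD)
  (is_deriveZr (bcoef P j) (kz_is_derive Dt tDD)).
Qed.

Lemma energy1_start N : energy1 N D <= 2 * energy0 N D + 2 * nb * tv T 0 ^+ 2.
Proof.
have kz0 : kz (D - D) = tv T 0 by rewrite kz_tv ?subrr.
rewrite /energy1 /late kz0.
apply: (@le_trans _ _ (\sum_(n <= j < N) (2 * (mode_rate q T j D * mode_rate q T j D)
   + 2 * tv T 0 ^+ 2 * bcoef P j ^+ 2))).
  apply: ler_sum_nat => j _; rewrite -!expr2 -mulrA -exprMn mulrC (mulrC (tv T 0)).
  by rewrite mulrC; exact: sqrD_le.
rewrite big_split/= -!mulr_sumr lerD2l (mulrAC 2 nb).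
apply: ler_wpM2l (sum_b N).
by rewrite mulr_ge0// sqr_ge0.
Qed.

Lemma energy1_dissipation N t : D < t -> t != D + D ->
  is_derive t 1 (energy1 N) (\sum_(n <= j < N)
    ((plam P j * late j t + (acoef P j * tv T (t - D) + coeff P (dd' q t) j +
        bcoef P j * dv q T (t - D))) * late j t +
     late j t * (plam P j * late j t + (acoef P j * tv T (t - D) + coeff P (dd' q t) j +
        bcoef P j * dv q T (t - D))))) /\
  \sum_(n <= j < N)
    ((plam P j * late j t + (acoef P j * tv T (t - D) + coeff P (dd' q t) j +
        bcoef P j * dv q T (t - D))) * late j t +
     late j t * (plam P j * late j t + (acoef P j * tv T (t - D) + coeff P (dd' q t) j +
        bcoef P j * dv q T (t - D)))) <=
  - (2 * k) * energy1 N t + (2 * k)^-1 * (3 * (na * tv T (t - D) ^+ 2 +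
     L2norm L (dd' q t) ^+ 2 + nb * dv q T (t - D) ^+ 2)).
Proof.
move=> Dt tDD; split.
  apply: is_derive_sumr => j _.
  by apply: is_deriveMr; exact: late_is_derive.
apply: (le_trans (energy_sum N (fun j => late j t) _)).
rewrite lerD2l ler_wpM2l ?invr_ge0//; first by rewrite mulr_ge0// ltW.
apply: (@le_trans _ _ (\sum_(n <= j < N) 3 * (acoef P j ^+ 2 * tv T (t - D) ^+ 2 +
   coeff P (dd' q t) j ^+ 2 + bcoef P j ^+ 2 * dv q T (t - D) ^+ 2))).
  by apply: ler_sum_nat => j _; rewrite -!exprMn; exact: sqrD3_le.
rewrite -mulr_sumr ler_wpM2l// !big_split/= -!mulr_suml.
apply: lerD; first apply: lerD.
- by rewrite ler_wpM2r ?sqr_ge0.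
- by apply: (Bessel_from ok); apply: (dd'_in_L2 qok); apply: ltW; exact: lt_trans Dt.
by rewrite ler_wpM2r ?sqr_ge0.
Qed.

Lemma energy1_continuous N : {within `[D, +oo[, continuous (energy1 N)}.
Proof.
by apply: within_continuous_sum => j _; apply: within_continuousM; exact: late_continuous.
Qed.

Lemma energy0_rate N t : t < D -> \sum_(n <= j < N)
   (mode_rate q T j t + bcoef P j * tv T (t - D)) ^+ 2 = energy0 N t.
Proof.
move=> tD; have [y0 [z0 cl]] := sol; apply: eq_bigr => j _.
by rewrite (tv_lt0 cl) ?subr_lt0// mulr0 addr0 expr2.
Qed.

Lemma energy1_rate N t : D <= t -> \sum_(n <= j < N)
   (mode_rate q T j t + bcoef P j * tv T (t - D)) ^+ 2 = energy1 N t.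
Proof. by move=> tD; apply: eq_bigr => j _; rewrite /late kz_tv// expr2. Qed.

End high_modes.

(** The energy is bounded up to time [D] by its initial value, and this bound starts
    [decay_step] on the half-line from [D], with [D + D] as exceptional time. *)
Lemma decays_rate : decays (fun N q T t => \sum_(n <= j < N)
   (mode_rate q T j t + bcoef P j * tv T (t - D)) ^+ 2).
Proof.
have k20 : 0 < 2 * k by rewrite mulr_gt0.
have [Cv Cv0 hv] := decays_tv.
have dp : decays (fun _ q T t => (2 * k)^-1 * (3 * (na * tv T (t - D) ^+ 2 +
    L2norm L (dd' q t) ^+ 2 + nb * (if t < D then 0 else dv q T (t - D) ^+ 2)))).
  apply: decaysZ; first by rewrite invr_ge0 ltW.
  apply: decaysZ => //; apply: decaysD; last exact: decaysZ decays_dv.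
  by apply: decaysD; [exact: decaysZ decays_vD|exact: decays_dd'].
have [Cp Cp0 hp] := dp.
(* [E0 * J ^+ 2 + A0] bounds the energy on the interval from 0 to [D], and [C0 * J ^+ 2 + A]
   at time [D] once the jump of the control is counted in. *)
pose E0 := 3 * (1 + na).
have E00 : 0 <= E0 by rewrite mulr_ge0// addr_ge0.
pose C0 := 2 * E0 + 2 * nb * Cv.
have C00 : 0 <= C0 by rewrite addr_ge0// mulr_ge0// mulr_ge0.
exists (expR (k * D) * E0 + expR (k * D) * (C0 + 2 * Cp / k)).
  have h : 0 <= 2 * Cp / k by rewrite divr_ge0 ?mulr_ge0// ltW.
  by apply: addr_ge0; apply: mulr_ge0; rewrite ?expR_ge0// addr_ge0.
move=> q qok.
have [rd' vd' hd'] := dd'_majorant qok; have [rv vv {}hv] := hv q qok.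
have [rp vp {}hp] := hp q qok.
pose A0 := 3 * L2norm L (dd q 0 - dde q) ^+ 2 + (2 * k)^-1 * rd' 0 / (2 * k).
have rd'0 : 0 <= rd' 0 by have [_ p _] := vd'; exact: p.
have rv0 : 0 <= rv 0 by have [_ p _] := vv; exact: p.
have A00 : 0 <= A0.
  apply: addr_ge0; first by rewrite mulr_ge0 ?sqr_ge0.
  by rewrite !mulr_ge0 ?invr_ge0 ?(ltW k20).
pose A := 2 * A0 + 2 * nb * rv 0.
have A_ge0 : 0 <= A.
  by apply: addr_ge0; [exact: mulr_ge0|apply: mulr_ge0 => //; exact: mulr_ge0].
have [rho v h] := decay_step k0 (ltW D0) A_ge0 vp.
have [_ rho0 _] := v.
exists (fun t => expR (k * D) * A0 * expR (- k * t) + rho t).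
  apply: vanishingD => //; apply: vanishingZ; last exact: vanishing_exp.
  by rewrite mulr_ge0 ?expR_ge0.
move=> N T sol t t0.
have J0 : 0 <= dev0 q T ^+ 2 by exact: sqr_ge0.
have early s : 0 <= s <= D -> \sum_(n <= j < N) mode_rate q T j s * mode_rate q T j s <=
    E0 * dev0 q T ^+ 2 + A0.
  move=> sD; have hd0 x : 0 <= x -> L2norm L (dd' q x) ^+ 2 <= rd' 0.
    by move=> x0; apply: (le_trans (hd' x x0)); have [p _ _] := vd'; exact: p.
  apply: (le_trans (energy0_early qok sol N sD hd0)).
  by rewrite /A0 addrA lerD2r (le_trans (energy0_initial qok sol N))// /E0; lra.
have e1 : 1 <= expR (k * D) by rewrite -[leLHS]expR0 ler_expR mulr_ge0// ltW.
have ekt : 0 <= expR (- k * t) by exact: expR_ge0.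
have [tD|Dt] := ltP t D.
  rewrite (energy0_rate sol N tD).
  have t0D : 0 <= t <= D by rewrite t0 ltW.
  apply: (le_trans (early t t0D)).
  have eD : 1 <= expR (k * D) * expR (- k * t).
    rewrite -expRD -[leLHS]expR0 ler_expR mulNr subr_ge0 ler_pM2l//.
    exact: ltW.
  have EA : 0 <= E0 * dev0 q T ^+ 2 + A0 by rewrite addr_ge0// mulr_ge0.
  apply: (@le_trans _ _ (expR (k * D) * expR (- k * t) * (E0 * dev0 q T ^+ 2 + A0))).
    by rewrite ler_peMl.
  have extra : 0 <= expR (k * D) * (C0 + 2 * Cp / k) * dev0 q T ^+ 2 * expR (- k * t) + rho t.
    rewrite addr_ge0 ?rho0// mulr_ge0// mulr_ge0// mulr_ge0 ?expR_ge0// addr_ge0//.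
    by rewrite divr_ge0 ?mulr_ge0// ltW.
  rewrite -subr_ge0; apply: le_trans extra _.
  by rewrite le_eqVlt; apply/orP; left; apply/eqP; ring.
rewrite (energy1_rate (q := q) sol N Dt).
have V0 := energy1_start (q := q) sol N.
have VD : \sum_(n <= j < N) (mode_rate q T j D + bcoef P j * (K *m Zstate P T (D - D)) 0 0) *
    (mode_rate q T j D + bcoef P j * (K *m Zstate P T (D - D)) 0 0) <=
    C0 * dev0 q T ^+ 2 + A.
  apply: (le_trans V0).
  have DD : 0 <= D <= D by rewrite lexx ltW.
  have b1 := early D DD.
  have b2 := hv N T sol 0 (lexx _); rewrite mulr0 expR0 mulr1 in b2.
  have b3 : 2 * nb * tv T 0 ^+ 2 <= 2 * nb * (Cv * dev0 q T ^+ 2 + rv 0).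
    by rewrite ler_wpM2l// mulr_ge0.
  by rewrite /C0 /A; move: b1 b3; set e := \sum_(_ <= _ < _) _; lra.
have dis := energy1_dissipation qok sol N.
have := h Cp C0 (dev0 q T ^+ 2) (D + D) _ _ Cp0 C00 J0 (energy1_continuous qok sol (N := N)).
move=> step; apply: (le_trans (step _ _ VD t Dt)) => [s Ds sDD|].
  have [d1 d2] := dis s Ds sDD.
  split; first exact: d1.
  apply: (le_trans d2); rewrite -[leRHS]addrA lerD2l.
  have := hp N T sol s (ltW (lt_trans D0 Ds)).
  by rewrite ltNge (ltW Ds).
have extra : 0 <= expR (k * D) * E0 * dev0 q T ^+ 2 * expR (- k * t) +
    expR (k * D) * A0 * expR (- k * t).
  have eD0 : 0 <= expR (k * D) by exact: expR_ge0.
  apply: addr_ge0; apply: mulr_ge0 => //; last exact: mulr_ge0.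
  by apply: mulr_ge0 => //; exact: mulr_ge0.
rewrite -subr_ge0; apply: le_trans extra _.
by rewrite le_eqVlt; apply/orP; left; apply/eqP; ring.
Qed.

(** * Slope at the left end *)

Lemma decays_sum (I : Type) (r : seq I) (g : I -> nat -> data -> traj R -> R -> R) :
  (forall i, decays (g i)) -> decays (fun N q T t => \sum_(i <- r) g i N q T t).
Proof.
move=> h; elim: r => [|i r ih].
  apply: decays_le (_ : decays (fun _ _ _ _ => 0)).
    by move=> N q T t _ _ _; rewrite big_nil.
  by apply: decays_data => q _; exists (fun=> 0) => //; exact: vanishing0.
apply: decays_le (decaysD (h i) ih) => N q T t _ _ _.
by rewrite big_cons.
Qed.

Definition Adw q T t := opA (pc P) (w P T t - dwe q) (wxx T t - dwe2 q).

(** [mode_rate_deviation] solved for the mode of [Adw]. *)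
Lemma decays_Adw : decays (fun N q T t => \sum_(n <= j < N) coeff P (Adw q T t) j ^+ 2).
Proof.
apply: decays_le (decaysZ (ler0n _ 4) (decaysD (decaysD (decaysD decays_rate
  (decaysZ na0 decays_uD)) decays_dd) (decaysZ nb0 decays_vD))) => N q T t qok sol t0.
have [[de2 _ _ _] _] := qok.
set u := uD P T t - u_e _ _ _; set v := tv T (t - D).
apply: (@le_trans _ _ (\sum_(n <= j < N) 4 * ((mode_rate q T j t + bcoef P j * v) ^+ 2 +
   acoef P j ^+ 2 * u ^+ 2 + coeff P (dd q t - dde q) j ^+ 2 + bcoef P j ^+ 2 * v ^+ 2))).
  apply: ler_sum_nat => j _; rewrite -!exprMn.
  have -> : coeff P (Adw q T t) j = mode_rate q T j t + bcoef P j * v +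
      - (acoef P j * u) + - coeff P (dd q t - dde q) j + - (bcoef P j * v).
    by rewrite (mode_rate_deviation qok sol j t0) /Adw -/u; ring.
  by apply: (le_trans (sqrD4_le _ _ _ _)); rewrite !sqrrN.
rewrite -mulr_sumr; apply: ler_wpM2l => //; rewrite !big_split/= -!mulr_suml.
apply: lerD; first apply: lerD; first apply: lerD => //.
- by rewrite ler_wpM2r ?sqr_ge0.
- by apply: (Bessel_from ok); apply: in_L2B de2; exact: dd_in_L2.
- by rewrite ler_wpM2r ?sqr_ge0.
Qed.

(** The bound of [decays_Adw] is uniform in [N]. *)
Lemma decays_tail : decays (fun _ q T t => tail_sum P (coeff P (Adw q T t)) ^+ 2).
Proof.
have [Kap Kap0 hK] := tail_sum_bound ok; have [C C0 h] := decays_Adw.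
exists (Kap * C) => [|q qok]; first exact: mulr_ge0.
have [rho v {}h] := h q qok.
exists (fun t => Kap * rho t) => [|_ T sol t t0]; first exact: vanishingZ.
have -> : Kap * C * dev0 q T ^+ 2 * expR (- k * t) + Kap * rho t =
  Kap * (C * dev0 q T ^+ 2 * expR (- k * t) + rho t) by ring.
apply: hK => [|N]; last exact: h.
exact: (opA_in_L2 ok (dw_domA qok sol t0)).
Qed.

(** Expansion of the slope of [w - we] at 0, the affine lifting of the input accounting for
    the first term. *)
Lemma slope_deviation q T t : data_ok q -> solution q T -> 0 <= t ->
  tyx T t 0 - dre q = (pL P)^-1 * (uD P T t - u_e K (dre q) (dde q)) +
    \sum_(j < pn P) peig1 P j 0 *
       (coeff P (w P T t) j - wcoef_e K (dre q) (dde q) j) +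
    tail_sum P (coeff P (Adw q T t)).
Proof.
move=> qok sol t0; have [[de2 we_ok _ _] _] := qok; have [weA _] := we_ok.
have [[we_H1 _] _ _] := weA; have we2 := H1_in_L2 (plant_L0 ok) we_H1.
have [y0 [z0 cl]] := sol.
have := left_slope_modal ok (dw_domA qok sol t0); rewrite -/(Adw q T t).
under eq_bigr do rewrite (coeffB ok _ (w_in_L2 ok cl t0) we2) (coeff_we ok we_ok).
move=> E; have {}E : wx P T t 0 - dwe1 q 0 = _ := E.
rewrite -addrA -E /wx {1}(equilibrium_slope ok HK de2 we_ok); ring.
Qed.

Lemma decays_slope : decays (fun _ q T t => (tyx T t 0 - dre q) ^+ 2).
Proof.
have [c c0 hc] := row_functional_sum (\row_(j < pn P) peig1 P j 0).
apply: decays_le (decaysZ (ler0n _ 3) (decaysD (decaysD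
  (decaysZ (sqr_ge0 (pL P)^-1) decays_uD)
  (decaysZ c0 (decays_sum (index_enum 'I_(pn P)) decays_w))) decays_tail))
  => N q T t qok sol t0.
rewrite (slope_deviation qok sol t0); apply: (le_trans (sqrD3_le _ _ _)).
apply: ler_wpM2l => //; rewrite lerD2r exprMn lerD2l.
have := hc (\col_j (coeff P (w P T t) j - wcoef_e K (dre q) (dde q) j)).
rewrite mxE; under eq_bigr do rewrite !mxE.
by under [X in _ <= _ * X]eq_bigr do rewrite mxE.
Qed.

End decay.

Theorem corollary3 (R : realType) (P : plant R) (K : 'rV[R]_(1 + pn P + 1)) :
  plant_ok P -> Hurwitz (matAK K) ->
  exists C kappa : R, [/\ 0 < C, 0 < kappa &
    forall (re : R) (de we we1 we2 : R -> R)
           (r : R -> R) (d d' : R -> R -> R),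
      in_L2 (pL P) de -> is_w_e K re de we we1 we2 ->
      {within `[0, +oo[, continuous r} -> L2C1 (pL P) d d' ->
      r t @[t --> +oo] --> re ->
      L2cvg (pL P) +oo d de ->
      L2cvg (pL P) +oo d' (fun=> 0) ->
      exists rho : R -> R, rho t @[t --> +oo] --> 0 /\
        forall (y0 y01 y02 : R -> R) (z0 : R) (T : traj R),
          is_domA (pL P) y0 y01 y02 -> closed_loop K r d y0 z0 T ->
          tyx T t 0 @[t --> +oo] --> re /\
          forall t, 0 <= t ->
            `|tyx T t 0 - re| <=
              C * expR (- kappa * t) * initial_deviation K re de we we1 we2 T
              + rho t].
Proof.
move=> ok HK; have [k0 k00 hk0] := Hurwitz_decay HK.
(* [k] must suit both the Hurwitz matrix and the high modes, whose damping [- plam P (pn P)]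
   has to be at least [2 * k]. *)
pose k := Num.min k0 (- plam P (pn P) / 2).
have k_gt0 : 0 < k by rewrite lt_min k00 divr_gt0// oppr_gt0 (plam_n_lt0 ok).
have k_le : k <= k0 by rewrite ge_min lexx.
have k_lam : plam P (pn P) <= - (2 * k).
  have : k <= - plam P (pn P) / 2 by rewrite ge_min lexx orbT.
  by move=> ?; lra.
have [Kz Kz0 hKz] := hk0 k (introT andP (conj k_gt0 k_le)).
have [C C0 hC] := decays_slope ok HK k_gt0 k_lam Kz0 hKz.
(* The estimate is on squares, whence [k / 2]; adding 1 makes the constant positive. *)
exists (Num.sqrt C + 1), (k / 2); split; first by rewrite ltr_wpDl ?sqrtr_ge0.
  exact: divr_gt0.
move=> re de we we1 we2 r d d' de2 we_ok rc dC1 rl dl dl'.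
pose q := Data re de we we1 we2 r d d'.
have qok : data_ok K q by [].
have [rho [_ rho0 rhol] h] := hC q qok.
have srho : Num.sqrt (rho t) @[t --> +oo] --> (0 : R).
  by rewrite -[X in _ --> X]sqrtr0; apply: continuous_cvg => //; exact: sqrt_continuous.
exists (fun t => Num.sqrt (rho t)); split=> // y0 _ _ z0 T _ cl.
have sol : solution K q T by exists y0, z0.
have J0 : 0 <= initial_deviation K re de we we1 we2 T := dev0_ge0 K q T.
set J := initial_deviation _ _ _ _ _ _ _ in J0 *.
have bound t : 0 <= t -> `|tyx T t 0 - re| <=
    (Num.sqrt C + 1) * expR (- (k / 2) * t) * J + Num.sqrt (rho t).
  move=> t0; have e0 : 0 <= expR (- (k / 2) * t) by exact: expR_ge0.
  apply: (@le_trans _ _ (Num.sqrt C * expR (- (k / 2) * t) * J + Num.sqrt (rho t))); last first.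
    by rewrite lerD2r ler_wpM2r// ler_wpM2r// lerDl.
  have a0 : 0 <= Num.sqrt C * expR (- (k / 2) * t) * J.
    by rewrite !mulr_ge0 ?sqrtr_ge0.
  rewrite -(@ler_pXn2r _ 2) ?nnegrE ?addr_ge0 ?sqrtr_ge0// real_normK ?num_real//.
  apply: (le_trans (h 0%N T sol t t0)); rewrite [leRHS]sqrrD.
  rewrite (sqr_sqrtr (rho0 t t0)).
  rewrite !exprMn sqr_sqrtr// -expRM_natl.
  have -> : 2 * (- (k / 2) * t) = - k * t by field.
  rewrite lerD2r (mulrAC C) lerDl mulrn_wge0//.
  by apply: mulr_ge0 => //; exact: sqrtr_ge0.
split=> //; apply/cvgrPdist_le => /= eps eps0.
have bl : (Num.sqrt C + 1) * expR (- (k / 2) * t) * J + Num.sqrt (rho t) @[t --> +oo]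
    --> (0 : R).
  rewrite -[X in _ --> X](_ : (Num.sqrt C + 1) * 0 * J + 0 = 0); last by ring.
  apply: cvgD srho; apply: cvgM; last exact: cvg_cst.
  by apply: cvgM; [exact: cvg_cst|apply: cvg_expR_decay; exact: divr_gt0].
near=> t; rewrite distrC; apply: (le_trans (bound t _)).
  by near: t; apply: nbhs_pinfty_ge; exact: num_real.
near: t; have /cvgrPdist_le/(_ eps eps0) := bl.
by apply: filterS => t /=; rewrite sub0r normrN => /(le_trans (ler_norm _)).
Unshelve. all: by end_near. Qed.
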